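(* Let $(M,g,J)$ be a pseudo-Kähler manifold with Kähler form $\omega=g(J\cdot,\cdot)$, endowed with a Killing vector field $Z$ such that $g(Z,Z)$ is nowhere zero, and let $f$ be a smooth function on $M$ with $df=-\omega(Z,\cdot)$. Assume that $f$ and $f_1:=f-\frac12 g(Z,Z)$ are nowhere vanishing. Put $\beta:=g(Z,\cdot)$ and $\alpha:=df$. Let $\pi:P\to M$ be an $S^1$-principal bundle endowed with a principal connection $\eta$ with curvature $d\eta=\pi^*(\omega-\frac12 d\beta)$, and let $X_P$ be the fundamental vector field of $P$. Let $\hat M:=P\times\mathbb{R}$, with coordinate $t$ on the $\mathbb{R}$-factor, let $\hat\pi:\hat M\to M$, $\hat\pi(p,t)=\pi(p)$, and define on $\hat M$ $$\xi:=\partial_t,\qquad \hat g:=e^{2t}\Big(\frac{2}{f_1}\eta^2+g+2f\,dt^2+2\alpha\,dt\Big),\qquad \theta:=e^{2t}\Big(\eta+\frac12\beta\Big),\qquad \hat\omega:=d\theta,$$ where tensor fields on $M$ and $P$ are identified with their pullbacks to $\hat M$. Then $\hat g$ is a pseudo-Riemannian metric, and with $\hat J:=\hat g^{-1}\hat\omega$ (i.e. $\hat\omega=\hat g(\hat J\cdot,\cdot)$) the tuple $(\hat M,\hat g,\hat J,\xi)$ is a conical pseudo-Kähler manifold. The induced CR-structure on the hypersurface $P\cong P\times\{0\}\subset\hat M$ coincides with the horizontal distribution $T^hP=\ker\eta$, and $\pi:P\to M$ is holomorphic in the sense that $d\pi\circ\hat J=J\circ d\pi$ on $T^hP$. The projection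 $\hat\pi:\hat M\to M$ is not holomorphic, since $\ker d\hat\pi=\mathrm{span}\{X_P,\xi\}$ is not $\hat J$-invariant. The metric $\hat g$ has signature $(2k+2,2\ell)$ if $f_1>0$ and $(2k,2\ell+2)$ if $f_1<0$, where $(2k,2\ell)$ is the signature of $g$.
   Context: An almost pseudo-Kähler manifold $(M,g,J)$ is a pseudo-Riemannian manifold $(M,g)$ with a $g$-skew-symmetric almost complex structure $J$ whose fundamental form $\omega:=g(J\cdot,\cdot)$ is closed; it is pseudo-Kähler if $J$ is integrable, and then $\omega$ is called the Kähler form. A conical pseudo-Riemannian manifold $(N,g,\xi)$ is a pseudo-Riemannian manifold with a vector field $\xi$ such that $g(\xi,\xi)$ is nowhere zero ($\xi$ is time-like or space-like) and $D\xi=\mathrm{Id}$, where $D$ is the Levi-Civita connection. A conical pseudo-Kähler manifold $(N,g,J,\xi)$ is a pseudo-Kähler manifold $(N,g,J)$ such that $(N,g,\xi)$ is conical. Conventions: the connection $\eta$ is regarded as a real-valued $S^1$-invariant one-form on $P$ with $\eta(X_P)=1$, where $S^1=\{e^{is}\mid s\in\mathbb{R}\}$ and $X_P$ is the fundamental vector field of the principal action ($X_P=\partial_s$ in local trivialisations). Signature $(a,b)$ means $a$ positive and $b$ negative directions. Products of one-forms in metrics are symmetric products, so $\eta^2=\eta\otimes\eta$ and $2\alpha\,dt=\alpha\otimes dt+dt\otimes\alpha$. The CR-structure induced on the hypersurface $P\subset\hat M$ is the maximal $\hat J$-invariant subbundle $TP\cap\hat J(TP)$ with the restriction of $\hat J$.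 *)

(* Defs.v *)
From HB Require Import structures.
From mathcomp Require Import all_boot all_order all_algebra.
From mathcomp Require Import all_classical all_reals all_analysis.
Set Implicit Arguments.
Unset Strict Implicit.
Unset Printing Implicit Defensive.
Import Order.TTheory GRing.Theory Num.Theory.
Import numFieldNormedType.Exports.
Local Open Scope classical_set_scope.
Local Open Scope ring_scope.

Fixpoint Ck (R : realType) (n : nat) (k : nat) (U : set 'rV[R]_n)
    (h : 'rV[R]_n -> R) : Prop :=
  if k is k'.+1 then
    (forall x, U x -> differentiable h x) /\
    (forall i : 'I_n, Ck k' U ('D_(delta_mx 0 i) h))
  else forall x, U x -> {for x, continuous h}.

Definition Cinfty (R : realType) (n : nat) (U : set 'rV[R]_n)
  (h : 'rV[R]_n -> R) : Prop := forall k, Ck k U h.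

(* [fwd] and [bwd] are total functions, meaningful on [dom] and on
   [chart_img] only. *)
Record chart (R : realType) (T : Type) (n : nat) := Chart {
  dom : set T;
  fwd : T -> 'rV[R]_n;
  bwd : 'rV[R]_n -> T }.

Definition chart_img (R : realType) (T : Type) (n : nat) (c : chart R T n)
  : set 'rV[R]_n := fwd c @` dom c.

(* Raw data; the axioms are in [manifold]. The atlas need not be maximal. *)
Record premanifold (R : realType) := Premanifold {
  carrier :> topologicalType;
  mdim : nat;
  atlas : set (chart R carrier mdim) }.

Definition manifold (R : realType) (M : premanifold R) : Prop :=
  [/\ hausdorff_space M,
      @second_countable M,
      forall p : M, exists2 c, atlas c & dom c p,
      forall c, @atlas R M c ->
        [/\ open (dom c), open (chart_img c),
            forall p, dom c p -> bwd c (fwd c p) = p,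
            {within dom c, continuous (fwd c)} &
            {within chart_img c, continuous (bwd c)}]
    & forall c d, @atlas R M c -> @atlas R M d -> forall i : 'I_(mdim M),
        Cinfty (fwd c @` (dom c `&` dom d)) (fun x => fwd d (bwd c x) 0 i)].

Definition smooth (R : realType) (M : premanifold R) (h : M -> R) : Prop :=
  forall c, @atlas R M c -> Cinfty (chart_img c) (h \o bwd c).

(* [U] is meant to be open. *)
Definition smooth_on (R : realType) (M N : premanifold R) (U : set M)
    (phi : M -> N) : Prop :=
  (forall p, U p -> {for p, continuous phi}) /\
  (forall c d, @atlas R M c -> @atlas R N d -> forall i : 'I_(mdim N),
     Cinfty (fwd c @` (dom c `&` U `&` phi @^-1` dom d))
            (fun x => fwd d (phi (bwd c x)) 0 i)).

Definition smooth_map (R : realType) (M N : premanifold R) (phi : M -> N) :=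
  smooth_on setT phi.

Definition smooth_fun_on (R : realType) (M : premanifold R) (U : set M)
    (h : M -> R) : Prop :=
  forall c, @atlas R M c -> Cinfty (fwd c @` (dom c `&` U)) (h \o bwd c).

Definition chart_prodR (R : realType) (T : Type) (n : nat) (c : chart R T n)
  : chart R (T * R)%type (n + 1) :=
  Chart [set y | dom c y.1]
        (fun y => row_mx (fwd c y.1) (const_mx y.2))
        (fun x => (bwd c (lsubmx x), rsubmx x 0 0)).

Definition prodR (R : realType) (M : premanifold R) : premanifold R :=
  @Premanifold R (M * R)%type (mdim M + 1)
    [set chart_prodR c | c in @atlas R M].

(* Tangent vectors at [p] are the derivations at [p] of the algebra of smooth
   functions. They are encoded as functionals on all functions, with value 0
   on the non-smooth ones, so that two tangent vectors which agree on smooth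
   functions are equal. *)
Definition tvec (R : realType) (M : premanifold R) := (M -> R) -> R.

Definition tangent (R : realType) (M : premanifold R) (p : M) (v : tvec M)
  : Prop :=
  [/\ forall h, ~ smooth h -> v h = 0,
      forall a h k, smooth h -> smooth k ->
        v (fun q => a * h q + k q) = a * v h + v k
    & forall h k, smooth h -> smooth k ->
        v (fun q => h q * k q) = v h * k p + h p * v k].

Definition restrict_smooth (R : realType) (M : premanifold R) (v : tvec M)
  : tvec M := fun h => if `[< smooth h >] then v h else 0.

Definition vfield (R : realType) (M : premanifold R) := M -> tvec M.
Definition form1 (R : realType) (M : premanifold R) := M -> tvec M -> R.
Definition tensor2 (R : realType) (M : premanifold R) :=
  M -> tvec M -> tvec M -> R.
Definition endo (R : realType) (M : premanifold R) := M -> tvec M -> tvec M.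

Definition vector_field (R : realType) (M : premanifold R) (X : vfield M)
  : Prop :=
  (forall p, tangent p (X p)) /\
  (forall h, smooth h -> smooth (fun p => X p h)).

(* The values of tensors on functionals that are not tangent vectors are
   irrelevant. *)
Definition smooth_form1 (R : realType) (M : premanifold R) (a : form1 M)
  : Prop :=
  (forall p r u v, tangent p u -> tangent p v ->
     a p (r *: u + v) = r * a p u + a p v) /\
  (forall X, vector_field X -> smooth (fun p => a p (X p))).

Definition smooth_tensor2 (R : realType) (M : premanifold R) (b : tensor2 M)
  : Prop :=
  [/\ forall p r u v w, tangent p u -> tangent p v -> tangent p w ->
        b p (r *: u + v) w = r * b p u w + b p v w,
      forall p r u v w, tangent p u -> tangent p v -> tangent p w ->
        b p w (r *: u + v) = r * b p w u + b p w v
    & forall X Y, vector_field X -> vector_field Y ->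
        smooth (fun p => b p (X p) (Y p))].

Definition smooth_endo (R : realType) (M : premanifold R) (A : endo M)
  : Prop :=
  [/\ forall p u, tangent p u -> tangent p (A p u),
      forall p r u v, tangent p u -> tangent p v ->
        A p (r *: u + v) = r *: A p u + A p v
    & forall X, vector_field X -> vector_field (fun p => A p (X p))].

Definition bracket (R : realType) (M : premanifold R) (X Y : vfield M)
  : vfield M :=
  fun p h => X p (fun q => Y q h) - Y p (fun q => X q h).

Definition push (R : realType) (M N : premanifold R) (phi : M -> N)
  (u : tvec M) : tvec N := restrict_smooth (fun h => u (h \o phi)).

Definition pull1 (R : realType) (M N : premanifold R) (phi : M -> N)
  (a : form1 N) : form1 M := fun p u => a (phi p) (push phi u).

Definition pull2 (R : realType) (M N : premanifold R) (phi : M -> N)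
  (b : tensor2 N) : tensor2 M :=
  fun p u v => b (phi p) (push phi u) (push phi v).

Definition dfun (R : realType) (M : premanifold R) (h : M -> R) : form1 M :=
  fun p u => u h.

(* (d a)(X, Y) = X (a Y) - Y (a X) - a [X, Y], evaluated on arbitrary vector
   fields extending the given tangent vectors: the value does not depend on
   the extensions. *)
Definition extd (R : realType) (M : premanifold R) (a : form1 M)
  : tensor2 M := fun p u v =>
  xget 0 [set r : R | exists X Y : vfield M,
    [/\ vector_field X, vector_field Y, X p = u, Y p = v
      & r = X p (fun q => a q (Y q)) - Y p (fun q => a q (X q))
            - a p (bracket X Y p)]].

(* d w = 0 for a two-form w *)
Definition closed2 (R : realType) (M : premanifold R) (w : tensor2 M)
  : Prop :=
  forall X Y V : vfield M,
    vector_field X -> vector_field Y -> vector_field V -> forall p,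
    X p (fun q => w q (Y q) (V q)) + Y p (fun q => w q (V q) (X q))
    + V p (fun q => w q (X q) (Y q))
    - w p (bracket X Y p) (V p) - w p (bracket Y V p) (X p)
    - w p (bracket V X p) (Y p) = 0.

Definition pseudo_riemannian (R : realType) (M : premanifold R)
    (g : tensor2 M) : Prop :=
  [/\ manifold M, smooth_tensor2 g,
      forall p u v, tangent p u -> tangent p v -> g p u v = g p v u
    & forall p u, tangent p u -> (forall v, tangent p v -> g p u v = 0) ->
        u = 0].

(* [a] positive and [b] negative directions *)
Definition has_signature (R : realType) (M : premanifold R) (g : tensor2 M)
    (a b : nat) : Prop :=
  forall p, exists e : 'I_(a + b) -> tvec M,
  [/\ forall i, tangent p (e i),
      forall u, tangent p u ->
        exists c : 'I_(a + b) -> R, u = \sum_i c i *: e i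
    & forall i j, g p (e i) (e j) =
        if i == j then (if (i < a)%N then 1 else -1) else 0].

Definition affine_connection (R : realType) (M : premanifold R)
    (D : vfield M -> vfield M -> vfield M) : Prop :=
  [/\ forall X Y, vector_field X -> vector_field Y -> vector_field (D X Y),
      forall h X X' Y, smooth h ->
        vector_field X -> vector_field X' -> vector_field Y ->
        forall p, D (fun q => h q *: X q + X' q) Y p =
                  h p *: D X Y p + D X' Y p,
      forall X Y Y',
        vector_field X -> vector_field Y -> vector_field Y' ->
        forall p, D X (fun q => Y q + Y' q) p = D X Y p + D X Y' p
    & forall h X Y, smooth h -> vector_field X -> vector_field Y ->
        forall p, D X (fun q => h q *: Y q) p =
                  X p h *: Y p + h p *: D X Y p].

Definition levi_civita (R : realType) (M : premanifold R) (g : tensor2 M)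
    (D : vfield M -> vfield M -> vfield M) : Prop :=
  [/\ affine_connection D,
      forall X Y, vector_field X -> vector_field Y -> forall p,
        D X Y p - D Y X p = bracket X Y p
    & forall X Y V, vector_field X -> vector_field Y -> vector_field V ->
        forall p, X p (fun q => g q (Y q) (V q)) =
                  g p (D X Y p) (V p) + g p (Y p) (D X V p)].

(* L_Z g = 0 *)
Definition killing (R : realType) (M : premanifold R) (g : tensor2 M)
    (Z : vfield M) : Prop :=
  vector_field Z /\
  forall X Y, vector_field X -> vector_field Y -> forall p,
    Z p (fun q => g q (X q) (Y q)) =
    g p (bracket Z X p) (Y p) + g p (X p) (bracket Z Y p).

Definition almost_complex (R : realType) (M : premanifold R) (J : endo M)
  : Prop :=
  smooth_endo J /\ forall p u, tangent p u -> J p (J p u) = - u.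

(* vanishing of the Nijenhuis tensor *)
Definition integrable (R : realType) (M : premanifold R) (J : endo M)
  : Prop :=
  forall X Y, vector_field X -> vector_field Y -> forall p,
    let JX := fun q => J q (X q) in
    let JY := fun q => J q (Y q) in
    bracket JX JY p - J p (bracket JX Y p) - J p (bracket X JY p)
    - bracket X Y p = 0.

Definition fundamental_form (R : realType) (M : premanifold R)
  (g : tensor2 M) (J : endo M) : tensor2 M := fun p u v => g p (J p u) v.

Definition almost_pseudo_kahler (R : realType) (M : premanifold R)
    (g : tensor2 M) (J : endo M) : Prop :=
  [/\ pseudo_riemannian g, almost_complex J,
      forall p u v, tangent p u -> tangent p v ->
        g p (J p u) v = - g p u (J p v)
    & closed2 (fundamental_form g J)].

Definition pseudo_kahler (R : realType) (M : premanifold R)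
    (g : tensor2 M) (J : endo M) : Prop :=
  almost_pseudo_kahler g J /\ integrable J.

(* The Levi-Civita connection is unique, so "exists" fixes no choice. *)
Definition conical (R : realType) (M : premanifold R) (g : tensor2 M)
    (xi : vfield M) : Prop :=
  [/\ pseudo_riemannian g, vector_field xi,
      forall p, g p (xi p) (xi p) != 0
    & exists2 D, levi_civita g D &
        forall X, vector_field X -> forall p, D X xi p = X p].

Definition conical_pseudo_kahler (R : realType) (M : premanifold R)
    (g : tensor2 M) (J : endo M) (xi : vfield M) : Prop :=
  pseudo_kahler g J /\ conical g xi.

(* g^-1 w : the endomorphism A with g(A u, v) = w(u, v) *)
Definition raise (R : realType) (M : premanifold R) (g w : tensor2 M)
  : endo M := fun p u =>
  xget 0 [set x : tvec M | tangent p x /\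
                    forall v, tangent p v -> g p x v = w p u v].

(* The circle group {e^(is) | s real} acts through s, that is by a
   2 pi-periodic action [act s p] = p . e^(is) of the real line; smoothness
   can be tested in s since s |-> e^(is) is a surjective local
   diffeomorphism. *)
Definition circle_action (R : realType) (P : premanifold R)
    (act : R -> P -> P) : Prop :=
  [/\ smooth_map (fun y : prodR P => act y.2 y.1 : P),
      forall p, act 0 p = p,
      forall s t p, act (s + t) p = act s (act t p)
    & forall p, act (2 * pi) p = p].

(* A local trivialisation over [U]: the map p |-> (pr p, chi p) is a
   bijection from pr^-1 U onto U x S^1, with S^1 in the plane, whose inverse
   is (x, e^(is)) |-> act s (sigma x); both are smooth and equivariant. *)
Definition local_trivialisation (R : realType) (M P : premanifold R)
    (pr : P -> M) (act : R -> P -> P) (U : set M)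
    (chi1 chi2 : P -> R) (sigma : M -> P) : Prop :=
  [/\ smooth_fun_on (pr @^-1` U) chi1, smooth_fun_on (pr @^-1` U) chi2,
      smooth_on U sigma,
      forall p, U (pr p) -> exists s,
        [/\ chi1 p = cos s, chi2 p = sin s & p = act s (sigma (pr p))]
    & forall x s, U x ->
        [/\ pr (act s (sigma x)) = x, chi1 (act s (sigma x)) = cos s
          & chi2 (act s (sigma x)) = sin s]].

Definition principal_circle_bundle (R : realType) (M P : premanifold R)
    (pr : P -> M) (act : R -> P -> P) : Prop :=
  [/\ manifold P, manifold M, smooth_map pr, circle_action act
    & forall x : M, exists U chi1 chi2 sigma,
        [/\ open U, U x
          & local_trivialisation pr act U chi1 chi2 sigma]].

Definition fundamental_vf (R : realType) (P : premanifold R)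
  (act : R -> P -> P) : vfield P :=
  fun p => restrict_smooth (fun h => derive1 (fun s : R => h (act s p)) 0).

Definition principal_connection (R : realType) (P : premanifold R)
    (act : R -> P -> P) (eta : form1 P) : Prop :=
  [/\ smooth_form1 eta,
      forall s p u, tangent p u -> pull1 (act s) eta p u = eta p u
    & forall p, eta p (fundamental_vf act p) = 1].

(* d/dt on P x R *)
Definition partial_t (R : realType) (P : premanifold R) : vfield (prodR P) :=
  fun y => restrict_smooth
    (fun h : prodR P -> R => derive1 (fun t : R => h (y.1, t)) y.2).

Definition slice (R : realType) (P : premanifold R) (t : R) (p : P)
  : prodR P := (p, t).

(* TP cap A(TP), for P immersed by [phi] *)
Definition CR_distribution (R : realType) (P N : premanifold R)
    (phi : P -> N) (A : endo N) (p : P) : set (tvec N) :=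
  (push phi @` [set u | tangent p u]) `&`
  (A (phi p) @` (push phi @` [set u | tangent p u])).

(* Main.v *)
Require Import Defs.
From HB Require Import structures.
From mathcomp Require Import all_boot all_order all_algebra.
From mathcomp Require Import all_classical all_reals all_analysis.
From mathcomp Require Import ring lra.
Set Implicit Arguments.
Unset Strict Implicit.
Unset Printing Implicit Defensive.
Import Order.TTheory GRing.Theory Num.Theory.
Import numFieldNormedType.Exports.
Local Open Scope classical_set_scope.
Local Open Scope ring_scope.

(* Along the cone, a tangent vector u is determined by its components
   A = d hpr u on M, a = eta u and c = dt u. In these components Jh u has the
   components (c' JZ + c Z + J A, f1 c, c') with c' = - a / f1, and Jh^2 = -1
   follows at once.

   For integrability, the Nijenhuis tensor is tested against the one-forms
   d (h o hpr), eta and dt. For a one-form b the value b (N (X, Y)) only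
   involves d b and d (b o J), so everything reduces to identities on M
   between two-forms: F = omega - d beta / 2 and the forms d (dh o J) are of
   type (1,1), F (Z, .) = - d f1, and
   d (dh o J) (Z, .) = d (Z h) o J - d (J Z h).

   The cone is conical since xi rescales gh and gh (xi, .) = d (exp (2 t) f)
   is exact: Koszul's formula then gives D xi = Id. For the signature, the
   vectors with components (JZ, 0, 1) and (0, 1, 0) are orthogonal to each
   other and to those with components (A, 0, 0), and have squares
   2 exp (2 t) f1 and 2 exp (2 t) / f1. *)

(** * Calculus on row vectors *)

(** Tangent vectors are derivations of the globally smooth functions and come without coordinates.
    Cutoffs make derivations local, and Hadamard's lemma shows that the coordinate fields span them.
    This yields local frames, extensions of tangent vectors to vector fields, and the independence
    of [extd] from the chosen extensions.

    The (1,1) claims on M have two sources. For d (dh o J) the claim is the vanishing of the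
    Nijenhuis tensor, tested on the closed form dh. For F, the field Z preserves g and omega, hence
    J, and integrability then makes JZ preserve J too. As beta = - omega (JZ, .) and omega is
    closed, d beta = - L_JZ omega is of type (1,1).

    The curvature of eta is prescribed so that the two terms in d beta cancel in d theta, which
    leaves exp (2 t) times omega + 2 dt ^ eta + dt ^ beta. Comparing this with gh coefficient by
    coefficient forces the components of Jh. *)

Section frechet.
Context {K : numFieldType} {V W : normedModType K}.
Implicit Types f g : V -> W.

Lemma frechet_diff f (L : {linear V -> W}) (x : V) : continuous L ->
  (forall e, 0 < e -> \forall h \near (0 : V), `|f (h + x) - f x - L h| <= e * `|h|) ->
  differentiable f x /\ 'd f x = L :> (V -> W).
Proof.
move=> cL H.
have e : f \o shift x = cst (f x) + L +o_ 0 id.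
  apply/eqaddoP => e e0; move: (H _ e0); apply: filterS => h.
  by rewrite !fctE /= /cst opprD addrA.
have dL := diff_unique cL e.
by split => //; apply/diff_locallyP; rewrite dL.
Qed.

(** Taylor's formula and the bound on flat functions both deliver quadratic remainders, so this is
    the form in which differentiability gets checked for flat functions at 0 and for integrals along
    rays. *)
Lemma frechet_quad f (L : {linear V -> W}) (x : V) (C d : K) : continuous L ->
  0 < d -> 0 <= C ->
  (forall h, `|h| < d -> `|f (h + x) - f x - L h| <= C * `|h| ^+ 2) ->
  differentiable f x /\ 'd f x = L :> (V -> W).
Proof.
move=> cL d0 C0 H; apply: frechet_diff => // e e0.
(* [C] may vanish; [C + 1] can be divided by. *)
have C1 : 0 < C + 1 by rewrite ltr_wpDl.
near=> h.
apply: (le_trans (H h _)); first by near: h; exact: nbhs0_lt.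
rewrite expr2 mulrA; apply: ler_wpM2r; first exact: normr_ge0.
apply: (@le_trans _ _ ((C + 1) * `|h|)).
  by apply: ler_wpM2r; [exact: normr_ge0|rewrite lerDl].
by rewrite mulrC -ler_pdivlMr//; near: h; apply: nbhs0_le; rewrite divr_gt0.
Unshelve. all: by end_near. Qed.

Lemma near_eq_differentiable f g (x : V) :
  (\near x, f x = g x) -> differentiable f x -> differentiable g x.
Proof.
move=> fg df.
have := @frechet_diff g ('d f x) x (diff_continuous df); case => // e e0.
have /eqaddoP/(_ _ e0) := diff_locally df.
have fgx : \forall h \near (0 : V), f (h + x) = g (h + x).
  by move: fg; rewrite (near_shift 0)/= subr0; apply: filterS.
apply: filterS2 fgx => h; rewrite !fctE /= /cst => -> .
by rewrite (nbhs_singleton fg) opprD addrA.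
Qed.

End frechet.

Section differentiability.
Context {R : realType} {n : nat}.
Implicit Types (f g : 'rV[R]_n -> R) (x : 'rV[R]_n).

Definition linear_of (c : 'I_n -> R) (v : 'rV[R]_n) : R := \sum_i v 0 i * c i.

Lemma linear_of_is_linear c : linear (linear_of c : 'rV[R]_n -> R^o).
Proof.
move=> a u v; rewrite /linear_of scaler_sumr -big_split; apply: eq_bigr => i _.
by rewrite !mxE mulrDl -mulrA.
Qed.

Lemma linear_of_differentiable c x : differentiable (linear_of c) x.
Proof.
have -> : linear_of c = \sum_i (fun v : 'rV[R]_n => v 0 i * c i).
  by rewrite funeqE => v; rewrite fct_sumE.
apply: differentiable_sum => i; apply: differentiableM => //.
exact: differentiable_coord.
Qed.

Lemma differentiable_quad f x (c : 'I_n -> R) (C d : R) : 0 < d -> 0 <= C ->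
  (forall h, `|h| < d -> `|f (h + x) - f x - linear_of c h| <= C * `|h| ^+ 2) ->
  differentiable f x /\ (forall i, 'D_(delta_mx 0 i) f x = c i).
Proof.
move=> d0 C0 H.
pose lM := GRing.isLinear.Build _ _ _ _ _ (linear_of_is_linear c).
pose L : {linear 'rV[R]_n -> R} := HB.pack (linear_of c) lM.
have cL : continuous L.
  by move=> y; exact/differentiable_continuous/linear_of_differentiable.
have [df dL] := frechet_quad (W := R^o) cL d0 C0 H.
split => // i; rewrite deriveE// dL /= /linear_of (bigD1 i)//= big1 ?mxE ?eqxx ?mul1r ?addr0// => j ji.
by rewrite mxE /= (negbTE ji) mul0r.
Qed.

Lemma derive_linear f x v : differentiable f x ->
  'D_v f x = \sum_i v 0 i * 'D_(delta_mx 0 i) f x.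
Proof.
move=> df; rewrite deriveE// {1}(row_sum_delta v) linear_sum; apply: eq_bigr => i _.
by rewrite linearZ deriveE.
Qed.

End differentiability.

(** * Functions of class C^k on row vectors *)

Section Ck_theory.
Context {R : realType}.

Lemma Ck_sub n k (U V : set 'rV[R]_n) (f : 'rV[R]_n -> R) :
  U `<=` V -> Ck k V f -> Ck k U f.
Proof.
move=> UV; elim: k f => [f|k IH f] /= H; first by move=> x /UV; exact: H.
by case: H => H1 H2; split => [x /UV|i]; [exact: H1|exact: IH].
Qed.

(** [V] need not be open: [Ck k U f] is a family of conditions at single points of [U], because
    differentiability and the partial derivatives refer to [f] as a function on the whole space. *)
Lemma Ck_local n k (U : set 'rV[R]_n) (f : 'rV[R]_n -> R) :
  (forall x, U x -> exists2 V : set 'rV[R]_n, V x & Ck k V f) -> Ck k U f.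
Proof.
elim: k f => [f|k IH f] /= H.
  by move=> x /H[V Vx]; exact.
split => [x /H[V Vx [+ _]]|i]; first exact.
by apply: IH => x /H[V Vx [_ VH]]; exists V.
Qed.

(** Here openness matters: agreement on [U] alone says nothing about derivatives, which depend on
    values in a whole neighbourhood. *)
Lemma Ck_eq n k (U : set 'rV[R]_n) (f g : 'rV[R]_n -> R) : open U ->
  (forall x, U x -> f x = g x) -> Ck k U f -> Ck k U g.
Proof.
move=> oU; elim: k f g => [f g|k IH f g] fg /=.
  move=> fc x Ux; rewrite /prop_for /continuous_at -fg//.
  have nfg : {near x, f =1 g}.
    by near=> y; apply: fg; near: y; exact: open_nbhs_nbhs.
  exact: cvg_trans (near_eq_cvg nfg) (fc x Ux).
case=> H1 H2.
have nfg x : U x -> \near x, f x = g x.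
  by move=> Ux; near=> y; apply/fg; near: y; exact: open_nbhs_nbhs.
split => [x Ux|i]; first exact: (near_eq_differentiable (nfg _ Ux) (H1 x Ux)).
by apply: (IH ('D_(delta_mx 0 i) f)) => // x Ux; apply: near_eq_derive; exact: nfg.
Unshelve. all: by end_near. Qed.

Lemma CkW n k (U : set 'rV[R]_n) (f : 'rV[R]_n -> R) : Ck k.+1 U f -> Ck k U f.
Proof.
elim: k f => [f [H1 _] x /H1|k IH f [H1 H2]]; first exact: differentiable_continuous.
by split => // i; apply: IH; exact: H2.
Qed.

Lemma Ck_cst n k (U : set 'rV[R]_n) (a : R) : Ck k U (fun=> a).
Proof.
elim: k a => [a x _|k IH a /=]; first exact: cst_continuous.
split => // i; rewrite (_ : 'D_(delta_mx 0 i) _ = fun=> 0) //.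
by rewrite funeqE => x; rewrite derive_cst.
Qed.

Lemma CkD n k (U : set 'rV[R]_n) (f g : 'rV[R]_n -> R) : open U ->
  Ck k U f -> Ck k U g -> Ck k U (fun x => f x + g x).
Proof.
move=> oU; elim: k f g => [f g cf cg x Ux|k IH f g [df Hf] [dg Hg]].
  by apply: continuousD; [exact: cf|exact: cg].
split => [x Ux|i]; first by apply: differentiableD; [exact: df|exact: dg].
apply: (Ck_eq oU) (IH _ _ (Hf i) (Hg i)) => x Ux.
by rewrite deriveD//; apply: diff_derivable; [exact: df|exact: dg].
Qed.

Lemma CkM n k (U : set 'rV[R]_n) (f g : 'rV[R]_n -> R) : open U ->
  Ck k U f -> Ck k U g -> Ck k U (fun x => f x * g x).
Proof.
move=> oU; elim: k f g => [f g cf cg x Ux|k IH f g Cf Cg].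
  by apply: continuousM; [exact: cf|exact: cg].
have [[df Hf] [dg Hg]] := (Cf, Cg).
split => [x Ux|i]; first by apply: differentiableM; [exact: df|exact: dg].
apply: (Ck_eq oU) (CkD oU (IH _ _ (CkW Cf) (Hg i)) (IH _ _ (CkW Cg) (Hf i))) => x Ux.
by rewrite (@deriveM _ _ f g)//; apply: diff_derivable; [exact: df|exact: dg].
Qed.

Lemma Ck_sum n k (U : set 'rV[R]_n) (I : Type) (r : seq I) (P : pred I) (f : I -> 'rV[R]_n -> R) :
  open U -> (forall i, P i -> Ck k U (f i)) -> Ck k U (fun x => \sum_(i <- r | P i) f i x).
Proof.
move=> oU H; elim: r => [|i r IH].
  apply: (Ck_eq oU) (Ck_cst k U 0) => x _; by rewrite big_nil.
case Pi : (P i).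
  apply: (Ck_eq oU) (CkD oU (H i Pi) IH) => x _; by rewrite big_cons Pi.
by apply: (Ck_eq oU) IH => x _; rewrite big_cons Pi.
Qed.

Lemma Ck_prod n k (U : set 'rV[R]_n) (I : Type) (r : seq I) (P : pred I) (f : I -> 'rV[R]_n -> R) :
  open U -> (forall i, P i -> Ck k U (f i)) -> Ck k U (fun x => \prod_(i <- r | P i) f i x).
Proof.
move=> oU H; elim: r => [|i r IH].
  apply: (Ck_eq oU) (Ck_cst k U 1) => x _; by rewrite big_nil.
case Pi : (P i).
  apply: (Ck_eq oU) (CkM oU (H i Pi) IH) => x _; by rewrite big_cons Pi.
by apply: (Ck_eq oU) IH => x _; rewrite big_cons Pi.
Qed.

Lemma Ck_coord n k (U : set 'rV[R]_n) i : Ck k U (fun x => x 0 i).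
Proof.
case: k => [x _|k]; first exact: coord_continuous.
split => [x _|j]; first exact: differentiable_coord.
rewrite (_ : 'D_(delta_mx 0 j) _ = fun=> (j == i)%:R : R); first exact: Ck_cst.
rewrite funeqE => x.
have H : is_derive x (delta_mx 0 j) (id : 'rV[R]_n -> _) (delta_mx 0 j) by exact: is_derive_id.
have := derive_mx (@ex_derive _ _ _ _ _ _ _ H); rewrite derive_id => /matrixP/(_ 0 i).
by rewrite !mxE eqxx eq_sym /= => <-.
Qed.

Lemma differentiable_rV n m (phi : 'rV[R]_n -> 'rV[R]_m) x :
  (forall j, differentiable (fun y => phi y 0 j) x) -> differentiable phi x.
Proof.
move=> H.
have -> : phi = \sum_j (fun y => phi y 0 j *: (delta_mx 0 j : 'rV[R]_m)).
  by rewrite funeqE => v; rewrite fct_sumE {1}(row_sum_delta (phi v)).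
by apply: differentiable_sum => j; exact: differentiableZl.
Qed.

Lemma continuous_rV (T : topologicalType) m (phi : T -> 'rV[R]_m) x :
  (forall j, {for x, continuous (fun y => phi y 0 j)}) -> {for x, continuous phi}.
Proof.
move=> H.
have -> : phi = fun y => \sum_j (phi y 0 j *: (delta_mx 0 j : 'rV[R]_m)).
  by rewrite funeqE => v; exact: row_sum_delta.
rewrite (_ : (fun y => _) = \sum_j (fun y => phi y 0 j *: (delta_mx 0 j : 'rV[R]_m))).
  elim/big_ind : _ => [|f g cf cg|j _]; [exact: cst_continuous| exact: continuousD|].
  exact: continuousZr_tmp.
by rewrite funeqE => v; rewrite fct_sumE.
Qed.

Lemma derive_comp_rV n m (phi : 'rV[R]_n -> 'rV[R]_m) (h : 'rV[R]_m -> R) x i :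
  (forall j, differentiable (fun y => phi y 0 j) x) -> differentiable h (phi x) ->
  'D_(delta_mx 0 i) (h \o phi) x =
  \sum_j 'D_(delta_mx 0 i) (fun y => phi y 0 j) x * 'D_(delta_mx 0 j) h (phi x).
Proof.
move=> H dh; have dphi := differentiable_rV H.
rewrite deriveE; last exact: differentiable_comp.
rewrite diff_comp//= -!deriveE// derive_linear//.
apply: eq_bigr => j _; congr (_ * _).
by rewrite derive_mx ?mxE//; exact: diff_derivable.
Qed.

(** Only the first-order chain rule is used. The partial derivatives of the composite are sums of
    products of partials of [phi] with a partial of [h] composed with the same [phi], and the
    induction hypothesis applies to these composites. *)
Lemma Ck_comp n m k (U : set 'rV[R]_n) (V : set 'rV[R]_m)
    (phi : 'rV[R]_n -> 'rV[R]_m) (h : 'rV[R]_m -> R) : open U ->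
  (forall x, U x -> V (phi x)) ->
  (forall j, Ck k U (fun y => phi y 0 j)) -> Ck k V h -> Ck k U (h \o phi).
Proof.
move=> oU UV; elim: k h => [h Hphi ch x Ux|k IH h Hphi [dh Hh]].
  apply: continuous_comp; last by apply: ch; exact: UV.
  by apply: continuous_rV => j; exact: (Hphi j x Ux).
have dphi x j : U x -> differentiable (fun y => phi y 0 j) x by move=> Ux; case: (Hphi j) => + _; exact.
split => [x Ux|i].
  apply: differentiable_comp; last by apply: dh; exact: UV.
  by apply: differentiable_rV => j; exact: dphi.
apply: (Ck_eq oU) (_ : Ck k U (fun x => \sum_j 'D_(delta_mx 0 i) (fun y => phi y 0 j) x * 'D_(delta_mx 0 j) h (phi x))).
  move=> x Ux; rewrite derive_comp_rV//; [by move=> j; exact: dphi|by apply: dh; exact: UV].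
apply: Ck_sum => // j _; apply: CkM => //; first by case: (Hphi j) => _; exact.
by apply: (IH ('D_(delta_mx 0 j) h)) => [j'|]; [apply: CkW|exact: Hh].
Qed.

(** A device for composing with exp, the inverse and the flat functions in one induction: all
    iterated derivatives of a member stay in the family, so no formula for them is required. *)
Definition derivative_closed (V : set R) (S : set (R -> R)) :=
  forall f, S f -> exists2 f', S f' & forall t, V t -> is_derive t 1 f (f' t).

Lemma derive_comp1 n (f : 'rV[R]_n -> R) (psi : R -> R) x i (d : R) :
  differentiable f x -> is_derive (f x) 1 psi d ->
  differentiable (psi \o f) x /\
  'D_(delta_mx 0 i) (psi \o f) x = 'D_(delta_mx 0 i) f x * d.
Proof.
move=> df [dpsi dE]; have dpsi' : differentiable psi (f x) by exact/derivable1_diffP.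
have H : differentiable (psi \o f) x by exact: differentiable_comp.
by split => //; rewrite deriveE// diff_comp//= diff1E// derive1E dE deriveE.
Qed.

Lemma Ck_comp1 n k (U : set 'rV[R]_n) (V : set R) (S : set (R -> R))
   (f : 'rV[R]_n -> R) (psi : R -> R) : open U -> derivative_closed V S -> S psi ->
  (forall x, U x -> V (f x)) -> Ck k U f -> Ck k U (psi \o f).
Proof.
move=> oU dcS; elim: k psi => [|k IH] psi /dcS[psi' Spsi' dpsi] UV.
  move=> cf x Ux; apply: continuous_comp; first exact: cf.
  apply: differentiable_continuous; apply/derivable1_diffP.
  by case: (dpsi _ (UV _ Ux)).
move=> Cf; have [df Hf] := Cf; split => [x Ux|i].
  apply: differentiable_comp; first exact: df.
  by apply/derivable1_diffP; case: (dpsi _ (UV _ Ux)).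
apply: (Ck_eq oU) (CkM oU (Hf i) (IH _ Spsi' UV (CkW Cf))) => x Ux.
by rewrite (derive_comp1 _ (df _ Ux) (dpsi _ (UV _ Ux))).2.
Qed.

End Ck_theory.

(** * Exponential, inverse and flat functions of one variable *)

Section special_functions.
Context {R : realType}.

Lemma derivative_closed_expR : derivative_closed setT [set @expR R].
Proof. by move=> f ->; exists expR => // t _; exact: is_derive_expR. Qed.

(** The inverse alone is not closed under differentiation, but polynomials in 1/t are: the
    derivative of p (1/t) is - (1/t)^2 p' (1/t). *)
Lemma derivative_closed_inv :
  derivative_closed [set t : R | t != 0] [set psi | exists p : {poly R}, psi = fun t => p.[t^-1]].
Proof.
move=> f [p ->]; exists (fun t => (- ('X^2 * p^`())).[t^-1]); first by exists (- ('X^2 * p^`())).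
move=> t t0.
have H : is_derive t 1 (fun t : R => t^-1) (- t ^- 2).
  have := @is_deriveV R idfun t 1 1 t0 (is_derive_id _ _).
  by rewrite /GRing.scale /= mulr1; apply.
have := @is_derive1_comp R (horner p) (fun t => t^-1) t _ _ (is_derive_poly p _) H.
move/is_derive_eq; apply.
by rewrite !hornerE /= -exprVn mulrN mulrC.
Qed.

Lemma expr_le_expR k (x : R) : 0 <= x -> x ^+ k <= k`!%:R * expR x.
Proof.
move=> x0; case: k => [|k].
  by rewrite expr0 fact0 mul1r (le_trans _ (expR_ge1Dx x))// lerDl.
have := expR_ge1Dxn k x0; move=> H.
rewrite mulrC -ler_pdivrMr ?ltr0n ?fact_gt0//; apply: le_trans H.
by rewrite lerDr.
Qed.

(** The extra factor [x ^+ 2] is what will bound [flat p] by a multiple of t^2 near 0. Each monomial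
    is absorbed by one term of the exponential series. *)
Lemma horner_le_expR (p : {poly R}) :
  exists2 C, 0 <= C & forall x, 0 <= x -> `|p.[x]| * x ^+ 2 <= C * expR x.
Proof.
exists (\sum_(i < size p) `|p`_i| * (i + 2)`!%:R).
  by apply: sumr_ge0 => i _; rewrite mulr_ge0.
move=> x x0; rewrite horner_coef.
apply: (@le_trans _ _ ((\sum_(i < size p) `|p`_i * x ^+ i|) * x ^+ 2)).
  by rewrite ler_wpM2r ?exprn_ge0// ler_norm_sum.
rewrite !mulr_suml ler_sum// => i _.
rewrite normrM -!mulrA ler_wpM2l// ger0_norm ?exprn_ge0// -exprD.
exact: expr_le_expR.
Qed.

(* The family [flat p] is closed under differentiation, so one induction
   gives all the derivatives of exp (- 1 / t). *)
Definition flat (p : {poly R}) (t : R) : R :=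
  if 0 < t then p.[t^-1] * expR (- t^-1) else 0.

(** Put x = 1/t in [horner_le_expR]. *)
Lemma flat_quad p : exists2 C, 0 <= C & forall t, `|flat p t| <= C * `|t| ^+ 2.
Proof.
have [C C0 HC] := horner_le_expR p; exists C => // t; rewrite /flat.
case: ifPn => t0; last by rewrite normr0 mulr_ge0 ?exprn_ge0.
have := HC t^-1; rewrite invr_ge0 (ltW t0) => /(_ isT) H.
rewrite normrM [`|expR _|]ger0_norm ?expR_ge0// expRN (gtr0_norm t0).
rewrite ler_pdivrMr ?expR_gt0// mulrAC -ler_pdivrMr ?exprn_gt0//.
by move: H; rewrite exprVn.
Qed.

(** Away from 0 this is the product rule: differentiating p (1/t) gives - X^2 p' and differentiating
    exp (- 1/t) gives X^2 p. At 0 the quadratic bound says that the derivative is 0, which is also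
    the value there of the new flat function. *)
Lemma is_derive_flat (p : {poly R}) (t : R) :
  is_derive t 1 (flat p) (flat ('X^2 * (p - p^`())) t).
Proof.
have [t0|t0|->] := ltgtP t 0.
- have E : \near t, (cst (0 : R)) t = flat p t.
    by near=> s; rewrite /flat ltNge ltW//; near: s; exact: lt_nbhsl.
  apply: near_eq_is_derive E _; rewrite /flat ltNge (ltW t0)/=; exact: is_derive_cst.
- have E : \near t, (fun t => p.[t^-1] * expR (- t^-1)) t = flat p t.
    by near=> s; rewrite /flat; have -> : 0 < s by near: s; exact: lt_nbhsr.
  apply: near_eq_is_derive E _; rewrite /flat t0.
  have tn0 : t != 0 by rewrite gt_eqF.
  have H : is_derive t 1 (fun t : R => t^-1) (- t ^- 2).
    have := @is_deriveV R idfun t 1 1 tn0 (is_derive_id _ _).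
    by rewrite /GRing.scale /= mulr1; apply.
  have H1 := @is_derive1_comp R (horner p) (fun t => t^-1) t _ _ (is_derive_poly p _) H.
  have H2 := @is_derive1_comp R expR (fun t => - t^-1) t _ _ (is_derive_expR _) (is_deriveN H).
  apply: is_derive_eq (is_deriveM H1 H2) _.
  by rewrite !hornerE /GRing.scale /= -exprVn; ring.
- have [C C0 HC] := flat_quad p.
  have f0 q : flat q 0 = 0 by rewrite /flat ltxx.
  have [| |df dE] := @frechet_quad R R^o R^o (flat p) (@GRing.null_fun R^o R^o) 0 C 1 _ ltr01 C0.
  - exact: cst_continuous.
  - by move=> h _; rewrite addr0 f0 !subr0; exact: HC.
  by apply: DeriveDef; [exact/derivable1_diffP|rewrite deriveE// dE f0].
Unshelve. all: by end_near. Qed.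

Lemma derivative_closed_flat : derivative_closed setT (range flat).
Proof.
move=> f [p _ <-]; exists (flat ('X^2 * (p - p^`()))); first by exists ('X^2 * (p - p^`())).
by move=> t _; exact: is_derive_flat.
Qed.

(** The usual smooth transition from 0 to 1. The denominator is positive since t and 1 - t cannot
    both be nonpositive. *)
Definition smoothstep (t : R) : R := flat 1 t / (flat 1 t + flat 1 (1 - t)).

Lemma flat1_ge0 t : 0 <= flat 1 t.
Proof. by rewrite /flat; case: ifP => // _; rewrite hornerC mul1r expR_ge0. Qed.

Lemma flat1_gt0 t : 0 < t -> 0 < flat 1 t.
Proof. by rewrite /flat => ->; rewrite hornerC mul1r expR_gt0. Qed.

Lemma smoothstep_den t : flat 1 t + flat 1 (1 - t) != 0.
Proof.
rewrite gt_eqF//; have [t0|t0] := ltP 0 t.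
  by rewrite ltr_pwDl ?flat1_gt0 ?flat1_ge0.
by rewrite ltr_wpDl ?flat1_ge0// flat1_gt0; lra.
Qed.

Lemma smoothstep0 t : t <= 0 -> smoothstep t = 0.
Proof. by move=> t0; rewrite /smoothstep /flat ltNge t0 /= mul0r. Qed.

Lemma smoothstep1 t : 1 <= t -> smoothstep t = 1.
Proof.
move=> t1; rewrite /smoothstep.
have -> : flat 1 (1 - t) = 0 by rewrite /flat subr_gt0 ltNge t1.
by rewrite addr0 divff// gt_eqF// flat1_gt0// (lt_le_trans ltr01).
Qed.

End special_functions.

(** * Smooth cutoffs and extensions on row vectors *)

Section Ck_special.
Context {R : realType} {n : nat}.
Implicit Types (U : set 'rV[R]_n) (f g : 'rV[R]_n -> R).

Lemma Ck_expR k U f : open U -> Ck k U f -> Ck k U (fun x => expR (f x)).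
Proof.
by move=> oU; apply: (Ck_comp1 oU derivative_closed_expR (psi := expR)).
Qed.

Lemma Ck_inv k U f : open U -> (forall x, U x -> f x != 0) -> Ck k U f ->
  Ck k U (fun x => (f x)^-1).
Proof.
move=> oU f0; apply: (Ck_comp1 oU derivative_closed_inv (psi := fun t => t^-1)) => //.
by exists 'X; rewrite funeqE => t; rewrite hornerX.
Qed.

Lemma Ck_smoothstep k U f : open U -> Ck k U f -> Ck k U (fun x => smoothstep (f x)).
Proof.
have Cflat g : open U -> Ck k U g -> Ck k U (fun x => flat 1 (g x)).
  move=> oU; apply: (Ck_comp1 oU derivative_closed_flat (psi := flat 1)) => //.
move=> oU Cf; apply: CkM => //; first exact: Cflat.
apply: Ck_inv => //; first by move=> x _; exact: smoothstep_den.
apply: CkD => //; first exact: Cflat.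
apply: Cflat => //; apply: CkD; [by []|exact: Ck_cst|].
by apply: (Ck_eq oU) (CkM oU (Ck_cst k U (-1)) Cf) => x _; rewrite mulN1r.
Qed.

(** Needed for the angle function of a circle bundle. The derivative 1 / (1 + f^2) is handled by
    [Ck_inv], so a direct induction replaces a derivative-closed family. *)
Lemma Ck_atan k U f : open U -> Ck k U f -> Ck k U (fun x => atan (f x)).
Proof.
move=> oU; elim: k f => [f cf x Ux|k IH f Cf].
  by apply: continuous_comp; [exact: cf|exact: continuous_atan].
have [df Hf] := Cf; split => [x Ux|i].
  apply: differentiable_comp; first exact: df.
  by apply/derivable1_diffP; exact: derivable_atan.
apply: (Ck_eq oU) (CkM oU (Hf i) (_ : Ck k U (fun x => (1 + f x * f x)^-1))).
  by move=> x Ux; rewrite (derive_comp1 _ (df _ Ux) (is_derive1_atan _)).2 expr2.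
apply: Ck_inv => //; first by move=> x _; rewrite gt_eqF// ltr_pwDl// -expr2 sqr_ge0.
by apply: CkD => //; [exact: Ck_cst|apply: CkM => //; exact: CkW].
Qed.

(** Squaring avoids the absolute value, which is not smooth. If a coordinate differs from that of
    [a] by at most r/2, the square is at most 1 and the argument of [smoothstep] at least 1; if it
    differs by at least r, the square is at least 4 and the argument negative. The product over
    coordinates fits the sup norm of row vectors. *)
Definition bump_rV (a : 'rV[R]_n) (r : R) (x : 'rV[R]_n) : R :=
  \prod_i smoothstep (2 - (2 / r * (x 0 i - a 0 i)) ^+ 2).

Lemma Cinfty_bump_rV a r U : open U -> Cinfty U (bump_rV a r).
Proof.
move=> oU k; apply: Ck_prod => // i _; apply: Ck_smoothstep => //.
have H : Ck k U (fun x => 2 / r * (x 0 i + - a 0 i)).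
  by apply: CkM => //; [exact: Ck_cst|apply: CkD => //; [exact: Ck_coord|exact: Ck_cst]].
apply: CkD => //; first exact: Ck_cst.
apply: (Ck_eq oU) (CkM oU (Ck_cst k U (-1)) (CkM oU H H)) => x _.
by rewrite mulN1r expr2.
Qed.

Lemma bump_rV1 a r x : 0 < r -> `|x - a| <= r / 2 -> bump_rV a r x = 1.
Proof.
move=> r0 xa; rewrite /bump_rV big1// => i _; apply: smoothstep1.
have H : `|x 0 i - a 0 i| <= r / 2.
  apply: le_trans xa; rewrite [leRHS]/Num.norm /= mx_normrE.
  by apply: le_trans (le_bigmax _ _ (0, i)); rewrite /= !mxE.
have : `|2 / r * (x 0 i - a 0 i)| <= 1.
  rewrite normrM [`|2 / r|]gtr0_norm ?divr_gt0//.
  apply: (@le_trans _ _ (2 / r * (r / 2))); first by rewrite ler_wpM2l// divr_ge0 ?ltW.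
  by rewrite mulrA divfK ?gt_eqF// divff.
rewrite ler_norml => /andP[]; set u := 2 / r * _ => u1 u2; nra.
Qed.

Lemma bump_rV0 a r x : 0 < r -> r <= `|x - a| -> bump_rV a r x = 0.
Proof.
move=> r0 rxa; apply/eqP; apply: contraTT rxa => B0; rewrite -ltNge.
have {}B0 i : smoothstep (2 - (2 / r * (x 0 i - a 0 i)) ^+ 2) != 0.
  by apply: contra_neq B0 => E; rewrite /bump_rV (bigD1 i)//= E mul0r.
rewrite /Num.norm /= mx_normrE; apply: bigmax_lt => // -[i' i] _ /=; rewrite !mxE ord1.
have /eqP H := B0 i; rewrite ltNge; apply/negP => rx; apply: H; apply: smoothstep0.
have : 2 <= `|2 / r * (x 0 i - a 0 i)|.
  rewrite normrM [`|2 / r|]gtr0_norm ?divr_gt0//.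
  apply: (@le_trans _ _ (2 / r * r)); last by rewrite ler_wpM2l// divr_ge0 ?ltW.
  by rewrite divfK ?gt_eqF.
set u := 2 / r * _ => u1; rewrite -real_normK ?num_real//; nra.
Qed.

(** Chart expressions are meaningful on the chart image only, whereas Hadamard's lemma integrates
    along rays and wants a function on the whole space. Only the germ at [x] has to be kept, so a
    cutoff suffices. *)
Lemma Cinfty_extend (V : set 'rV[R]_n) x f : open V -> V x -> Cinfty V f ->
  exists2 H, Cinfty setT H & \forall y \near x, H y = f y.
Proof.
move=> oV Vx Cf.
have [r r0 rV] : exists2 r : R, 0 < r & forall y, `|y - x| <= r -> V y.
  have /nbhs_ballP[e /= e0 eV] := open_nbhs_nbhs (conj oV Vx).
  exists (e / 2); first by rewrite divr_gt0.
  move=> y xe; apply: eV; rewrite -ball_normE /= distrC (le_lt_trans xe)//.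
  by rewrite ltr_pdivrMr// ltr_pMr// ltr1n.
have oB : open [set y : 'rV[R]_n | r < `|y - x|].
  apply: (@open_comp _ _ (fun y : 'rV[R]_n => `|y - x| : R) [set s | r < s]); last exact: open_gt.
  move=> y _; apply: (@continuous_comp _ _ _ (fun x0 : 'rV[R]_n => x0 - x) Num.norm); last exact: norm_continuous.
  by apply: continuousB => //; exact: cst_continuous.
pose H y := if `[< V y >] then bump_rV x r y * f y else 0.
exists H.
  move=> k; apply: Ck_local => y _; have [Vy|Vy] := pselect (V y).
    exists V => //; apply: (Ck_eq oV) (CkM oV (Cinfty_bump_rV x r oV k) (Cf k)) => z Vz.
    by rewrite /H; case: asboolP.
  (* Points outside [V] lie at distance more than r from [x]; this is an open set on which the
     cutoff vanishes, so the extension is locally 0 there. *)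
  have ry : r < `|y - x| by rewrite ltNge; apply/negP => /rV.
  exists [set y : 'rV[R]_n | r < `|y - x|] => //; apply: (Ck_eq oB) (Ck_cst k _ 0) => z /= rz.
  by rewrite /H; case: asboolP => // _; rewrite bump_rV0 ?mul0r// ltW.
have : ball x (r / 2) x by apply: ballxx; rewrite divr_gt0.
move=> bx; have := open_nbhs_nbhs (conj (ball_open _ _) bx); apply: filterS => y.
rewrite -ball_normE /= distrC => /ltW xy; rewrite /H; case: asboolP => [_|].
  by rewrite bump_rV1 ?mul1r.
by move=> H0; exfalso; apply: H0; apply: rV; apply: (le_trans xy); rewrite ler_pdivrMr// ler_pMr// ler1n.
Qed.

End Ck_special.

(** * Integrals over the unit interval *)

Section integral01.
Context {R : realType}.
Implicit Types f g : R -> R.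

Definition integral01 f : R := \int[lebesgue_measure]_(t in `[0, 1]) f t.

Lemma integrable01 f : continuous f ->
  lebesgue_measure.-integrable `[0 : R, 1] (EFin \o f).
Proof.
move=> cf; apply: continuous_compact_integrable; first exact: segment_compact.
exact: continuous_subspaceT.
Qed.

Lemma integral01D f g : continuous f -> continuous g ->
  integral01 (fun t => f t + g t) = integral01 f + integral01 g.
Proof. by move=> cf cg; apply: RintegralD => //; exact: integrable01. Qed.

Lemma integral01Z f c : continuous f ->
  integral01 (fun t => c * f t) = c * integral01 f.
Proof. by move=> cf; apply: RintegralZl => //; exact: integrable01. Qed.

Lemma integral01_cst c : integral01 (fun=> c) = c.
Proof.
rewrite /integral01 Rintegral_cst//= lebesgue_measure_itv/= lte_fin ltr01.
by rewrite -EFinB /= subr0 mulr1.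
Qed.

Lemma integral01B f g : continuous f -> continuous g ->
  integral01 (fun t => f t - g t) = integral01 f - integral01 g.
Proof. by move=> cf cg; apply: RintegralB => //; exact: integrable01. Qed.

Lemma continuous_bigsum (I : Type) (r : seq I) (f : I -> R -> R) :
  (forall i, continuous (f i)) -> continuous (fun t => \sum_(i <- r) f i t).
Proof.
move=> cf; elim: r => [|j s IHs] t.
  by under eq_fun do rewrite big_nil; exact: cst_continuous.
by under eq_fun do rewrite big_cons; apply: continuousD; [exact: cf|exact: IHs].
Qed.

Lemma integral01_sum (I : Type) (r : seq I) (f : I -> R -> R) :
  (forall i, continuous (f i)) ->
  integral01 (fun t => \sum_(i <- r) f i t) = \sum_(i <- r) integral01 (f i).
Proof.
move=> cf; elim: r => [|i r IH].
  rewrite big_nil -[RHS](integral01_cst 0); congr integral01.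
  by rewrite funeqE => t; rewrite big_nil.
rewrite big_cons -IH -integral01D//.
  by congr integral01; rewrite funeqE => t; rewrite big_cons.
exact: continuous_bigsum.
Qed.

Lemma integral01_le f C : continuous f -> (forall t, 0 <= t <= 1 -> `|f t| <= C) ->
  `|integral01 f| <= C.
Proof.
move=> cf fC; apply: (le_trans (le_normr_Rintegral _ _)) => //; first exact: integrable01.
rewrite -[leRHS]integral01_cst; apply: le_Rintegral => //=.
- apply: (@integrable01 (fun t => `|f t|)) => t.
  by apply: (@continuous_comp _ _ _ f Num.norm); [exact: cf|exact: norm_continuous].
- by apply: (@integrable01 (fun=> C)) => t; exact: cst_continuous.
Qed.

Lemma integral01_FTC f g : continuous g -> (forall t : R, is_derive t 1 f (g t)) ->
  integral01 g = f 1 - f 0.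
Proof.
move=> cg dfg; rewrite /integral01 /Rintegral (@continuous_FTC2 _ g f)//.
- exact: continuous_subspaceT.
- have cf t : {for t, continuous f}.
    by apply/differentiable_continuous/derivable1_diffP; case: (dfg t).
  split; first by move=> t _; case: (dfg t).
  + by apply: cvg_at_right_filter; exact: cf.
  + by apply: cvg_at_left_filter; exact: cf.
- by move=> t _; rewrite derive1E; case: (dfg t).
Qed.

End integral01.

(** * Taylor estimate, differentiation under the integral, Hadamard's lemma *)

Section hadamard.
Context {R : realType} {n : nat}.
Implicit Types (h : 'rV[R]_n -> R) (x y v : 'rV[R]_n).

Lemma is_derive_segment h y v t : differentiable h (y + t *: v) ->
  is_derive t 1 (fun t : R => h (y + t *: v))
    (linear_of (fun i => 'D_(delta_mx 0 i) h (y + t *: v)) v).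
Proof.
move=> dh.
have dl : is_diff t (fun t : R => y + t *: v) (fun t => 0 + t *: v).
  by apply: is_diffD.
have dg : is_diff t (h \o (fun t : R => y + t *: v)) _ := is_diff_comp dl (differentiableP dh).
apply: DeriveDef; first by apply/derivable1_diffP; exact: (@ex_diff _ _ _ _ _ _ _ dg).
rewrite deriveE; last exact: (@ex_diff _ _ _ _ _ _ _ dg).
rewrite (@diff_val _ _ _ _ _ _ _ dg) /= add0r scale1r -deriveE// derive_linear//.
Qed.

Lemma norm_coord v i : `|v 0 i| <= `|v|.
Proof.
rewrite [leRHS]/Num.norm /= mx_normrE.
by apply: le_trans (le_bigmax _ _ (0, i)).
Qed.

Lemma linear_of_le (c : 'I_n -> R) v C : (forall i, `|c i| <= C) ->
  `|linear_of c v| <= n%:R * C * `|v|.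
Proof.
move=> cC; apply: (le_trans (ler_norm_sum _ _ _)).
apply: (@le_trans _ _ (\sum_(i < n) C * `|v|)).
  apply: ler_sum => i _; rewrite normrM mulrC ler_pM//; exact: norm_coord.
by rewrite sumr_const card_ord -[leRHS]mulrA mulr_natl.
Qed.

Lemma ball_bounded h r : continuous h ->
  exists2 C, 0 <= C & forall x, `|x| <= r -> `|h x| <= C.
Proof.
move=> ch; have cK : compact [set x : 'rV[R]_n | `|x| <= r].
  apply: bounded_closed_compact.
    by exists r; split; [exact: num_real|move=> s rs x /= /le_trans; apply; exact: ltW].
  by apply: (@closed_comp _ _ (Num.norm : 'rV[R]_n -> R) [set s | s <= r]);
    [move=> x _; exact: norm_continuous|exact: closed_le].
have [C [_ HC]] := compact_bounded (continuous_compact (continuous_subspaceT ch) cK).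
exists (`|C| + 1); first by rewrite addr_ge0.
by move=> x xr; apply: (HC (`|C| + 1)) => /=; [have := ler_norm C; lra|exists x].
Qed.

(** The point is that [C] is uniform in [y] over a ball, so that the estimate can be integrated
    along a segment. It comes from a bound on the second partials over the ball of radius r + 1,
    which contains the segments from [y] to [y + v]. *)
Lemma taylor1 h r : Cinfty setT h ->
  exists2 C, 0 <= C & forall y v, `|y| <= r -> `|v| <= 1 ->
    `|h (y + v) - h y - linear_of (fun i => 'D_(delta_mx 0 i) h y) v| <= C * `|v| ^+ 2.
Proof.
move=> Ch.
have dh x : differentiable h x by case: (Ch 1%N) => + _; exact.
have dhi i x : differentiable ('D_(delta_mx 0 i) h) x.
  by case: (Ch 2%N) => _ /(_ i)[+ _]; exact.
have chij i j : continuous ('D_(delta_mx 0 j) ('D_(delta_mx 0 i) h)).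
  by move=> x; case: (Ch 2%N) => _ /(_ i)[_ /(_ j x I)].
have [C C0 HC] : exists2 C, 0 <= C & forall i j x, `|x| <= r + 1 ->
    `|'D_(delta_mx 0 j) ('D_(delta_mx 0 i) h) x| <= C.
  have /choice[c Hc] : forall ij : 'I_n * 'I_n, exists C, 0 <= C /\
      forall x, `|x| <= r + 1 ->
      `|'D_(delta_mx 0 ij.2) ('D_(delta_mx 0 ij.1) h) x| <= C.
    by move=> [i j]; have [C ? ?] := ball_bounded (r + 1) (chij i j); exists C.
  (* The sum of the nonnegative constants is a common bound for all pairs. *)
  exists (\sum_ij c ij); first by apply: sumr_ge0 => ij _; case: (Hc ij).
  move=> i j x xr; rewrite (bigD1 (i, j))//=; have [_ /(_ x xr) H] := Hc (i, j).
  by apply: (le_trans H); rewrite lerDl sumr_ge0// => ij _; case: (Hc ij).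
exists (n%:R * (n%:R * C)); first by rewrite !mulr_ge0.
move=> y v yr v1.
have in_ball s : 0 <= s <= 1 -> `|y + s *: v| <= r + 1.
  move=> /andP[s0 s1]; apply: (le_trans (ler_normD _ _)); rewrite lerD//.
  by rewrite normrZ ger0_norm// mulr_ile1.
have segcont (k : 'rV[R]_n -> R) : (forall x, differentiable k x) ->
    forall a b : R, {within `[a, b], continuous (fun s : R => k (y + s *: v))}.
  move=> dk a b; apply: derivable_within_continuous => s _.
  by case: (is_derive_segment (dk (y + s *: v))).
have [s s01] := @MVT R _ _ 0 1 ltr01 (fun s _ => is_derive_segment (dh (y + s *: v))) (segcont _ dh _ _).
rewrite scale0r addr0 scale1r subr0 mulr1 => ->.
have -> : linear_of (fun i => 'D_(delta_mx 0 i) h (y + s *: v)) v -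
   linear_of (fun i => 'D_(delta_mx 0 i) h y) v =
   linear_of (fun i => 'D_(delta_mx 0 i) h (y + s *: v) - 'D_(delta_mx 0 i) h y) v.
  by rewrite /linear_of -sumrB; apply: eq_bigr => i _; rewrite mulrBr.
have {}s01 : 0 <= s <= 1 by move: s01; rewrite in_itv /= => /andP[/ltW -> /ltW ->].
have -> : n%:R * (n%:R * C) * `|v| ^+ 2 = n%:R * (n%:R * C * `|v|) * `|v| by ring.
apply: linear_of_le => i; case/andP: (s01) => s0 s1.
(* The first mean value moved the gradient to [y + s *: v]; a second one compares it with the
   gradient at [y] and supplies the other factor of the norm of [v]. *)
have [c c01] := MVT_segment s0 (fun s _ => is_derive_segment (dhi i (y + s *: v))) (segcont _ (dhi i) _ _).
rewrite scale0r addr0 subr0 => ->; rewrite normrM (ger0_norm s0).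
apply: (@le_trans _ _ (n%:R * C * `|v| * 1)); last by rewrite mulr1.
apply: ler_pM => //; apply: linear_of_le => j; apply: HC; apply: in_ball.
by move: c01; rewrite in_itv /= => /andP[-> /le_trans]; apply.
Qed.

(** The weight t^m makes the family stable under differentiation: the inner derivative of x0 + t (x
    - x0) contributes one more factor t each time. *)
Definition ray_mean (m : nat) (x0 : 'rV[R]_n) h x : R :=
  integral01 (fun t => t ^+ m * h (x0 + t *: (x - x0))).

Lemma ray_continuous m x0 h x : continuous h ->
  continuous (fun t : R => t ^+ m * h (x0 + t *: (x - x0))).
Proof.
move=> ch t; apply: (@continuousM R R (fun t => t ^+ m) (fun t => h _)); first exact: exprn_continuous.
apply: (@continuous_comp _ _ _ (fun t : R => x0 + t *: (x - x0)) h); last exact: ch.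
by apply: continuousD; [exact: cst_continuous|exact: scalel_continuous].
Qed.

Lemma Cinfty_continuous h : Cinfty setT h -> continuous h.
Proof. by move=> /(_ 0%N) /= H x; exact: H. Qed.

Lemma CinftyD_partial h i : Cinfty setT h -> Cinfty setT ('D_(delta_mx 0 i) h).
Proof. by move=> Ch k; case: (Ch k.+1) => _; exact. Qed.

(** Differentiation under the integral sign. The remainder of the integrand is bounded by [taylor1]
    uniformly in t, on a ball that contains the segment from [x0] to [x], and then integrated. *)
Lemma ray_mean_derive m x0 h x : Cinfty setT h ->
  differentiable (ray_mean m x0 h) x /\ forall i,
  'D_(delta_mx 0 i) (ray_mean m x0 h) x = ray_mean m.+1 x0 ('D_(delta_mx 0 i) h) x.
Proof.
move=> Ch; have [C C0 HC] := taylor1 (`|x0| + `|x - x0|) Ch.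
apply: (@differentiable_quad _ _ _ _ _ C 1) => // v v1.
have cr m' k y : Cinfty setT k -> continuous (fun t : R => t ^+ m' * k (x0 + t *: (y - x0))).
  by move=> Ck; apply: ray_continuous; exact: Cinfty_continuous.
have cv i : continuous (fun t : R => v 0 i * (t ^+ m.+1 * 'D_(delta_mx 0 i) h (x0 + t *: (x - x0)))).
  move=> t; apply: (@continuousM R R (fun=> v 0 i) (fun t => _)); first exact: cst_continuous.
  by apply: (cr m.+1 ('D_(delta_mx 0 i) h)); exact: CinftyD_partial.
have cs := @continuous_bigsum _ _ (index_enum 'I_n) _ cv.
have cd : continuous (fun t : R => t ^+ m * h (x0 + t *: (v + x - x0)) -
      t ^+ m * h (x0 + t *: (x - x0))).
  by move=> t; apply: (@continuousB R R^o R (fun t => t ^+ m * h _) (fun t => t ^+ m * h _)); exact: cr.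
have -> : ray_mean m x0 h (v + x) - ray_mean m x0 h x -
    linear_of (fun i => ray_mean m.+1 x0 ('D_(delta_mx 0 i) h) x) v =
  integral01 (fun t => t ^+ m * h (x0 + t *: (v + x - x0)) - t ^+ m * h (x0 + t *: (x - x0))
     - \sum_i (v 0 i * (t ^+ m.+1 * 'D_(delta_mx 0 i) h (x0 + t *: (x - x0))))).
  rewrite integral01B//; congr (_ - _); first by rewrite integral01B//; exact: cr.
  rewrite integral01_sum//; apply: eq_bigr => i _.
  by rewrite integral01Z//; apply: (cr m.+1 ('D_(delta_mx 0 i) h)); exact: CinftyD_partial.
apply: integral01_le; first by move=> t; apply: (@continuousB R R^o R (fun t => _) (fun t => _)); [exact: cd|exact: cs].
move=> t /andP[t0 t1].
have -> : x0 + t *: (v + x - x0) = (x0 + t *: (x - x0)) + t *: v.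
  by rewrite -[v + x - x0]addrA scalerDr addrCA addrC.
have -> : \sum_i v 0 i * (t ^+ m.+1 * 'D_(delta_mx 0 i) h (x0 + t *: (x - x0))) =
   t ^+ m * linear_of (fun i => 'D_(delta_mx 0 i) h (x0 + t *: (x - x0))) (t *: v).
  by rewrite /linear_of mulr_sumr; apply: eq_bigr => i _; rewrite mxE exprS; ring.
rewrite -mulrBr -mulrBr normrM -[leRHS]mul1r ler_pM//.
  by rewrite normrX ger0_norm// exprn_ile1.
have tv : `|t *: v| <= `|v| by rewrite normrZ ger0_norm// ler_piMl.
apply: (le_trans (HC _ _ _ _)).
- apply: (le_trans (ler_normD _ _)); rewrite lerD// normrZ ger0_norm//.
  by rewrite ler_piMl.
- by apply: (le_trans tv); exact: ltW.
- by rewrite ler_wpM2l// ler_pXn2r ?nnegrE.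
Qed.

Lemma Cinfty_ray_mean m x0 h : Cinfty setT h -> Cinfty setT (ray_mean m x0 h).
Proof.
move=> + k; elim: k m h => [|k IH] m h Ch.
  by move=> x _; apply: differentiable_continuous; case: (ray_mean_derive m x0 x Ch).
split=> [x _|i]; first by case: (ray_mean_derive m x0 x Ch).
rewrite (_ : 'D_(delta_mx 0 i) _ = ray_mean m.+1 x0 ('D_(delta_mx 0 i) h)).
  by apply: IH; exact: CinftyD_partial.
by rewrite funeqE => x; case: (ray_mean_derive m x0 x Ch).
Qed.

(** The difference h x - h x0 is the integral of the derivative of h along the segment; [K i] is the
    mean of the i-th partial derivative over it, and at [x0] the integrand is constant. *)
Lemma hadamard h x0 : Cinfty setT h ->
  exists K : 'I_n -> 'rV[R]_n -> R, [/\ forall i, Cinfty setT (K i),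
    forall x, h x = h x0 + \sum_i (x 0 i - x0 0 i) * K i x &
    forall i, K i x0 = 'D_(delta_mx 0 i) h x0].
Proof.
move=> Ch; exists (fun i => ray_mean 0 x0 ('D_(delta_mx 0 i) h)); split.
- by move=> i; apply: Cinfty_ray_mean; exact: CinftyD_partial.
- move=> x.
  have dh y : differentiable h y by case: (Ch 1%N) => + _; exact.
  have cr i : continuous (fun t : R => t ^+ 0 * 'D_(delta_mx 0 i) h (x0 + t *: (x - x0))).
    apply: (@ray_continuous 0 x0 ('D_(delta_mx 0 i) h)).
    by apply: Cinfty_continuous; exact: CinftyD_partial.
  have cr' i : continuous (fun t : R => (x 0 i - x0 0 i) * (t ^+ 0 * 'D_(delta_mx 0 i) h (x0 + t *: (x - x0)))).
    move=> t; apply: (@continuousM R R (fun=> x 0 i - x0 0 i) (fun t => _)); first exact: cst_continuous.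
    exact: cr.
  under eq_bigr => i _ do rewrite -integral01Z//.
  rewrite -integral01_sum//.
  have ftc := @integral01_FTC _ (fun t : R => h (x0 + t *: (x - x0))) _
    (@continuous_bigsum _ _ (index_enum 'I_n) _ cr').
  have dg (t : R) : is_derive t 1 (fun t0 : R => h (x0 + t0 *: (x - x0)))
       (\sum_i (x 0 i - x0 0 i) * (t ^+ 0 * 'D_(delta_mx 0 i) h (x0 + t *: (x - x0)))).
    have := is_derive_segment (dh (x0 + t *: (x - x0))).
    move/is_derive_eq; apply; rewrite /linear_of; apply: eq_bigr => i _.
    by rewrite !mxE expr0 mul1r.
  by rewrite (ftc dg) scale1r scale0r addr0 !subrKC.
- move=> i; rewrite /ray_mean -[RHS]integral01_cst; congr integral01.
  by rewrite funeqE => t; rewrite subrr scaler0 addr0 expr0 mul1r.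
Qed.

End hadamard.

(** * Manifolds and tangent vectors *)

Lemma open_bigcap_fin (T : topologicalType) (I : finType) (W : I -> set T) :
  (forall i, open (W i)) -> open (\bigcap_(i in [set: I]) W i).
Proof.
move=> oW; rewrite openE => x Wx; rewrite /interior.
have : \forall y \near x, forall i, W i y.
  by apply: filter_forall => i; apply: open_nbhs_nbhs; split; [exact: oW|exact: Wx].
by apply: filterS => y Wy i _.
Qed.

Section charts.
Context {R : realType} {M : premanifold R} (mM : manifold M).
Local Notation n := (mdim M).
Implicit Types (c d : chart R M n) (p q : M) (h k : M -> R).

Lemma chart_at p : exists2 c, @atlas R M c & dom c p.
Proof. by case: mM => _ _ + _ _; apply. Qed.

Lemma fwdK c p : @atlas R M c -> dom c p -> bwd c (fwd c p) = p.
Proof. by case: mM => _ _ _ + _ => H /H[_ _ + _ _]; apply. Qed.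

Lemma dom_open c : @atlas R M c -> open (dom c).
Proof. by case: mM => _ _ _ + _ => H /H[]. Qed.

Lemma img_open c : @atlas R M c -> open (chart_img c).
Proof. by case: mM => _ _ _ + _ => H /H[]. Qed.

Lemma bwd_dom c x : @atlas R M c -> chart_img c x -> dom c (bwd c x).
Proof. by move=> ac [p cp <-]; rewrite fwdK. Qed.

Lemma bwdK c x : @atlas R M c -> chart_img c x -> fwd c (bwd c x) = x.
Proof. by move=> ac [p cp <-]; rewrite fwdK. Qed.

Lemma fwd_img c p : dom c p -> chart_img c (fwd c p).
Proof. by exists p. Qed.

Lemma fwd_continuous c p : @atlas R M c -> dom c p -> {for p, continuous (fwd c)}.
Proof.
move=> ac cp; case: mM => _ _ _ /(_ c ac)[od _ _ + _] _.
by rewrite continuous_open_subspace// => H; apply: H; rewrite inE.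
Qed.

Lemma bwd_continuous c x : @atlas R M c -> chart_img c x -> {for x, continuous (bwd c)}.
Proof.
move=> ac cx; case: mM => _ _ _ /(_ c ac)[_ oi _ _ +] _.
by rewrite continuous_open_subspace// => H; apply: H; rewrite inE.
Qed.

Lemma chart_open_img c (U : set M) : @atlas R M c -> open U -> open (fwd c @` (dom c `&` U)).
Proof.
move=> ac oU.
have -> : fwd c @` (dom c `&` U) = chart_img c `&` bwd c @^-1` U.
  apply/seteqP; split => [x [p [cp Up] <-]|x [cx Ux]].
    by split; [exact: fwd_img|rewrite /= fwdK].
  by exists (bwd c x); [split => //; exact: bwd_dom|exact: bwdK].
rewrite openE => x [cx Ux]; rewrite /interior.
apply: filterI; first exact: (open_nbhs_nbhs (conj (img_open ac) cx)).
exact: (bwd_continuous ac cx (open_nbhs_nbhs (conj oU Ux))).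
Qed.

Lemma chart_open_preimage c (V : set 'rV[R]_n) : @atlas R M c -> open V ->
  open (dom c `&` fwd c @^-1` V).
Proof.
move=> ac oV; rewrite openE => p [cp Vp]; rewrite /interior.
apply: filterI; first exact: (open_nbhs_nbhs (conj (dom_open ac) cp)).
exact: (fwd_continuous ac cp (open_nbhs_nbhs (conj oV Vp))).
Qed.

(** Smoothness of the germ at [p], tested in one chart only. Compatibility of charts makes the
    choice of chart immaterial, and [smooth] amounts to this condition at every point. *)
Definition smooth_near h p := exists c, exists V : set 'rV[R]_n,
  [/\ @atlas R M c, dom c p, open V & V (fwd c p)] /\
  V `<=` chart_img c /\ Cinfty V (h \o bwd c).

Lemma smooth_near_chart h p d : smooth_near h p -> @atlas R M d -> dom d p ->
  exists V : set 'rV[R]_n, [/\ open V, V (fwd d p), V `<=` chart_img d &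
  Cinfty V (h \o bwd d)].
Proof.
move=> [c [V [[ac cp oV Vp] [Vc Ch]]]] ad dp.
pose W := fwd d @` (dom d `&` (dom c `&` fwd c @^-1` V)).
have oW : open W by apply: chart_open_img => //; exact: chart_open_preimage.
exists W; split => //; first by exists p.
  by move=> _ [q [dq _] <-]; exact: fwd_img.
move=> k; have Ct i : Ck k W (fun x => fwd c (bwd d x) 0 i).
  case: mM => _ _ _ _ /(_ d c ad ac i k); apply: Ck_sub => _ [q [dq [cq _]] <-].
  by exists q.
have WV x : W x -> V (fwd c (bwd d x)) by move=> [q [dq [cq Vq]] <-]; rewrite fwdK.
apply: (Ck_eq oW) (Ck_comp oW WV Ct (Ch k)) => x [q [dq [cq _]] <-] /=.
by rewrite !fwdK.
Qed.

Lemma near_chart c p (P : set M) : @atlas R M c -> dom c p -> (\forall q \near p, P q) ->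
  exists W : set 'rV[R]_n, [/\ open W, W (fwd c p), W `<=` chart_img c &
    forall x, W x -> P (bwd c x)].
Proof.
move=> ac cp nP.
have [U [oU Up] UP] : exists2 U, open_nbhs p U & U `<=` P.
  by move: nP; rewrite /prop_near1 nbhsE.
exists (fwd c @` (dom c `&` U)); split; first exact: chart_open_img.
- by exists p.
- by move=> _ [q [cq _] <-]; exact: fwd_img.
- by move=> _ [q [cq Uq] <-]; rewrite fwdK//; exact: UP.
Qed.

Lemma smooth_near_near h p : smooth_near h p -> \forall q \near p, smooth_near h q.
Proof.
move=> [c [V [[ac cp oV Vp] [Vc Ch]]]].
have o := chart_open_preimage ac oV.
have : (dom c `&` fwd c @^-1` V) p by [].
move=> H; have := open_nbhs_nbhs (conj o H); apply: filterS => q [cq Vq].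
by exists c, V.
Qed.

Lemma smooth_near_eq h k p : (\forall q \near p, h q = k q) ->
  smooth_near h p -> smooth_near k p.
Proof.
move=> hk [c [V [[ac cp oV Vp] [Vc Ch]]]].
have [W [oW Wp _ WH]] := near_chart ac cp hk.
exists c, (V `&` W); split; first by split => //; exact: openI.
split=> [x [/Vc]//|j]; apply: (@Ck_eq _ _ _ _ (h \o bwd c)); first exact: openI.
  by move=> x [_ /WH].
by apply: Ck_sub (Ch j) => x [].
Qed.

Lemma smooth_near_continuous h p : smooth_near h p -> {for p, continuous h}.
Proof.
move=> [c [V [[ac cp oV Vp] [Vc Ch]]]].
have ch : {for fwd c p, continuous (h \o bwd c)} by apply: (Ch 0%N).
have := continuous_comp (fwd_continuous ac cp) ch.
rewrite /prop_for /continuous_at /= fwdK// => H; apply: (cvg_trans _ H); apply: near_eq_cvg.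
near=> q; rewrite /= fwdK//; near: q.
exact: (open_nbhs_nbhs (conj (dom_open ac) cp)).
Unshelve. all: by end_near. Qed.

Lemma smooth_fun_onP (U : set M) h : open U ->
  smooth_fun_on U h <-> forall p, U p -> smooth_near h p.
Proof.
move=> oU; split=> [H p Up|H c ac k].
  have [c ac cp] := chart_at p; exists c, (fwd c @` (dom c `&` U)); split.
    by split => //; [exact: chart_open_img|exists p].
  by split; [move=> _ [q [cq _] <-]; exact: fwd_img|exact: H].
apply: Ck_local => _ [p [cp Up] <-].
have [V [oV Vp _ CV]] := smooth_near_chart (H p Up) ac cp.
by exists V.
Qed.

Lemma smoothP h : smooth h <-> forall p, smooth_near h p.
Proof.
have -> : smooth h <-> smooth_fun_on setT h.
  rewrite /smooth /smooth_fun_on.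
  suff E c : fwd c @` (dom c `&` setT) = chart_img c.
    by split => H c ac; [rewrite E|rewrite -E]; exact: H.
  by rewrite setIT.
by split=> [/(smooth_fun_onP _ openT) H p|H]; [exact: H|apply/smooth_fun_onP => //; exact: openT].
Qed.

Lemma smooth_near_comp_rV m (phi : M -> 'rV[R]_m) (H : 'rV[R]_m -> R) p (V : set 'rV[R]_m) :
  open V -> V (phi p) -> Cinfty V H ->
  (forall i, smooth_near (fun q => phi q 0 i) p) -> smooth_near (H \o phi) p.
Proof.
move=> oV Vp CH Hphi; have [c ac cp] := chart_at p.
have /choice[W HW] : forall i, exists W : set 'rV[R]_n, [/\ open W, W (fwd c p) , W `<=` chart_img c &
  Cinfty W ((fun q => phi q 0 i) \o bwd c)].
  by move=> i; exact: smooth_near_chart (Hphi i) ac cp.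
have cphi : {for p, continuous phi}.
  by apply: continuous_rV => i; exact: smooth_near_continuous.
have nV : \forall q \near p, V (phi q) by apply: cphi; exact: (open_nbhs_nbhs (conj oV Vp)).
have [W0 [oW0 W0p W0c W0H]] := near_chart ac cp nV.
pose W1 := W0 `&` \bigcap_(i in [set: 'I_m]) W i.
have oW1 : open W1.
  by apply: openI => //; apply: open_bigcap_fin => i; case: (HW i).
exists c, W1; split.
  by split => //; split => // i _; case: (HW i).
split=> [x [/W0c]//|k].
apply: (@Ck_comp _ _ _ k W1 V (phi \o bwd c) H oW1 _ _ (CH k)).
  by move=> x [/W0H].
by move=> j; case: (HW j) => _ _ _ /(_ k); apply: Ck_sub => x [_ /(_ j I)].
Qed.

End charts.

(** * Algebra of smooth functions, cutoffs and extension of germs *)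

Section smooth_functions.
Context {R : realType} {M : premanifold R} (mM : manifold M).
Local Notation n := (mdim M).
Implicit Types (c : chart R M n) (p q : M) (h k : M -> R).

Lemma smooth_near_cst (a : R) p : smooth_near (fun=> a : R) p.
Proof.
have [c ac cp] := chart_at mM p; exists c, (chart_img c); split.
  by split => //; [exact: img_open|exact: fwd_img].
by split => // k; exact: Ck_cst.
Qed.

Lemma smooth_near_op2 (op : R -> R -> R) h k p :
  (forall j (U : set 'rV[R]_n) f g, open U -> Ck j U f -> Ck j U g ->
     Ck j U (fun x => op (f x) (g x))) ->
  smooth_near h p -> smooth_near k p -> smooth_near (fun q => op (h q) (k q)) p.
Proof.
move=> Hop sh sk; have [c ac cp] := chart_at mM p.
have [V [oV Vp Vc CV]] := smooth_near_chart mM sh ac cp.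
have [W [oW Wp Wc CW]] := smooth_near_chart mM sk ac cp.
exists c, (V `&` W); split; first by split => //; exact: openI.
split=> [x [/Vc]//|j]; apply: (Hop j _ (h \o bwd c) (k \o bwd c)); first exact: openI.
  by apply: Ck_sub (CV j) => x [].
by apply: Ck_sub (CW j) => x [].
Qed.

Lemma smooth_nearD h k p : smooth_near h p -> smooth_near k p ->
  smooth_near (fun q => h q + k q) p.
Proof. by apply: smooth_near_op2 => *; exact: CkD. Qed.

Lemma smooth_nearM h k p : smooth_near h p -> smooth_near k p ->
  smooth_near (fun q => h q * k q) p.
Proof. by apply: smooth_near_op2 => *; exact: CkM. Qed.

Lemma smooth_nearN h p : smooth_near h p -> smooth_near (fun q => - h q) p.
Proof.
move=> sh; have := smooth_nearM (smooth_near_cst (-1) p) sh.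
by apply: (smooth_near_eq mM); near=> q; rewrite mulN1r.
Unshelve. all: by end_near. Qed.

Lemma smooth_nearB h k p : smooth_near h p -> smooth_near k p ->
  smooth_near (fun q => h q - k q) p.
Proof. by move=> sh sk; apply: smooth_nearD => //; exact: smooth_nearN. Qed.

Lemma smooth_near_expR h p : smooth_near h p -> smooth_near (fun q => expR (h q)) p.
Proof.
(* A unary function is passed as a binary one that ignores its second argument. *)
by move=> sh; apply: (smooth_near_op2 (op := fun a _ => expR a) _ sh sh) => *; exact: Ck_expR.
Qed.

Lemma smooth_near_atan h p : smooth_near h p -> smooth_near (fun q => atan (h q)) p.
Proof.
by move=> sh; apply: (smooth_near_op2 (op := fun a _ => atan a) _ sh sh) => *; exact: Ck_atan.
Qed.

Lemma smooth_near_inv h p : h p != 0 -> smooth_near h p -> smooth_near (fun q => (h q)^-1) p.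
Proof.
move=> hp0 sh; have [c ac cp] := chart_at mM p.
have [V [oV Vp Vc CV]] := smooth_near_chart mM sh ac cp.
have nh0 : \forall q \near p, h q != 0.
  exact: (smooth_near_continuous mM sh (open_nbhs_nbhs (conj (@open_neq _ 0) hp0))).
have [W [oW Wp Wc WH]] := near_chart mM ac cp nh0.
exists c, (V `&` W); split; first by split => //; exact: openI.
split=> [x [/Vc]//|j]; apply: (@Ck_inv _ _ _ _ (h \o bwd c)); first exact: openI.
  by move=> x [_ /WH].
by apply: Ck_sub (CV j) => x [].
Qed.

Lemma smooth_near_sum (I : Type) (r : seq I) (P : pred I) (h : I -> M -> R) p :
  (forall i, P i -> smooth_near (h i) p) -> smooth_near (fun q => \sum_(i <- r | P i) h i q) p.
Proof.
move=> sh; elim: r => [|i r IH].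
  by apply: (smooth_near_eq mM) (smooth_near_cst 0 p); near=> q; rewrite big_nil.
case Pi : (P i).
  apply: (smooth_near_eq mM) (smooth_nearD (sh i Pi) IH).
  by near=> q; rewrite big_cons Pi.
by apply: (smooth_near_eq mM) IH; near=> q; rewrite big_cons Pi.
Unshelve. all: by end_near. Qed.

Lemma smooth_near_prod (I : Type) (r : seq I) (P : pred I) (h : I -> M -> R) p :
  (forall i, P i -> smooth_near (h i) p) -> smooth_near (fun q => \prod_(i <- r | P i) h i q) p.
Proof.
move=> sh; elim: r => [|i r IH].
  by apply: (smooth_near_eq mM) (smooth_near_cst 1 p); near=> q; rewrite big_nil.
case Pi : (P i).
  apply: (smooth_near_eq mM) (smooth_nearM (sh i Pi) IH).
  by near=> q; rewrite big_cons Pi.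
by apply: (smooth_near_eq mM) IH; near=> q; rewrite big_cons Pi.
Unshelve. all: by end_near. Qed.

Lemma smooth_near_fwd c p i : @atlas R M c -> dom c p -> smooth_near (fun q => fwd c q 0 i) p.
Proof.
move=> ac cp; exists c, (chart_img c); split.
  by split => //; [exact: img_open|exact: fwd_img].
split => // k; apply: (Ck_eq (img_open mM ac) _ (Ck_coord _ _ i)) => x cx.
by rewrite /= (bwdK mM).
Qed.

(** The cutoff of a chart is extended by 0. The closed set [C] inside [W] is recorded because a
    product with a function smooth on [W] only is then smooth: a point is either in [W] or in the
    open complement of [C]. *)
Lemma bump_exists p (W : set M) : open W -> W p ->
  exists b : M -> R, [/\ smooth b, \forall q \near p, b q = 1 &
    exists2 C : set M, closed C & C `<=` W /\ forall q, ~ C q -> b q = 0].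
Proof.
move=> oW Wp; have [c ac cp] := chart_at mM p.
have [V [oV Vp Vc WV]] := near_chart mM ac cp (open_nbhs_nbhs (conj oW Wp)).
have [r r0 rV] : exists2 r : R, 0 < r & forall x, `|x - fwd c p| <= r -> V x.
  have /nbhs_ballP[e /= e0 eV] := open_nbhs_nbhs (conj oV Vp).
  exists (e / 2); first by rewrite divr_gt0.
  move=> x xe; apply: eV; rewrite -ball_normE /= distrC (le_lt_trans xe)//.
  by rewrite ltr_pdivrMr// ltr_pMr// ltr1n.
pose K : set 'rV[R]_n := [set x | `|x - fwd c p| <= r].
have KV : K `<=` V by [].
have cK : compact K.
  apply: bounded_closed_compact.
    exists (r + `|fwd c p|); split; first exact: num_real.
    move=> s rs x /= Kx; rewrite -(subrK (fwd c p) x).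
    by rewrite (le_trans (ler_normD _ _))// (le_trans _ (ltW rs))// lerD2r.
  apply: (@closed_comp _ _ (fun x : 'rV[R]_n => `|x - fwd c p| : R) [set s | s <= r]) => [x _|];
    last exact: closed_le.
  apply: (@continuous_comp _ _ _ (fun x : 'rV[R]_n => x - fwd c p) Num.norm); last exact: norm_continuous.
  by apply: continuousB => //; exact: cst_continuous.
(* Being closed in the chart would not do: extension by 0 needs a closed subset of the manifold,
   which compactness and the Hausdorff axiom provide. *)
have cC : closed (bwd c @` K).
  apply: compact_closed; first by case: mM.
  apply: continuous_compact => //; apply: continuous_in_subspaceT => x /[!inE] /KV/Vc cx.
  exact: (bwd_continuous mM ac cx).
pose b q := if `[< dom c q >] then bump_rV (fwd c p) r (fwd c q) else 0.
have bC q : ~ (bwd c @` K) q -> b q = 0.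
  move=> Cq; rewrite /b; case: asboolP => // cq; apply: bump_rV0 => //.
  rewrite leNgt; apply/negP => Kq; apply: Cq; exists (fwd c q); first exact: ltW.
  exact: (fwdK mM).
have Cdom : bwd c @` K `<=` dom c by move=> _ [x /KV/Vc cx <-]; exact: (bwd_dom mM).
exists b; split.
- apply/(smoothP mM) => q; have [/Cdom cq|Cq] := pselect ((bwd c @` K) q).
    exists c, (chart_img c); split.
      by split => //; [exact: img_open|exact: fwd_img].
    split => // k; have o := img_open mM ac.
    apply: (Ck_eq o _ (Cinfty_bump_rV (fwd c p) r o k)) => x cx.
    by rewrite /b /=; case: asboolP => [_|/(_ (bwd_dom mM ac cx))//]; rewrite (bwdK mM).
  apply: (smooth_near_eq mM) (smooth_near_cst 0 q); near=> q'.
  rewrite bC//; near: q'.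
  by apply: (open_nbhs_nbhs (conj (closed_openC cC) _)).
- have H : (dom c `&` fwd c @^-1` (ball (fwd c p) (r / 2))) p.
    by split => //=; apply: ballxx; rewrite divr_gt0.
  have := open_nbhs_nbhs (conj (chart_open_preimage mM ac (ball_open _ _)) H).
  apply: filterS => q [cq].
  rewrite /= -ball_normE /= distrC => /ltW qr; rewrite /b; case: asboolP => // _.
  exact: bump_rV1.
- exists (bwd c @` K) => //; split => // _ [x /KV Vx <-]; exact: WV.
Unshelve. all: by end_near. Qed.

Lemma smooth_cutoff (W C : set M) b h : closed C -> C `<=` W ->
  (forall q, ~ C q -> b q = 0) -> smooth b -> (forall q, W q -> smooth_near h q) ->
  smooth (fun q => b q * h q).
Proof.
move=> cC CW b0 /(smoothP mM) sb sh; apply/(smoothP mM) => q.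
have [/CW/sh hq|Cq] := pselect (C q); first exact: smooth_nearM.
apply: (smooth_near_eq mM) (smooth_near_cst 0 q); near=> q'.
rewrite b0 ?mul0r//; near: q'.
by apply: (open_nbhs_nbhs (conj (closed_openC cC) _)).
Unshelve. all: by end_near. Qed.

(** Derivations only see globally smooth functions, so local ones such as chart coordinates are
    replaced by global functions with the same germ. *)
Lemma smooth_extension h p : smooth_near h p ->
  exists2 k, smooth k & \forall q \near p, k q = h q.
Proof.
move=> /(smooth_near_near mM) nW.
have [W [oW Wp] WH] : exists2 W, open_nbhs p W & W `<=` smooth_near h.
  by move: nW; rewrite /prop_near1 nbhsE.
have [b [sb b1 [C cC [CW b0]]]] := bump_exists oW Wp.
exists (fun q => b q * h q); first exact: smooth_cutoff cC CW b0 sb WH.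
by apply: filterS b1 => q ->; rewrite mul1r.
Qed.

Lemma smooth_cst (a : R) : smooth (fun _ : M => a).
Proof. by apply/(smoothP mM) => p; exact: smooth_near_cst. Qed.

Lemma smoothD h k : smooth h -> smooth k -> smooth (fun q => h q + k q).
Proof.
by move=> /(smoothP mM) sh /(smoothP mM) sk; apply/(smoothP mM) => p; exact: smooth_nearD.
Qed.

Lemma smoothM h k : smooth h -> smooth k -> smooth (fun q => h q * k q).
Proof.
by move=> /(smoothP mM) sh /(smoothP mM) sk; apply/(smoothP mM) => p; exact: smooth_nearM.
Qed.

Lemma smoothN h : smooth h -> smooth (fun q => - h q).
Proof. by move=> /(smoothP mM) sh; apply/(smoothP mM) => p; exact: smooth_nearN. Qed.

Lemma smoothB h k : smooth h -> smooth k -> smooth (fun q => h q - k q).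
Proof. by move=> sh sk; apply: smoothD => //; exact: smoothN. Qed.

Lemma smooth_sum (I : Type) (r : seq I) (P : pred I) (h : I -> M -> R) :
  (forall i, P i -> smooth (h i)) -> smooth (fun q => \sum_(i <- r | P i) h i q).
Proof.
move=> sh; apply/(smoothP mM) => p; apply: smooth_near_sum => i Pi.
by have /(smoothP mM) := sh i Pi; apply.
Qed.

End smooth_functions.

(** * Tangent vectors as derivations, and local frames *)

Section tangent_vectors.
Context {R : realType} {M : premanifold R} (mM : manifold M).
Local Notation n := (mdim M).
Implicit Types (c : chart R M n) (p q : M) (h k : M -> R) (u v w : tvec M).

Lemma tangent_ns p v h : tangent p v -> ~ smooth h -> v h = 0.
Proof. by case=> + _ _; apply. Qed.

Lemma tangent_lin p v a h k : tangent p v -> smooth h -> smooth k ->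
  v (fun q => a * h q + k q) = a * v h + v k.
Proof. by case=> _ + _; apply. Qed.

Lemma tangent_mul p v h k : tangent p v -> smooth h -> smooth k ->
  v (fun q => h q * k q) = v h * k p + h p * v k.
Proof. by case=> _ _; apply. Qed.

Lemma tangent_ext p v w : tangent p v -> tangent p w ->
  (forall h, smooth h -> v h = w h) -> v = w.
Proof.
move=> tv tw vw; rewrite funeqE => h; have [/vw//|nh] := pselect (smooth h).
by rewrite (tangent_ns tv)// (tangent_ns tw).
Qed.

(** The product rule on 1 = 1 * 1 gives v 1 = 2 v 1, and linearity does the rest. *)
Lemma tangent_cst p v (a : R) : tangent p v -> v (fun=> a) = 0.
Proof.
move=> tv; have s0 (b : R) := smooth_cst mM b.
have v1 : v (fun=> 1) = 0.
  have := tangent_mul tv (s0 1) (s0 1); rewrite mulr1 mulr1 mul1r => H; lra.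
have := tangent_lin a tv (s0 1) (s0 0).
have -> : (fun _ : M => a * 1 + 0) = (fun=> a) by rewrite funeqE => q; rewrite mulr1 addr0.
have v0 : v (fun=> 0) = 0.
  have := tangent_mul tv (s0 0) (s0 0); rewrite mulr0 mulr0 mul0r; lra.
by rewrite v1 v0 mulr0 addr0.
Qed.

Lemma tangentD_fun p v h k : tangent p v -> smooth h -> smooth k ->
  v (fun q => h q + k q) = v h + v k.
Proof.
move=> tv sh sk; have := tangent_lin 1 tv sh sk; rewrite mul1r => <-.
by congr v; rewrite funeqE => q; rewrite mul1r.
Qed.

Lemma tangentZ_fun p v a h : tangent p v -> smooth h -> v (fun q => a * h q) = a * v h.
Proof.
move=> tv sh; have := tangent_lin a tv sh (smooth_cst mM 0).
rewrite (tangent_cst 0 tv) addr0 => <-.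
by congr v; rewrite funeqE => q; rewrite addr0.
Qed.

Lemma tangentN_fun p v h : tangent p v -> smooth h -> v (fun q => - h q) = - v h.
Proof.
move=> tv sh; rewrite -[RHS]mulN1r -(tangentZ_fun _ tv sh).
by congr v; rewrite funeqE => q; rewrite mulN1r.
Qed.

Lemma tangentB_fun p v h k : tangent p v -> smooth h -> smooth k ->
  v (fun q => h q - k q) = v h - v k.
Proof.
move=> tv sh sk; rewrite (tangentD_fun tv sh (smoothN mM sk)).
by rewrite (tangentN_fun tv sk).
Qed.

Lemma tangent_sum_fun p v (I : Type) (r : seq I) (h : I -> M -> R) : tangent p v ->
  (forall i, smooth (h i)) -> v (fun q => \sum_(i <- r) h i q) = \sum_(i <- r) v (h i).
Proof.
move=> tv sh; elim: r => [|i r IH].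
  rewrite big_nil -[RHS](tangent_cst 0 tv); congr v.
  by rewrite funeqE => q; rewrite big_nil.
rewrite big_cons -IH -(tangentD_fun tv (sh i)); last by apply: smooth_sum.
by congr v; rewrite funeqE => q; rewrite big_cons.
Qed.

(** Derivations are local: a cutoff equal to 1 near [p] and supported where h = k annihilates h - k,
    and the product rule evaluates [v] on this vanishing product. *)
Lemma tangent_near p v h k : tangent p v -> smooth h -> smooth k ->
  (\forall q \near p, h q = k q) -> v h = v k.
Proof.
move=> tv sh sk; rewrite /prop_near1 nbhsE => -[W [oW Wp] WH].
have [b [sb b1 [C cC [CW b0]]]] := bump_exists mM oW Wp.
have E : (fun q => b q * (h q - k q)) = fun=> 0.
  rewrite funeqE => q; have [/CW/WH ->|/b0 ->] := pselect (C q); last by rewrite mul0r.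
  by rewrite subrr mulr0.
have := tangent_mul tv sb (smoothB mM sh sk); rewrite E (tangent_cst 0 tv).
rewrite (WH p Wp) subrr mulr0 add0r (nbhs_singleton b1) mul1r.
by rewrite (tangentB_fun tv)// => /esym/eqP; rewrite subr_eq0 => /eqP.
Qed.

Lemma tangent0 p : tangent p (0 : tvec M).
Proof. by split => * /=; rewrite ?mulr0 ?mul0r ?addr0. Qed.

Lemma tangent_comb p r u v : tangent p u -> tangent p v -> tangent p (r *: u + v).
Proof.
move=> tu tv; split.
- by move=> h nh; rewrite !fctE (tangent_ns tu)// (tangent_ns tv)// scaler0 addr0.
- move=> a h k sh sk; rewrite !fctE (tangent_lin _ tu)// (tangent_lin _ tv)//.
  by rewrite /GRing.scale /=; ring.
- move=> h k sh sk; rewrite !fctE (tangent_mul tu)// (tangent_mul tv)//.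
  by rewrite /GRing.scale /=; ring.
Qed.

Lemma tangentD p u v : tangent p u -> tangent p v -> tangent p (u + v).
Proof. by move=> tu tv; rewrite -[u]scale1r; exact: tangent_comb. Qed.

Lemma tangentZ p r u : tangent p u -> tangent p (r *: u).
Proof. by move=> tu; rewrite -[r *: u]addr0; apply: tangent_comb => //; exact: tangent0. Qed.

Lemma tangentN p u : tangent p u -> tangent p (- u).
Proof. by move=> tu; rewrite -scaleN1r; exact: tangentZ. Qed.

Lemma tangentB p u v : tangent p u -> tangent p v -> tangent p (u - v).
Proof. by move=> tu tv; apply: tangentD => //; exact: tangentN. Qed.

Lemma tangent_sum p (I : Type) (r : seq I) (P : pred I) (u : I -> tvec M) :
  (forall i, P i -> tangent p (u i)) -> tangent p (\sum_(i <- r | P i) u i).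
Proof. by move=> tu; elim/big_ind : _ => //; [exact: tangent0|exact: tangentD]. Qed.

Lemma tvec0E h : (0 : tvec M) h = 0. Proof. by []. Qed.

Lemma tvecDE u v h : (u + v) h = u h + v h. Proof. by []. Qed.

Lemma tvecZE r u h : (r *: u) h = r * u h. Proof. by []. Qed.

Lemma tvecNE u h : (- u) h = - u h. Proof. by []. Qed.

Lemma tvecE_comb r u v h : (r *: u + v) h = r * u h + v h. Proof. by []. Qed.

Lemma tvec_sumE (I : Type) (r : seq I) (P : pred I) (u : I -> tvec M) h :
  (\sum_(i <- r | P i) u i) h = \sum_(i <- r | P i) u i h.
Proof. by rewrite fct_sumE. Qed.

Definition cpartial c i q : tvec M :=
  restrict_smooth (fun h => 'D_(delta_mx 0 i) (h \o bwd c) (fwd c q)).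

Lemma restrict_smoothE (F : tvec M) h : smooth h -> restrict_smooth F h = F h.
Proof. by move=> sh; rewrite /restrict_smooth; case: asboolP. Qed.

Lemma restrict_smooth_ns (F : tvec M) h : ~ smooth h -> restrict_smooth F h = 0.
Proof. by move=> sh; rewrite /restrict_smooth; case: asboolP. Qed.

Lemma smooth_diff c h q : @atlas R M c -> dom c q -> smooth h ->
  differentiable (h \o bwd c) (fwd c q).
Proof. by move=> ac cq /(_ c ac 1%N)[+ _]; apply; exact: fwd_img. Qed.

Lemma tangent_cpartial c i q : @atlas R M c -> dom c q -> tangent q (cpartial c i q).
Proof.
move=> ac cq; have df h (sh : smooth h) := smooth_diff ac cq sh.
split.
- by move=> h nh; rewrite /cpartial restrict_smooth_ns.
- move=> a h k sh sk; rewrite /cpartial !restrict_smoothE//; last first.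
    by apply: smoothD => //; apply: smoothM => //; exact: smooth_cst.
  rewrite (_ : _ \o _ = (a *: (h \o bwd c)) + (k \o bwd c))//.
  rewrite deriveD ?deriveZ//; apply: diff_derivable; try exact: df.
  apply: (@differentiableZ _ _ R^o); exact: df.
- move=> h k sh sk; rewrite /cpartial !restrict_smoothE//; last exact: smoothM.
  rewrite (_ : _ \o _ = (h \o bwd c) * (k \o bwd c))//.
  rewrite deriveM; [|exact: diff_derivable (df _ sh)|exact: diff_derivable (df _ sk)].
  by rewrite /= !(fwdK mM)// /GRing.scale /=; ring.
Qed.

(** The tangent space is spanned by the coordinate derivations. Hadamard's lemma writes h near [p]
    as h p plus a sum of (x i - x i p) k i. Both the coordinates and the factors k i are replaced by
    global functions, to which [v] can be applied. *)
Lemma tangent_coord c p v (x : 'I_n -> M -> R) : @atlas R M c -> dom c p -> tangent p v ->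
  (forall i, smooth (x i)) -> (forall i, \forall q \near p, x i q = fwd c q 0 i) ->
  v = \sum_i v (x i) *: cpartial c i p.
Proof.
move=> ac cp tv sx xE; apply: (tangent_ext tv).
  by apply: tangent_sum => i _; apply: tangentZ; exact: tangent_cpartial.
move=> h sh; rewrite tvec_sumE.
have [H CH Hh] := Cinfty_extend (img_open mM ac) (fwd_img cp) (sh c ac).
have [K [CK HK K0]] := hadamard (fwd c p) CH.
have /choice[k Hk] : forall i, exists k : M -> R,
    smooth k /\ \forall q \near p, k q = K i (fwd c q).
  move=> i; have [|k sk kE] := @smooth_extension _ _ mM (K i \o fwd c) p.
    apply: (smooth_near_comp_rV mM openT I (CK i)) => j; exact: smooth_near_fwd.
  by exists k.
have sk i : smooth (k i) by case: (Hk i).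
have sx0 i : smooth (fun q => x i q - fwd c p 0 i) by apply: smoothB => //; exact: smooth_cst.
have sxk i : smooth (fun q => (x i q - fwd c p 0 i) * k i q) by exact: smoothM.
have hE : \forall q \near p, h q = h p + \sum_i (x i q - fwd c p 0 i) * k i q.
  have [W [oW Wp Wc WH]] : exists W : set 'rV[R]_n, [/\ open W, W (fwd c p), W `<=` chart_img c &
      W `<=` [set y | H y = h (bwd c y)]].
    move: Hh; rewrite /prop_near1 nbhsE => -[W [oW Wp] WH].
    exists (W `&` chart_img c); split; [exact: openI (img_open mM ac)| |by move=> y []|].
      by split => //; exact: fwd_img.
    by move=> y [/WH].
  have nW := open_nbhs_nbhs (conj (chart_open_preimage mM ac oW) (conj cp Wp)).
  have nx : \forall q \near p, forall i, x i q = fwd c q 0 i by exact: filter_forall.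
  have nk : \forall q \near p, forall i, k i q = K i (fwd c q).
    by apply: filter_forall => i; case: (Hk i).
  near=> q.
  have [cq Wq] : (dom c `&` fwd c @^-1` W) q by near: q.
  have -> : h q = H (fwd c q) by rewrite (WH _ Wq) (fwdK mM).
  rewrite HK (WH _ Wp) (fwdK mM)//; congr (_ + _); apply: eq_bigr => i _.
  by congr (_ * _); [rewrite (near nx)|rewrite (near nk)].
rewrite (tangent_near tv sh _ hE); last first.
  by apply: smoothD; [exact: mM|exact: smooth_cst|exact: smooth_sum].
rewrite (tangentD_fun tv); [|exact: smooth_cst|exact: smooth_sum].
rewrite (tangent_cst _ tv) add0r (tangent_sum_fun _ tv)//; apply: eq_bigr => i _.
(* In the product rule the term with v (k i) carries the factor x i - x i p, which vanishes at
   [p]. *)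
rewrite (tangent_mul tv)// (tangentB_fun tv)//; last exact: smooth_cst.
rewrite (tangent_cst _ tv) subr0 (nbhs_singleton (xE i)) subrr mul0r addr0.
rewrite /GRing.scale /= /cpartial restrict_smoothE//; congr (_ * _).
have [_ /nbhs_singleton ->] := Hk i; rewrite K0.
exact: near_eq_derive.
Unshelve. all: by end_near. Qed.

Lemma smooth_near_cpartial c i h q : @atlas R M c -> dom c q -> smooth h ->
  smooth_near (fun q => 'D_(delta_mx 0 i) (h \o bwd c) (fwd c q)) q.
Proof.
move=> ac cq sh.
apply: (smooth_near_comp_rV mM (img_open mM ac) (fwd_img cq) (_ : Cinfty _ ('D_(delta_mx 0 i) (h \o bwd c)))).
  by move=> k; case: (sh c ac k.+1) => _; exact.
by move=> j; exact: smooth_near_fwd.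
Qed.

(** The fields [E i] are coordinate fields times a cutoff, hence global, and the [x i] are global
    extensions of the coordinates; the frame and the duality hold only near [p]. *)
Lemma local_frame p : exists (E : 'I_n -> vfield M) (x : 'I_n -> M -> R),
  [/\ forall i, vector_field (E i), forall i, smooth (x i) &
   \forall q \near p, (forall v, tangent q v -> v = \sum_i v (x i) *: E i q) /\
      (forall i j, E i q (x j) = (i == j)%:R)].
Proof.
have [c ac cp] := chart_at mM p.
have [b [sb b1 [C cC [CW b0]]]] := bump_exists mM (dom_open mM ac) cp.
pose E i q : tvec M := b q *: cpartial c i q.
have /choice[x Hx] : forall i, exists x : M -> R,
    smooth x /\ \forall q \near p, x q = fwd c q 0 i.
  by move=> i; have [x sx xE] := smooth_extension mM (smooth_near_fwd mM i ac cp); exists x.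
have sx i : smooth (x i) by case: (Hx i).
exists E, x; split => //.
- move=> i; split => [q|h sh].
    have [/CW cq|/b0 bq] := pselect (C q); first by apply: tangentZ; exact: tangent_cpartial.
    by rewrite /E bq scale0r; exact: tangent0.
  rewrite (_ : (fun q => _) = fun q => b q * 'D_(delta_mx 0 i) (h \o bwd c) (fwd c q)); last first.
    by rewrite funeqE => q; rewrite /E /GRing.scale /= /cpartial restrict_smoothE.
  by apply: (smooth_cutoff mM cC CW b0 sb) => q cq; exact: smooth_near_cpartial.
(* At a nearby point q the expansion [tangent_coord] requires agreement with the coordinates in a
   neighbourhood of q, not just at q. *)
- have nx : \forall q \near p, forall i, \forall q' \near q, x i q' = fwd c q' 0 i.
    by apply: filter_forall => i; apply: near_join; case: (Hx i).
  near=> q.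
  have cq : dom c q by near: q; exact: (open_nbhs_nbhs (conj (dom_open mM ac) cp)).
  have bq : b q = 1 by near: q.
  have xq : forall i, \forall q' \near q, x i q' = fwd c q' 0 i by near: q.
  split => [v tv|i j].
    rewrite [LHS](tangent_coord ac cq tv sx xq); apply: eq_bigr => i _.
    by rewrite /E bq scale1r.
  rewrite /E bq scale1r /cpartial restrict_smoothE//.
  rewrite (@near_eq_derive _ _ _ _ (fun y : 'rV[R]_n => y 0 j)).
    have H := is_derive_id (fwd c q) (delta_mx 0 i : 'rV[R]_n).
    have := derive_mx (@ex_derive _ _ _ _ _ _ _ H).
    rewrite derive_id => /matrixP/(_ 0 j).
    by rewrite !mxE eqxx [j == i]eq_sym /= => <-.
  have [W [oW Wq Wc WH]] := near_chart mM ac cq (xq j).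
  have := open_nbhs_nbhs (conj oW Wq); apply: filterS => y Wy /=.
  by rewrite WH// (bwdK mM)//; exact: Wc.
Unshelve. all: by end_near. Qed.

(** Extend with constant coefficients in a local frame. *)
Lemma tangent_extend p v : tangent p v -> exists2 X : vfield M, vector_field X & X p = v.
Proof.
move=> tv; have [E [x [vE sx Ex]]] := local_frame p.
exists (fun q => \sum_i v (x i) *: E i q); last first.
  by case: (nbhs_singleton Ex) => /(_ v tv) {2}->.
split => [q|h sh].
  by apply: tangent_sum => i _; apply: tangentZ; case: (vE i).
under eq_fun do rewrite tvec_sumE.
apply: smooth_sum => // i _; apply: smoothM => //; first exact: smooth_cst.
by case: (vE i) => _; apply.
Qed.

End tangent_vectors.

(** * Smooth maps and push-forward of tangent vectors *)

Section smooth_maps.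
Context {R : realType}.
Implicit Types M N L : premanifold R.

(** Testing smoothness on germs of functions keeps charts out of compositions. *)
Definition smooth_map_at M N (phi : M -> N) p :=
  {for p, continuous phi} /\
  forall h : N -> R, smooth_near h (phi p) -> smooth_near (h \o phi) p.

Lemma smooth_on_at M N (phi : M -> N) (U : set M) p : manifold M -> manifold N ->
  open U -> smooth_on U phi -> U p -> smooth_map_at phi p.
Proof.
move=> mM mN oU [cphi sphi] Up; split; first exact: cphi.
move=> h sh; have [c ac cp] := chart_at mM p; have [d ad dp] := chart_at mN (phi p).
have [V [oV Vp Vd CV]] := smooth_near_chart mN sh ad dp.
have nd : \forall q \near p, dom d (phi q).
  exact: (cphi _ Up _ (open_nbhs_nbhs (conj (dom_open mN ad) dp))).
have E : \forall q \near p, ((h \o bwd d) \o (fwd d \o phi)) q = (h \o phi) q.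
  by apply: filterS nd => q dq /=; rewrite (fwdK mN).
apply: (smooth_near_eq mM E).
apply: (smooth_near_comp_rV mM oV Vp CV) => i.
have [W [oW Wp Wc WH]] := near_chart mM ac cp nd.
have nU := open_nbhs_nbhs (conj oU Up).
have [W' [oW' Wp' Wc' WH']] := near_chart mM ac cp nU.
exists c, (W `&` W'); split; first by split => //; exact: openI.
split=> [x [/Wc]//|k]; apply: Ck_sub (sphi c d ac ad i k) => x [Wx W'x].
exists (bwd c x); last exact: (bwdK mM ac (Wc _ Wx)).
split; [split; [exact: (bwd_dom mM ac (Wc _ Wx))|exact: WH']|exact: WH].
Qed.

Lemma smooth_map_at_comp M N L (phi : M -> N) (psi : N -> L) p :
  smooth_map_at phi p -> smooth_map_at psi (phi p) -> smooth_map_at (psi \o phi) p.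
Proof.
move=> [c1 s1] [c2 s2]; split; first exact: continuous_comp.
by move=> h sh; apply: (s1 (h \o psi)); exact: s2.
Qed.

Lemma smooth_map_at_id M (p : M) : smooth_map_at (fun q : M => q) p.
Proof. by split. Qed.

Lemma smooth_near_comp M N (phi : M -> N) h p :
  smooth_map_at phi p -> smooth_near h (phi p) -> smooth_near (h \o phi) p.
Proof. by case=> _; apply. Qed.

Lemma smooth_comp M N (phi : M -> N) h : manifold M -> manifold N ->
  (forall p, smooth_map_at phi p) -> smooth h -> smooth (h \o phi).
Proof.
move=> mM mN sphi /(smoothP mN) sh; apply/(smoothP mM) => p.
exact: smooth_near_comp.
Qed.

Lemma push_smoothE M N (phi : M -> N) (u : tvec M) h : smooth h -> push phi u h = u (h \o phi).
Proof. exact: restrict_smoothE. Qed.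

Lemma push_ns M N (phi : M -> N) (u : tvec M) h : ~ smooth h -> push phi u h = 0.
Proof. exact: restrict_smooth_ns. Qed.

Lemma push_comb M N (phi : M -> N) r (u v : tvec M) :
  push phi (r *: u + v) = r *: push phi u + push phi v.
Proof.
rewrite funeqE => h; rewrite tvecE_comb; have [sh|nh] := pselect (smooth h).
  by rewrite !push_smoothE.
by rewrite !push_ns// mulr0 addr0.
Qed.

Lemma push0 M N (phi : M -> N) : push phi (0 : tvec M) = 0.
Proof. by have := push_comb phi (-1) 0 0; rewrite !scaleN1r !addNr. Qed.

Lemma pushD M N (phi : M -> N) (u v : tvec M) : push phi (u + v) = push phi u + push phi v.
Proof. by have := push_comb phi 1 u v; rewrite !scale1r. Qed.

Lemma pushZ M N (phi : M -> N) r (u : tvec M) : push phi (r *: u) = r *: push phi u.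
Proof. by have := push_comb phi r u 0; rewrite push0 !addr0. Qed.

Lemma push_sum M N (phi : M -> N) (I : Type) (r : seq I) (c : I -> R) (u : I -> tvec M) :
  push phi (\sum_(i <- r) c i *: u i) = \sum_(i <- r) c i *: push phi (u i).
Proof.
by elim: r => [|i r IH]; rewrite ?big_nil ?push0// !big_cons push_comb IH.
Qed.

Lemma push_tangent M N (phi : M -> N) p u : manifold M -> manifold N ->
  (forall p, smooth_map_at phi p) -> tangent p u -> tangent (phi p) (push phi u).
Proof.
move=> mM mN sphi tu; have sc h := @smooth_comp _ _ _ h mM mN sphi; split.
- by move=> h nh; exact: push_ns.
- move=> a h k sh sk; rewrite !push_smoothE//.
    by rewrite (tangent_lin a tu (sc _ sh) (sc _ sk)).
  by apply: smoothD => //; apply: smoothM => //; exact: smooth_cst.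
- move=> h k sh sk; rewrite !push_smoothE//; last exact: smoothM.
  exact: (tangent_mul tu (sc _ sh) (sc _ sk)).
Qed.

Lemma push_push M N L (phi : M -> N) (psi : N -> L) (u : tvec M) : manifold N -> manifold L ->
  (forall p, smooth_map_at psi p) -> push psi (push phi u) = push (psi \o phi) u.
Proof.
move=> mN mL spsi; rewrite funeqE => h; have [sh|nh] := pselect (smooth h).
  by rewrite !push_smoothE//; exact: smooth_comp.
by rewrite !push_ns.
Qed.

Lemma push_id M p (u : tvec M) : tangent p u -> push (fun q : M => q) u = u.
Proof.
move=> tu; rewrite funeqE => h; have [sh|nh] := pselect (smooth h).
  by rewrite push_smoothE.
by rewrite push_ns// (tangent_ns tu).
Qed.

End smooth_maps.

Lemma continuous_pair (T U V : topologicalType) (f : T -> U) (g : T -> V) (x : T) :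
  {for x, continuous f} -> {for x, continuous g} -> {for x, continuous (fun z => (f z, g z))}.
Proof. exact: cvg_pair. Qed.

(** * The product with the real line *)

Section product_with_line.
Context {R : realType} {P : premanifold R} (mP : manifold P).
Local Notation n := (mdim P).
Local Notation PR := (prodR P).
Implicit Types (y : PR) (h : PR -> R).

Lemma prodR_hausdorff : hausdorff_space PR.
Proof.
move=> [p t] [q s] H; have hP : hausdorff_space P by case: mP.
congr pair.
  apply: hP => A B nA nB.
  have nA' : nbhs ((p, t) : P * R) (A `*` setT) by exists (A, setT) => //; split => //; exact: filterT.
  have nB' : nbhs ((q, s) : P * R) (B `*` setT) by exists (B, setT) => //; split => //; exact: filterT.
  by have [[x r] [[Ax _] [Bx _]]] := H _ _ nA' nB'; exists x.
apply: (@Rhausdorff R) => A B nA nB.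
have nA' : nbhs ((p, t) : P * R) (setT `*` A) by exists (setT, A) => //; split => //; exact: filterT.
have nB' : nbhs ((q, s) : P * R) (setT `*` B) by exists (setT, B) => //; split => //; exact: filterT.
by have [[x r] [[_ Ar] [_ Br]]] := H _ _ nA' nB'; exists r.
Qed.

Lemma prodR_second_countable : @second_countable PR.
Proof.
case: mP => _ [B cB [oB nB]] _ _ _.
pose I (ab : rat * rat) : set R := [set x | ratr ab.1 < x < ratr ab.2].
have oI ab : open (I ab).
  have -> : I ab = [set` `]ratr ab.1, ratr ab.2[%R] by apply/seteqP; split => x; rewrite /= in_itv.
  exact: interval_open.
exists [set A `*` I ab | A in B & ab in setT].
  rewrite image2E; apply: card_le_trans (card_image_le _ _) _.
  by apply: countableX => //; exact: countableP.
split.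
  move=> _ [A BA [ab _ <-]]; rewrite openE => -[p t] [Ap It].
  exists (A, I ab) => //; split; first exact: (open_nbhs_nbhs (conj (oB _ BA) Ap)).
  exact: (open_nbhs_nbhs (conj (oI ab) It)).
move=> [p t] U [[U1 U2] /= [nU1 nU2] U12].
have [A [BA Ap] AU] := nB p U1 nU1.
have /nbhs_ballP[e /= e0 eU] := nU2.
have te1 : t - e < t by rewrite ltrBlDr ltrDl.
have te2 : t < t + e by rewrite ltrDl.
have [a] := rat_in_itvoo te1; have [b] := rat_in_itvoo te2.
rewrite !in_itv /= => /andP[tb be] /andP[ea at'].
exists (A `*` I (a, b)); first split.
- by exists A => //; exists (a, b).
- by split => //=; rewrite /I /= at' tb.
- move=> [q s] /= [Aq /andP[/= as' sb]]; apply: U12; split; first exact: AU.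
  by apply: eU; rewrite /ball /= ltr_distlC; apply/andP; split; lra.
Qed.

Lemma prodR_atlas c : @atlas R P c -> @atlas R PR (chart_prodR c).
Proof. by move=> ac; exists c. Qed.

Lemma lsubmx_continuous m1 m2 : continuous (lsubmx : 'rV[R]_(m1 + m2) -> 'rV[R]_m1).
Proof.
move=> x; apply: continuous_rV => j.
rewrite (_ : (fun z => _) = fun z : 'rV[R]_(m1 + m2) => z 0 (lshift m2 j)).
  exact: coord_continuous.
by rewrite funeqE => z; rewrite mxE.
Qed.

Lemma prodR_imgE (c : chart R P n) (A : set P) : A `<=` dom c ->
  fwd (chart_prodR c) @` [set y | A y.1] = lsubmx @^-1` (fwd c @` A).
Proof.
move=> Ac; apply/seteqP; split => [_ [[p t] /= Ap <-]|x [p Ap px]].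
  by rewrite /= row_mxKl; exists p.
exists (p, x 0 (rshift n ord0)) => //=; rewrite px.
rewrite -[RHS]hsubmxK; congr row_mx; apply/matrixP => i j.
by rewrite !mxE !ord1.
Qed.

Lemma prodR_manifold : manifold PR.
Proof.
split.
- exact: prodR_hausdorff.
- exact: prodR_second_countable.
- move=> [p t]; have [c ac cp] := chart_at mP p; exists (chart_prodR c) => //.
  exact: prodR_atlas.
- move=> _ [c ac <-]; have oi : open (chart_img (chart_prodR c)).
    rewrite /chart_img prodR_imgE//; apply: open_comp; last exact: img_open.
    by move=> x _; exact: lsubmx_continuous.
  split => //.
  + apply: (@open_comp PR P fst); last exact: dom_open.
    by move=> x _; exact: cvg_fst.
  + by move=> [p t] /= cp; rewrite row_mxKl row_mxKr (fwdK mP)// mxE.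
  + apply: continuous_in_subspaceT => -[p t] /[!inE] /= cp; apply: continuous_rV => j.
    case: (split_ordP j) => k ->.
      rewrite (_ : (fun y => _) = (fun y : PR => fwd c y.1 0 k)).
        apply: (@continuous_comp PR P R^o fst (fun q => fwd c q 0 k)); first exact: cvg_fst.
        exact: (@continuous_comp P 'rV[R]_n R^o (fwd c) (fun x => x 0 k) p (fwd_continuous mP ac cp) (@coord_continuous _ _ _ _ _ _)).
      by rewrite funeqE => y; rewrite row_mxEl.
    rewrite (_ : (fun y => _) = (snd : PR -> R)); first exact: cvg_snd.
    by rewrite funeqE => y; rewrite row_mxEr mxE.
  + apply: continuous_in_subspaceT => x /[!inE].
    rewrite /chart_img prodR_imgE// => -cx.
    apply: (@continuous_pair 'rV[R]_(n + 1) P R (fun z => bwd c (lsubmx z)) (fun z => rsubmx z 0 0)).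
      apply: (@continuous_comp _ _ _ lsubmx (bwd c)); first exact: lsubmx_continuous.
      exact: (bwd_continuous mP ac).
    rewrite (_ : (fun z => _) = fun z : 'rV[R]_(n + 1) => z 0 (rshift n ord0)).
      exact: coord_continuous.
    by rewrite funeqE => z; rewrite mxE.
- move=> _ _ [c ac <-] [d ad <-] i k.
  have := @prodR_imgE c (dom c `&` dom d) (@subIsetl _ _ _).
  set A := [set y : PR | _]; move=> AE.
  have -> : dom (chart_prodR c) `&` dom (chart_prodR d) = A by [].
  rewrite AE.
  have oA : open (lsubmx @^-1` (fwd c @` (dom c `&` dom d)) : set 'rV[R]_(n + 1)).
    apply: open_comp; first by move=> x _; exact: lsubmx_continuous.
    by apply: chart_open_img => //; exact: dom_open.
  case: (split_ordP i) => j ->.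
    apply: (Ck_eq oA (f := (fun x => fwd d (bwd c x) 0 j) \o lsubmx)).
      by move=> x _ /=; rewrite row_mxEl.
    apply: (Ck_comp oA (V := fwd c @` (dom c `&` dom d))) => //.
      move=> l; apply: (Ck_eq oA _ (Ck_coord _ _ (lshift 1 l))) => x _.
      by rewrite mxE.
    by case: mP => _ _ _ _ /(_ c d ac ad j k).
  apply: (Ck_eq oA _ (Ck_coord _ _ (rshift n ord0))) => x _ /=.
  by rewrite row_mxEr !mxE.
Qed.

Let mPR := prodR_manifold.

Lemma smooth_map_at_fst y : smooth_map_at (fst : PR -> P) y.
Proof.
split; first exact: cvg_fst.
move=> h sh; have [c ac cp] := chart_at mP y.1.
have [V [oV Vp Vc CV]] := smooth_near_chart mP sh ac cp.
have oV' : open (lsubmx @^-1` V : set 'rV[R]_(n + 1)).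
  by apply: open_comp => // x _; exact: lsubmx_continuous.
exists (chart_prodR c), (lsubmx @^-1` V); split.
  by split => //; [exact: prodR_atlas|rewrite /= row_mxKl].
split=> [x Vx|k]; first by rewrite /chart_img prodR_imgE//; exact: Vc.
apply: (@Ck_comp _ _ _ k _ V lsubmx (h \o bwd c) oV' _ _ (CV k)); first by [].
move=> l; apply: (Ck_eq oV' _ (Ck_coord _ _ (lshift 1 l))) => x _.
by rewrite mxE.
Qed.

Lemma smooth_near_snd y : smooth_near (snd : PR -> R) y.
Proof.
have [c ac cp] := chart_at mP y.1; have ac' := prodR_atlas ac.
have oi := img_open mPR ac'.
exists (chart_prodR c), (chart_img (chart_prodR c)); split.
  by split => //; exact: (@fwd_img _ PR (chart_prodR c) y cp).
split => // k; apply: (Ck_eq oi _ (Ck_coord _ _ (rshift n ord0))) => x _.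
by rewrite /= mxE.
Qed.

Lemma smooth_map_at_pair (M : premanifold R) (phi : M -> P) (s : M -> R) p : manifold M ->
  smooth_map_at phi p -> smooth_near s p -> smooth_map_at (fun q => (phi q, s q) : PR) p.
Proof.
move=> mM sphi ss; split.
  by apply: continuous_pair; [case: sphi|exact: (smooth_near_continuous mM)].
move=> h sh; have [c ac cp] := chart_at mP (phi p); have ac' := prodR_atlas ac.
have [V [oV Vp Vc CV]] := smooth_near_chart mPR sh ac' (cp : dom (chart_prodR c) (phi p, s p)).
have nd : \forall q \near p, dom c (phi q).
  by case: sphi => cphi _; exact: (cphi _ (open_nbhs_nbhs (conj (dom_open mP ac) cp))).
have E : \forall q \near p, ((h \o bwd (chart_prodR c)) \o
    (fun q => fwd (chart_prodR c) (phi q, s q))) q = (h \o (fun q => (phi q, s q))) q.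
  by apply: filterS nd => q dq; rewrite /= row_mxKl row_mxKr (fwdK mP)// mxE.
apply: (smooth_near_eq mM E).
apply: (smooth_near_comp_rV mM oV _ CV) => // i.
case: (split_ordP i) => j ->.
  apply: (smooth_near_eq mM _ (smooth_near_comp sphi (smooth_near_fwd mP j ac cp))).
  by near=> q; rewrite /= row_mxEl.
apply: (smooth_near_eq mM _ ss); near=> q.
by rewrite /= row_mxEr mxE.
Unshelve. all: by end_near. Qed.

Lemma smooth_map_at_slice (t : R) p : smooth_map_at (@slice R P t) p.
Proof.
apply: smooth_map_at_pair => //; first exact: smooth_map_at_id.
exact: smooth_near_cst.
Qed.

(** With its companion for the last coordinate, this identifies the coordinate fields of the product
    with those of [P], pushed along a slice, and [partial_t]. *)
Lemma cpartial_lshift (c : chart R P n) j y : @atlas R P c -> dom c y.1 ->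
  @cpartial R PR (chart_prodR c) (lshift 1 j) y = push (@slice R P y.2) (cpartial c j y.1).
Proof.
move=> ac cy; rewrite funeqE => h; have [sh|nh] := pselect (smooth h); last first.
  by rewrite push_ns// /cpartial restrict_smooth_ns.
rewrite push_smoothE// /cpartial !restrict_smoothE//; last first.
  by apply: smooth_comp => //; exact: smooth_map_at_slice.
rewrite /derive; set d := (fun _ : R => _); set d' := (fun _ : R => _).
suff -> : d = d' by []; rewrite funeqE => a; rewrite /d /d' /=.
have E1 : lsubmx (a *: delta_mx 0 (lshift 1 j) + row_mx (fwd c y.1) (const_mx y.2)) =
    a *: delta_mx 0 j + fwd c y.1.
  apply/matrixP => i k; rewrite [LHS]mxE [LHS]mxE row_mxEl !mxE.
  by rewrite (inj_eq (@lshift_inj _ _)).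
have E2 : rsubmx (a *: delta_mx 0 (lshift 1 j) + row_mx (fwd c y.1) (const_mx y.2)) 0 0 = y.2.
  by rewrite [LHS]mxE [LHS]mxE row_mxEr !mxE eq_shift andbF mulr0 add0r.
by rewrite E1 E2 row_mxKl row_mxKr mxE.
Qed.

Lemma cpartial_rshift (c : chart R P n) y : @atlas R P c -> dom c y.1 ->
  @cpartial R PR (chart_prodR c) (rshift n ord0) y = partial_t y.
Proof.
move=> ac cy; rewrite funeqE => h; have [sh|nh] := pselect (smooth h); last first.
  by rewrite /partial_t /cpartial !restrict_smooth_ns.
rewrite /partial_t /cpartial !restrict_smoothE//.
rewrite /derive /derive1; set d := (fun _ : R => _); set d' := (fun _ : R => _).
suff -> : d = d' by []; rewrite funeqE => a; rewrite /d /d' /=.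
have E1 : lsubmx (a *: delta_mx 0 (rshift n (ord0 : 'I_1)) + row_mx (fwd c y.1) (const_mx y.2)) = fwd c y.1.
  apply/matrixP => i k; rewrite [LHS]mxE [LHS]mxE row_mxEl !mxE.
  by rewrite eq_shift andbF mulr0 add0r.
have E2 : rsubmx (a *: delta_mx 0 (rshift n (ord0 : 'I_1)) + row_mx (fwd c y.1) (const_mx y.2)) 0 0 = a + y.2.
  by rewrite [LHS]mxE [LHS]mxE row_mxEr !mxE !eqxx mulr1.
by rewrite E1 E2 row_mxKl row_mxKr mxE (fwdK mP).
Qed.

Lemma tangent_partial_t y : tangent y (partial_t y).
Proof.
have [c ac cp] := chart_at mP y.1; rewrite -(cpartial_rshift ac cp).
by apply: (tangent_cpartial mPR) => //; exact: prodR_atlas.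
Qed.

Lemma vector_field_partial_t : vector_field (@partial_t R P).
Proof.
split; first exact: tangent_partial_t.
move=> h sh; apply/(smoothP mPR) => y.
have [c ac cp] := chart_at mP y.1; have ac' := prodR_atlas ac.
have := smooth_near_cpartial mPR (rshift n ord0) ac' (cp : dom (chart_prodR c) y) sh.
apply: (smooth_near_eq mPR).
have := open_nbhs_nbhs (conj (dom_open mPR ac') (cp : dom (chart_prodR c) y)).
apply: filterS => z cz; rewrite -(cpartial_rshift ac cz).
by rewrite /cpartial restrict_smoothE.
Qed.

Lemma smooth_snd : smooth (snd : PR -> R).
Proof. by apply/(smoothP mPR) => y; exact: smooth_near_snd. Qed.

Lemma smooth_fst_comp (h : P -> R) : smooth h -> smooth ((fun y => h y.1) : PR -> R).
Proof. by move=> sh; apply: (smooth_comp mPR mP smooth_map_at_fst). Qed.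

(** Both sides are compared through coordinate expansions: that of [u] in the product chart and that
    of its push-forward to [P] in the underlying chart. *)
Lemma tangent_prodR y u : tangent y u ->
  u = push (@slice R P y.2) (push (fst : PR -> P) u) + u (snd : PR -> R) *: partial_t y.
Proof.
move=> tu; have [c ac cp] := chart_at mP y.1; have ac' := prodR_atlas ac.
have /choice[x Hx] : forall i, exists x : P -> R,
    smooth x /\ \forall q \near y.1, x q = fwd c q 0 i.
  by move=> i; have [x sx xE] := smooth_extension mP (smooth_near_fwd mP i ac cp); exists x.
have sx i : smooth (x i) by case: (Hx i).
pose X (i : 'I_(n + 1)) : PR -> R := match fintype.split i with
  | inl j => fun z => x j z.1 | inr _ => snd end.
have sX i : smooth (X i).
  by rewrite /X; case: (fintype.split i) => j; [exact: smooth_fst_comp|exact: smooth_snd].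
have XE i : \forall z \near y, X i z = fwd (chart_prodR c) z 0 i.
  case: (split_ordP i) => j ->; rewrite /X (unsplitK (inl j)) || rewrite /X (unsplitK (inr j)).
    have [_ xj] := Hx j; have [cf _] := smooth_map_at_fst y.
    have {}xj : \forall z \near y, x j z.1 = fwd c z.1 0 j := cf _ xj.
    by apply: filterS xj => z /= ->; rewrite row_mxEl.
  by near=> z; rewrite /= row_mxEr mxE.
rewrite [LHS](tangent_coord mPR ac' (cp : dom (chart_prodR c) y) tu sX XE).
rewrite big_split_ord /= big_ord1 cpartial_rshift//; congr (_ + _); last first.
  by rewrite /X (unsplitK (inr _)).
have tu' := push_tangent mPR mP smooth_map_at_fst tu.
rewrite [push (fst : PR -> P) u](tangent_coord mP ac cp tu' sx (fun i => (Hx i).2)).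
have -> : push (@slice R P y.2) (\sum_i push (fst : PR -> P) u (x i) *: cpartial c i y.1) =
   \sum_i push (fst : PR -> P) u (x i) *: push (@slice R P y.2) (cpartial c i y.1).
  elim/big_ind2 : _ => [|v w v' w' <- <-|i _]; [exact: push0|exact: pushD|exact: pushZ].
apply: eq_bigr => i _; rewrite cpartial_lshift//; congr (_ *: _).
by rewrite push_smoothE// /X (unsplitK (inl _)).
Unshelve. all: by end_near. Qed.

Lemma push_fst_slice p t (w : tvec P) : tangent p w -> push (fst : PR -> P) (push (@slice R P t) w) = w.
Proof.
move=> tw; rewrite (push_push _ _ mPR mP smooth_map_at_fst) -[RHS](push_id tw).
by [].
Qed.

Lemma push_fst_partial_t y : push (fst : PR -> P) (partial_t y) = 0.
Proof.
rewrite funeqE => h; have [sh|nh] := pselect (smooth h); last exact: push_ns.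
rewrite push_smoothE// /partial_t restrict_smoothE; last exact: smooth_fst_comp.
by rewrite /= derive1_cst.
Qed.

Lemma slice_snd p t (w : tvec P) : tangent p w -> push (@slice R P t) w (snd : PR -> R) = 0.
Proof.
move=> tw; rewrite push_smoothE; last exact: smooth_snd.
exact: (tangent_cst mP t tw).
Qed.

Lemma partial_t_snd y : partial_t y (snd : PR -> R) = 1.
Proof.
rewrite /partial_t restrict_smoothE; last exact: smooth_snd.
exact: derive1_id.
Qed.

End product_with_line.

(** * Vector fields and tensors *)

Section vector_fields.
Context {R : realType} {M : premanifold R} (mM : manifold M).
Local Notation n := (mdim M).
Implicit Types (p q : M) (h k : M -> R) (u v w : tvec M) (X Y V : vfield M).

Lemma vf_tangent X p : vector_field X -> tangent p (X p).
Proof. by case. Qed.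

Lemma vf_smooth X h : vector_field X -> smooth h -> smooth (fun p => X p h).
Proof. by case=> _; apply. Qed.

Lemma vf_comb h X Y : smooth h -> vector_field X -> vector_field Y ->
  vector_field (fun q => h q *: X q + Y q).
Proof.
move=> sh vX vY; split => [p|k sk].
  by apply: tangent_comb; exact: vf_tangent.
by apply: smoothD => //; [apply: smoothM => //|]; exact: vf_smooth.
Qed.

Lemma vf0 : vector_field (fun=> 0 : tvec M).
Proof. by split=> [p|h sh]; [exact: tangent0|exact: smooth_cst]. Qed.

Lemma vfZ h X : smooth h -> vector_field X -> vector_field (fun q => h q *: X q).
Proof.
move=> sh vX; have := vf_comb sh vX vf0.
by rewrite (_ : (fun q => _ + _) = fun q => h q *: X q)// funeqE => q; rewrite addr0.
Qed.

Lemma vfD X Y : vector_field X -> vector_field Y -> vector_field (fun q => X q + Y q).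
Proof.
move=> vX vY; have := vf_comb (smooth_cst mM 1) vX vY.
by rewrite (_ : (fun q => _ + _) = fun q => X q + Y q)// funeqE => q; rewrite scale1r.
Qed.

Lemma vf_sum (I : Type) (r : seq I) (X : I -> vfield M) :
  (forall i, vector_field (X i)) -> vector_field (fun q => \sum_(i <- r) X i q).
Proof.
move=> vX; elim: r => [|i r IH].
  by under eq_fun do rewrite big_nil; exact: vf0.
by under eq_fun do rewrite big_cons; exact: vfD.
Qed.

Lemma vf_bracket X Y : vector_field X -> vector_field Y -> vector_field (bracket X Y).
Proof.
move=> vX vY; have tX p := vf_tangent p vX; have tY p := vf_tangent p vY.
have sX h := vf_smooth (h := h) vX; have sY h := vf_smooth (h := h) vY.
split => [p|h sh].
  split.
  - move=> h nh; rewrite /bracket.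
    have -> : (fun q => Y q h) = fun=> 0 by rewrite funeqE => q; exact: tangent_ns nh.
    have -> : (fun q => X q h) = fun=> 0 by rewrite funeqE => q; exact: tangent_ns nh.
    by rewrite (tangent_cst mM _ (tX p)) (tangent_cst mM _ (tY p)) subrr.
  - move=> a h k sh sk; rewrite /bracket.
    under eq_fun do rewrite (tangent_lin _ (tY _))//.
    under [in X in _ - X]eq_fun do rewrite (tangent_lin _ (tX _))//.
    rewrite (tangent_lin _ (tX _) (sY _ sh) (sY _ sk)).
    by rewrite (tangent_lin _ (tY _) (sX _ sh) (sX _ sk)); ring.
  - move=> h k sh sk; rewrite /bracket.
    under eq_fun do rewrite (tangent_mul (tY _))//.
    under [in X in _ - X]eq_fun do rewrite (tangent_mul (tX _))//.
    rewrite (tangentD_fun (tX _) (smoothM mM (sY _ sh) sk) (smoothM mM sh (sY _ sk))).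
    rewrite (tangentD_fun (tY _) (smoothM mM (sX _ sh) sk) (smoothM mM sh (sX _ sk))).
    rewrite (tangent_mul (tX _) (sY _ sh) sk) (tangent_mul (tX _) sh (sY _ sk)).
    by rewrite (tangent_mul (tY _) (sX _ sh) sk) (tangent_mul (tY _) sh (sX _ sk)); ring.
by apply: smoothB => //; [apply: (vf_smooth vX); exact: sY|apply: (vf_smooth vY); exact: sX].
Qed.

Lemma bracketC X Y p : bracket Y X p = - bracket X Y p.
Proof. by rewrite funeqE => h; rewrite /bracket [in RHS]/GRing.opp /= opprB. Qed.

Lemma bracket_comb h X X' Y p : smooth h -> vector_field X -> vector_field X' -> vector_field Y ->
  bracket (fun q => h q *: X q + X' q) Y p =
  h p *: bracket X Y p - Y p h *: X p + bracket X' Y p.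
Proof.
move=> sh vX vX' vY.
have vB := vf_bracket vX vY; have vB' := vf_bracket vX' vY.
apply: (tangent_ext (p := p)).
- exact: vf_tangent (vf_bracket (vf_comb sh vX vX') vY).
- apply: tangentD => //; last exact: vf_tangent.
  by apply: tangentB; apply: tangentZ; exact: vf_tangent.
- move=> k sk; rewrite /bracket tvecE_comb.
  have -> : Y p (fun q => (h q *: X q + X' q) k) = Y p h * X p k + h p * Y p (fun q => X q k) +
      Y p (fun q => X' q k).
    rewrite (tangentD_fun (vf_tangent p vY) (smoothM mM sh (vf_smooth vX sk)) (vf_smooth vX' sk)).
    by rewrite (tangent_mul (vf_tangent p vY) sh (vf_smooth vX sk)).
  by rewrite !(tvecDE, tvecNE, tvecZE) /bracket; ring.
Qed.

End vector_fields.

(** * Tensors and the exterior derivative *)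

Section tensors.
Context {R : realType} {M : premanifold R} (mM : manifold M).
Local Notation n := (mdim M).
Implicit Types (p q : M) (h k : M -> R) (u v w : tvec M) (X Y V : vfield M)
  (a : form1 M) (b : tensor2 M).

Section form1_linearity.
Variables (a : form1 M) (p : M).
Hypothesis sa : smooth_form1 a.

Lemma form1_comb r u v : tangent p u -> tangent p v -> a p (r *: u + v) = r * a p u + a p v.
Proof. by case: sa => + _; apply. Qed.

Lemma form1_0 : a p 0 = 0.
Proof.
have := form1_comb 1 (tangent0 p) (tangent0 p); rewrite scale1r addr0 mul1r => H; lra.
Qed.

Lemma form1Z r u : tangent p u -> a p (r *: u) = r * a p u.
Proof. by move=> tu; rewrite -[r *: u]addr0 form1_comb ?form1_0 ?addr0//; exact: tangent0. Qed.

Lemma form1D u v : tangent p u -> tangent p v -> a p (u + v) = a p u + a p v.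
Proof. by move=> tu tv; rewrite -[u]scale1r form1_comb// mul1r scale1r. Qed.

Lemma form1N u : tangent p u -> a p (- u) = - a p u.
Proof. by move=> tu; rewrite -scaleN1r form1Z// mulN1r. Qed.

Lemma form1B u v : tangent p u -> tangent p v -> a p (u - v) = a p u - a p v.
Proof. by move=> tu tv; rewrite form1D ?form1N//; exact: tangentN. Qed.

Lemma form1_sum (I : Type) (r : seq I) (c : I -> R) (E : I -> tvec M) :
  (forall i, tangent p (E i)) ->
  a p (\sum_(i <- r) c i *: E i) = \sum_(i <- r) c i * a p (E i).
Proof.
move=> tE; elim: r => [|i r IH]; first by rewrite !big_nil form1_0.
rewrite !big_cons form1_comb ?IH//.
by apply: tangent_sum => j _; exact: tangentZ.
Qed.

End form1_linearity.

Section tensor2_linearity.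
Variables (b : tensor2 M) (p : M).
Hypothesis sb : smooth_tensor2 b.

Lemma tensor2_combl r u v w : tangent p u -> tangent p v -> tangent p w ->
  b p (r *: u + v) w = r * b p u w + b p v w.
Proof. by case: sb => + _ _; apply. Qed.

Lemma tensor2_combr r u v w : tangent p u -> tangent p v -> tangent p w ->
  b p w (r *: u + v) = r * b p w u + b p w v.
Proof. by case: sb => _ + _; apply. Qed.

Lemma tensor2_0l w : tangent p w -> b p 0 w = 0.
Proof.
move=> tw; have := tensor2_combl 1 (tangent0 p) (tangent0 p) tw.
by rewrite scale1r addr0 mul1r => H; lra.
Qed.

Lemma tensor2_0r w : tangent p w -> b p w 0 = 0.
Proof.
move=> tw; have := tensor2_combr 1 (tangent0 p) (tangent0 p) tw.
by rewrite scale1r addr0 mul1r => H; lra.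
Qed.

Lemma tensor2Zl r u w : tangent p u -> tangent p w -> b p (r *: u) w = r * b p u w.
Proof. by move=> tu tw; rewrite -[r *: u]addr0 tensor2_combl ?tensor2_0l ?addr0//; exact: tangent0. Qed.

Lemma tensor2Zr r u w : tangent p u -> tangent p w -> b p w (r *: u) = r * b p w u.
Proof. by move=> tu tw; rewrite -[r *: u]addr0 tensor2_combr ?tensor2_0r ?addr0//; exact: tangent0. Qed.

Lemma tensor2Dl u v w : tangent p u -> tangent p v -> tangent p w ->
  b p (u + v) w = b p u w + b p v w.
Proof. by move=> *; rewrite -[u]scale1r tensor2_combl// mul1r scale1r. Qed.

Lemma tensor2Dr u v w : tangent p u -> tangent p v -> tangent p w ->
  b p w (u + v) = b p w u + b p w v.
Proof. by move=> *; rewrite -[u]scale1r tensor2_combr// mul1r scale1r. Qed.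

Lemma tensor2Nl u w : tangent p u -> tangent p w -> b p (- u) w = - b p u w.
Proof. by move=> tu tw; rewrite -scaleN1r tensor2Zl// mulN1r. Qed.

Lemma tensor2Nr u w : tangent p u -> tangent p w -> b p w (- u) = - b p w u.
Proof. by move=> tu tw; rewrite -scaleN1r tensor2Zr// mulN1r. Qed.

Lemma tensor2Bl u v w : tangent p u -> tangent p v -> tangent p w ->
  b p (u - v) w = b p u w - b p v w.
Proof. by move=> tu tv tw; rewrite tensor2Dl ?tensor2Nl//; exact: tangentN. Qed.

Lemma tensor2_suml (I : Type) (r : seq I) (c : I -> R) (E : I -> tvec M) w :
  (forall i, tangent p (E i)) -> tangent p w ->
  b p (\sum_(i <- r) c i *: E i) w = \sum_(i <- r) c i * b p (E i) w.
Proof.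
move=> tE tw; elim: r => [|i r IH]; first by rewrite !big_nil tensor2_0l.
rewrite !big_cons tensor2_combl ?IH//.
by apply: tangent_sum => j _; exact: tangentZ.
Qed.

Lemma tensor2_sumr (I : Type) (r : seq I) (c : I -> R) (E : I -> tvec M) w :
  (forall i, tangent p (E i)) -> tangent p w ->
  b p w (\sum_(i <- r) c i *: E i) = \sum_(i <- r) c i * b p w (E i).
Proof.
move=> tE tw; elim: r => [|i r IH]; first by rewrite !big_nil tensor2_0r.
rewrite !big_cons tensor2_combr ?IH//.
by apply: tangent_sum => j _; exact: tangentZ.
Qed.

End tensor2_linearity.

Lemma form1_smooth a X : smooth_form1 a -> vector_field X -> smooth (fun p => a p (X p)).
Proof. by case=> _; apply. Qed.

Lemma tensor2_smooth b X Y : smooth_tensor2 b -> vector_field X -> vector_field Y ->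
  smooth (fun p => b p (X p) (Y p)).
Proof. by case=> _ _; apply. Qed.

Lemma smooth_form1_dfun h : smooth h -> smooth_form1 (dfun h).
Proof. by move=> sh; split => // X vX; exact: vf_smooth. Qed.

Lemma smooth_form1Z h a : smooth h -> smooth_form1 a -> smooth_form1 (fun p u => h p * a p u).
Proof.
move=> sh sa; split => [p r u v tu tv|X vX]; first by rewrite (form1_comb sa)//; ring.
by apply: smoothM => //; exact: form1_smooth.
Qed.

Lemma smooth_form1D a a' : smooth_form1 a -> smooth_form1 a' ->
  smooth_form1 (fun p u => a p u + a' p u).
Proof.
move=> sa sa'; split => [p r u v tu tv|X vX].
  by rewrite (form1_comb sa)// (form1_comb sa')//; ring.
by apply: smoothD => //; exact: form1_smooth.
Qed.

Lemma smooth_tensor2Z h b : smooth h -> smooth_tensor2 b ->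
  smooth_tensor2 (fun p u v => h p * b p u v).
Proof.
move=> sh sb; split => [p r u v w tu tv tw|p r u v w tu tv tw|X Y vX vY].
- by rewrite (tensor2_combl sb)//; ring.
- by rewrite (tensor2_combr sb)//; ring.
- by apply: smoothM => //; exact: tensor2_smooth.
Qed.

Lemma smooth_tensor2D b b' : smooth_tensor2 b -> smooth_tensor2 b' ->
  smooth_tensor2 (fun p u v => b p u v + b' p u v).
Proof.
move=> sb sb'; split => [p r u v w tu tv tw|p r u v w tu tv tw|X Y vX vY].
- by rewrite (tensor2_combl sb)// (tensor2_combl sb')//; ring.
- by rewrite (tensor2_combr sb)// (tensor2_combr sb')//; ring.
- by apply: smoothD => //; exact: tensor2_smooth.
Qed.

Lemma smooth_tensor2_prod a a' : smooth_form1 a -> smooth_form1 a' ->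
  smooth_tensor2 (fun p u v => a p u * a' p v).
Proof.
move=> sa sa'; split => [p r u v w tu tv tw|p r u v w tu tv tw|X Y vX vY].
- by rewrite (form1_comb sa)//; ring.
- by rewrite (form1_comb sa')//; ring.
- by apply: smoothM => //; exact: form1_smooth.
Qed.

(** With a local frame, h i = a (E i) and k i is the i-th coordinate. Global functions h i and k i
    allow derivations to be applied to them. *)
Lemma form1_local a p : smooth_form1 a -> exists (h k : 'I_n -> M -> R),
  [/\ forall i, smooth (h i), forall i, smooth (k i) &
    \forall q \near p, forall v, tangent q v -> a q v = \sum_i h i q * v (k i)].
Proof.
move=> sa; have [E [x [vE sx Ex]]] := local_frame mM p.
exists (fun i q => a q (E i q)), x; split => //.
  by move=> i; exact: form1_smooth.
apply: filterS Ex => q [Eq _] v tv; rewrite {1}(Eq v tv) (form1_sum sa).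
  by apply: eq_bigr => i _; rewrite mulrC.
by move=> i; exact: vf_tangent.
Qed.

Lemma tensor2_local b p : smooth_tensor2 b ->
  exists (h : 'I_n -> 'I_n -> M -> R) (k : 'I_n -> M -> R),
  [/\ forall i j, smooth (h i j), forall i, smooth (k i) &
    \forall q \near p, forall v w, tangent q v -> tangent q w ->
      b q v w = \sum_i \sum_j h i j q * (v (k i) * w (k j))].
Proof.
move=> sb; have [E [x [vE sx Ex]]] := local_frame mM p.
exists (fun i j q => b q (E i q) (E j q)), x; split => //.
  by move=> i j; exact: tensor2_smooth.
have tE q i : tangent q (E i q) by exact: vf_tangent.
apply: filterS Ex => q [Eq _] v w tv tw.
rewrite {1}(Eq v tv) (tensor2_suml sb)//; apply: eq_bigr => i _.
rewrite {1}(Eq w tw) (tensor2_sumr sb)// mulr_sumr; apply: eq_bigr => j _.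
by ring.
Qed.

(** This is d (sum of h dk) = sum of dh ^ dk. The right side depends on X and Y through their values
    at [p] only, which is why the invariant formula is tensorial. *)
Lemma form1_d_expr m a (h k : 'I_m -> M -> R) X Y p : smooth_form1 a ->
  (forall i, smooth (h i)) -> (forall i, smooth (k i)) ->
  (\forall q \near p, forall v, tangent q v -> a q v = \sum_i h i q * v (k i)) ->
  vector_field X -> vector_field Y ->
  X p (fun q => a q (Y q)) - Y p (fun q => a q (X q)) - a p (bracket X Y p) =
  \sum_i (X p (h i) * Y p (k i) - Y p (h i) * X p (k i)).
Proof.
move=> sa sh sk aE vX vY.
have H Z Z' : vector_field Z -> vector_field Z' -> Z p (fun q => a q (Z' q)) =
    \sum_i (Z p (h i) * Z' p (k i) + h i p * Z p (fun q => Z' q (k i))).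
  move=> vZ vZ'; have tZ := vf_tangent p vZ.
  have sm i : smooth (fun q => h i q * Z' q (k i)).
    by apply: smoothM => //; exact: vf_smooth.
  rewrite (@tangent_near _ _ mM p (Z p) _ (fun q => \sum_i h i q * Z' q (k i)) tZ).
  - rewrite (tangent_sum_fun mM _ tZ)//; apply: eq_bigr => i _.
    by rewrite (tangent_mul tZ)//; exact: vf_smooth.
  - exact: form1_smooth.
  - exact: smooth_sum.
  - by apply: filterS aE => q; apply; exact: vf_tangent.
rewrite (H _ _ vX vY) (H _ _ vY vX) ((nbhs_singleton aE) _ (vf_tangent p (vf_bracket mM vX vY))).
rewrite -!sumrB; apply: eq_bigr => i _; rewrite /bracket; ring.
Qed.

(** The set defining [extd] is inhabited since tangent vectors extend, and all its elements agree by
    [form1_d_expr]; so the value picked by [xget] is this one. *)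
Lemma extd_expr m a (h k : 'I_m -> M -> R) u v p : smooth_form1 a ->
  (forall i, smooth (h i)) -> (forall i, smooth (k i)) ->
  (\forall q \near p, forall v, tangent q v -> a q v = \sum_i h i q * v (k i)) ->
  tangent p u -> tangent p v ->
  extd a p u v = \sum_i (u (h i) * v (k i) - v (h i) * u (k i)).
Proof.
move=> sa sh sk aE tu tv; rewrite /extd; set A := [set r | _].
have [X vX Xu] := tangent_extend mM tu; have [Y vY Yv] := tangent_extend mM tv.
have [|Z [W [vZ vW Zu Wv ->]]] := @xgetPex _ 0 A.
  by eexists; exists X, Y; split => //; reflexivity.
by rewrite (form1_d_expr sa sh sk aE)// Zu Wv.
Qed.

Lemma extdE a X Y p : smooth_form1 a -> vector_field X -> vector_field Y ->
  extd a p (X p) (Y p) =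
  X p (fun q => a q (Y q)) - Y p (fun q => a q (X q)) - a p (bracket X Y p).
Proof.
move=> sa vX vY; have [h [k [sh sk aE]]] := form1_local p sa.
rewrite (extd_expr sa sh sk aE); [|exact: vf_tangent|exact: vf_tangent].
by rewrite (form1_d_expr sa sh sk aE).
Qed.

Lemma smooth_extd a : smooth_form1 a -> smooth_tensor2 (extd a).
Proof.
move=> sa; split.
- move=> p r u v w tu tv tw; have [h [k [sh sk aE]]] := form1_local p sa.
  rewrite !(extd_expr sa sh sk aE)//; last exact: tangent_comb.
  rewrite mulr_sumr -big_split /=; apply: eq_bigr => i _; rewrite !tvecE_comb; ring.
- move=> p r u v w tu tv tw; have [h [k [sh sk aE]]] := form1_local p sa.
  rewrite !(extd_expr sa sh sk aE)//; last exact: tangent_comb.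
  rewrite mulr_sumr -big_split /=; apply: eq_bigr => i _; rewrite !tvecE_comb; ring.
- move=> X Y vX vY; under eq_fun do rewrite (extdE _ sa vX vY).
  apply: smoothB => //; last exact: form1_smooth (vf_bracket mM vX vY).
  by apply: smoothB => //; apply: vf_smooth => //; exact: form1_smooth.
Qed.

Lemma extd_anti a p u v : smooth_form1 a -> tangent p u -> tangent p v ->
  extd a p v u = - extd a p u v.
Proof.
move=> sa tu tv; have [h [k [sh sk aE]]] := form1_local p sa.
rewrite !(extd_expr sa sh sk aE)// -sumrN; apply: eq_bigr => i _; ring.
Qed.

Lemma extdZ h a p u v : smooth h -> smooth_form1 a -> tangent p u -> tangent p v ->
  extd (fun q w => h q * a q w) p u v = u h * a p v - v h * a p u + h p * extd a p u v.
Proof.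
move=> sh sa tu tv.
have [X vX <-] := tangent_extend mM tu; have [Y vY <-] := tangent_extend mM tv.
rewrite !extdE//; last exact: smooth_form1Z.
rewrite (tangent_mul (vf_tangent p vX) sh (form1_smooth sa vY)).
by rewrite (tangent_mul (vf_tangent p vY) sh (form1_smooth sa vX)); ring.
Qed.

Lemma extdD a a' p u v : smooth_form1 a -> smooth_form1 a' -> tangent p u -> tangent p v ->
  extd (fun q w => a q w + a' q w) p u v = extd a p u v + extd a' p u v.
Proof.
move=> sa sa' tu tv.
have [X vX <-] := tangent_extend mM tu; have [Y vY <-] := tangent_extend mM tv.
rewrite !extdE//; last exact: smooth_form1D.
rewrite (tangentD_fun (vf_tangent p vX) (form1_smooth sa vY) (form1_smooth sa' vY)).
rewrite (tangentD_fun (vf_tangent p vY) (form1_smooth sa vX) (form1_smooth sa' vX)).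
ring.
Qed.

Lemma extd_dfun h p u v : smooth h -> tangent p u -> tangent p v -> extd (dfun h) p u v = 0.
Proof.
move=> sh tu tv.
have [X vX <-] := tangent_extend mM tu; have [Y vY <-] := tangent_extend mM tv.
by rewrite extdE//; [rewrite /dfun /bracket; ring|exact: smooth_form1_dfun].
Qed.

Lemma extd_eq a a' p u v : smooth_form1 a -> smooth_form1 a' ->
  (forall q w, tangent q w -> a q w = a' q w) -> tangent p u -> tangent p v ->
  extd a p u v = extd a' p u v.
Proof.
move=> sa sa' aa' tu tv.
have [X vX <-] := tangent_extend mM tu; have [Y vY <-] := tangent_extend mM tv.
rewrite !extdE// aa'; last exact: vf_tangent (vf_bracket mM vX vY).
by congr (X p _ - Y p _ - _); rewrite funeqE => q; apply: aa'; exact: vf_tangent.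
Qed.

(** All second derivatives of the functions a (Y) cancel, and what remains is [a] on the cyclic sum
    of double brackets, which is 0 by the Jacobi identity. *)
Lemma closed_extd a : smooth_form1 a -> closed2 (extd a).
Proof.
move=> sa X Y V vX vY vV p.
have vXY := vf_bracket mM vX vY; have vYV := vf_bracket mM vY vV; have vVX := vf_bracket mM vV vX.
have E Z W : vector_field Z -> vector_field W -> (fun q => extd a q (Z q) (W q)) =
   fun q => Z q (fun q => a q (W q)) - W q (fun q => a q (Z q)) - a q (bracket Z W q).
  by move=> vZ vW; rewrite funeqE => q; rewrite extdE.
rewrite (E _ _ vY vV) (E _ _ vV vX) (E _ _ vX vY).
rewrite (extdE p sa vXY vV) (extdE p sa vYV vX) (extdE p sa vVX vY).
have sm Z W : vector_field Z -> vector_field W -> smooth (fun q => Z q (fun q' => a q' (W q'))).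
  by move=> vZ vW; apply: vf_smooth => //; exact: form1_smooth.
have D Z W W' : vector_field Z -> vector_field W -> vector_field W' ->
  Z p (fun q => W q (fun q => a q (W' q)) - W' q (fun q => a q (W q)) - a q (bracket W W' q)) =
  Z p (fun q => W q (fun q => a q (W' q))) - Z p (fun q => W' q (fun q => a q (W q)))
  - Z p (fun q => a q (bracket W W' q)).
  move=> vZ vW vW'; have tZ := vf_tangent p vZ.
  rewrite (tangentB_fun mM tZ (smoothB mM (sm _ _ vW vW') (sm _ _ vW' vW)) (form1_smooth sa (vf_bracket mM vW vW'))).
  by rewrite (tangentB_fun mM tZ (sm _ _ vW vW') (sm _ _ vW' vW)).
rewrite !D//.
have J : a p (bracket (bracket X Y) V p) + a p (bracket (bracket Y V) X p)
    + a p (bracket (bracket V X) Y p) = 0.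
  have t1 := vf_tangent p (vf_bracket mM vXY vV).
  have t2 := vf_tangent p (vf_bracket mM vYV vX).
  have t3 := vf_tangent p (vf_bracket mM vVX vY).
  rewrite -(form1D sa)// -(form1D sa)//; last exact: tangentD.
  rewrite -[RHS](form1_0 p sa); congr (a p _).
  apply: (tangent_ext (p := p)); [by apply: tangentD => //; exact: tangentD|exact: tangent0|].
  move=> h sh; rewrite !tvecDE /bracket.
  have B Z W W' : vector_field Z -> vector_field W -> vector_field W' ->
      Z p (fun q => W q (fun q => W' q h) - W' q (fun q => W q h)) =
      Z p (fun q => W q (fun q => W' q h)) - Z p (fun q => W' q (fun q => W q h)).
    move=> vZ vW vW'; rewrite (tangentB_fun mM (vf_tangent p vZ))//.
      by do 2 apply: vf_smooth => //.
    by do 2 apply: vf_smooth => //.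
  by rewrite (B _ _ _ vV vX vY) (B _ _ _ vX vY vV) (B _ _ _ vY vV vX) tvec0E; ring.
rewrite {1 3 5}/bracket.
move: J; set j1 := a p _; set j2 := a p _; set j3 := a p _ => J.
rewrite -[RHS]J /bracket; ring.
Qed.

End tensors.

(** * Pullbacks of forms and tensors *)

Section pullbacks.
Context {R : realType} {M N : premanifold R} (mM : manifold M) (mN : manifold N).
Variable phi : M -> N.
Hypothesis sphi : forall p, smooth_map_at phi p.

Lemma near_map (p : M) (A : set N) : (\forall q \near phi p, A q) -> \forall q \near p, A (phi q).
Proof. by case: (sphi p) => c _; exact: c. Qed.

Lemma pull1_local m (a : form1 N) (h k : 'I_m -> N -> R) p :
  (forall i, smooth (h i)) -> (forall i, smooth (k i)) ->
  (\forall q \near phi p, forall v, tangent q v -> a q v = \sum_i h i q * v (k i)) ->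
  \forall q \near p, forall v, tangent q v ->
    pull1 phi a q v = \sum_i (h i \o phi) q * v (k i \o phi).
Proof.
move=> sh sk /near_map; apply: filterS => q aE v tv; rewrite /pull1.
rewrite aE; last exact: push_tangent.
by apply: eq_bigr => i _; rewrite push_smoothE.
Qed.

Lemma smooth_pull1 a : smooth_form1 a -> smooth_form1 (pull1 phi a).
Proof.
move=> sa; split => [p r u v tu tv|X vX].
  by rewrite /pull1 push_comb (form1_comb sa)//; exact: push_tangent.
apply/(smoothP mM) => p; have [h [k [sh sk aE]]] := form1_local mN (phi p) sa.
have sh' i := smooth_comp mM mN sphi (sh i); have sk' i := smooth_comp mM mN sphi (sk i).
have : smooth (fun q => \sum_i (h i \o phi) q * X q (k i \o phi)).
  by apply: smooth_sum => // i _; apply: smoothM => //; exact: vf_smooth.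
move/(smoothP mM) => /(_ p); apply: (smooth_near_eq mM).
apply: filterS (pull1_local sh sk aE) => q aq; rewrite aq//.
exact: vf_tangent.
Qed.

(** Vector fields cannot be pushed forward, so the invariant formula is of no help. Instead a local
    expression of [a] by functions h and k pulls back to one by h o phi and k o phi. *)
Lemma extd_pull1 a p u v : smooth_form1 a -> tangent p u -> tangent p v ->
  extd (pull1 phi a) p u v = extd a (phi p) (push phi u) (push phi v).
Proof.
move=> sa tu tv; have [h [k [sh sk aE]]] := form1_local mN (phi p) sa.
have sh' i := smooth_comp mM mN sphi (sh i); have sk' i := smooth_comp mM mN sphi (sk i).
rewrite (extd_expr mM (smooth_pull1 sa) sh' sk' (pull1_local sh sk aE))//.
rewrite (extd_expr mN sa sh sk aE); [|exact: push_tangent|exact: push_tangent].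
by apply: eq_bigr => i _; rewrite !push_smoothE.
Qed.

Lemma smooth_pull2 b : smooth_tensor2 b -> smooth_tensor2 (pull2 phi b).
Proof.
move=> sb; have pt p u : tangent p u -> tangent (phi p) (push phi u) by exact: push_tangent.
split => [p r u v w tu tv tw|p r u v w tu tv tw|X Y vX vY].
- by rewrite /pull2 push_comb (tensor2_combl sb)//; exact: pt.
- by rewrite /pull2 push_comb (tensor2_combr sb)//; exact: pt.
apply/(smoothP mM) => p; have [h [k [sh sk bE]]] := tensor2_local mN (phi p) sb.
have sh' i j := smooth_comp mM mN sphi (sh i j); have sk' i := smooth_comp mM mN sphi (sk i).
have : smooth (fun q => \sum_i \sum_j (h i j \o phi) q * (X q (k i \o phi) * Y q (k j \o phi))).
  apply: smooth_sum => // i _; apply: smooth_sum => // j _.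
  by apply: smoothM => //; apply: smoothM => //; exact: vf_smooth.
move/(smoothP mM) => /(_ p); apply: (smooth_near_eq mM).
apply: filterS (near_map bE) => q bq; rewrite /pull2 bq; [|exact: pt (vf_tangent _ _)|exact: pt (vf_tangent _ _)].
by apply: eq_bigr => i _; apply: eq_bigr => j _; rewrite !push_smoothE.
Qed.

End pullbacks.

(** * From function-linear operations to one-forms *)

Section tensoriality.
Context {R : realType} {M : premanifold R} (mM : manifold M).
Local Notation n := (mdim M).
Implicit Types (p q : M) (h k : M -> R) (X Y V : vfield M).

(** Linearity over smooth functions makes [T X p] depend on [X p] alone. The form is then defined by
    evaluating [T] on any extension of the given vector. *)
Lemma tensorial (T : vfield M -> M -> R) :
  (forall h X Y p, smooth h -> vector_field X -> vector_field Y ->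
     T (fun q => h q *: X q + Y q) p = h p * T X p + T Y p) ->
  (forall X, vector_field X -> smooth (T X)) ->
  exists2 a : form1 M, smooth_form1 a &
    forall X p, vector_field X -> a p (X p) = T X p.
Proof.
move=> Tlin Tsm; have v0 := vf0 mM.
have T0 p : T (fun=> 0) p = 0.
  (* With coefficient -1 the value at the zero field equals minus itself plus itself. *)
  have := Tlin (fun=> -1) (fun=> 0) (fun=> 0) p (smooth_cst mM _) v0 v0.
  rewrite (_ : (fun q => _) = fun=> 0); first lra.
  by rewrite funeqE => q; rewrite scaler0 addr0.
have Tz X p : vector_field X -> X p = 0 -> T X p = 0.
  move=> vX X0; have [E [x [vE sx Ex]]] := local_frame mM p.
  have [W [oW Wp] WE] : exists2 W, open_nbhs p W & W `<=` [set q | forall v, tangent q v ->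
      v = \sum_i v (x i) *: E i q].
    have : \forall q \near p, forall v, tangent q v -> v = \sum_i v (x i) *: E i q.
      by apply: filterS Ex => q [].
    by rewrite /prop_near1 nbhsE.
  have [b [sb b1 [C cC [CW b0]]]] := bump_exists mM oW Wp.
  (* The cutoff turns the frame expansion of X near [p] into a global identity, whose coefficients
     vanish at [p] because X does. *)
  have bX : (fun q => b q *: X q + 0) = (fun q => \sum_i (b q * X q (x i)) *: E i q).
    rewrite funeqE => q; rewrite addr0; have [/CW/WE Cq|/b0 bq] := pselect (C q).
      rewrite {1}(Cq _ (vf_tangent q vX)) scaler_sumr; apply: eq_bigr => i _.
      by rewrite scalerA.
    rewrite bq scale0r big1// => i _; by rewrite mul0r scale0r.
  have := Tlin b X (fun=> 0) p sb vX v0.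
  rewrite bX T0 addr0 (nbhs_singleton b1) mul1r => <-.
  have sbx i : smooth (fun q => b q * X q (x i)) by apply: smoothM => //; exact: vf_smooth.
  elim: (index_enum _) => [|i r IH].
    by rewrite (_ : (fun q => _) = fun=> 0) ?T0// funeqE => q; rewrite big_nil.
  rewrite (_ : (fun q => _) = fun q => (b q * X q (x i)) *: E i q +
      \sum_(i <- r) (b q * X q (x i)) *: E i q); last first.
    by rewrite funeqE => q; rewrite big_cons.
  rewrite (Tlin (fun q => b q * X q (x i)) (E i) _ p (sbx i) (vE i)) ?IH; last first.
    by apply: vf_sum => // j; exact: vfZ.
  by rewrite X0 tvec0E mulr0 mul0r addr0.
have Teq X Y p : vector_field X -> vector_field Y -> X p = Y p -> T X p = T Y p.
  move=> vX vY XY; have := Tlin (fun=> -1) Y X p (smooth_cst mM _) vY vX.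
  rewrite Tz; first by move=> H; lra.
  - exact: vf_comb (smooth_cst mM _) vY vX.
  - by rewrite XY scaleN1r addNr.
(* One extension is fixed for each tangent vector; pairs that are not tangent get the zero field. *)
have /choice[e He] : forall pv : M * tvec M, exists X : vfield M, tangent pv.1 pv.2 ->
    vector_field X /\ X pv.1 = pv.2.
  move=> [p v]; have [tv|ntv] := pselect (tangent p v); last by exists (fun=> 0).
  by have [X vX Xv] := tangent_extend mM tv; exists X.
have ve p v : tangent p v -> vector_field (e (p, v)) by move=> tv; case: (He (p, v) tv).
have ee p v : tangent p v -> e (p, v) p = v by move=> tv; case: (He (p, v) tv).
have aE X p : vector_field X -> T (e (p, X p)) p = T X p.
  by move=> vX; have tX := vf_tangent p vX; apply: Teq => //; [exact: ve|exact: ee].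
exists (fun p v => T (e (p, v)) p); last by move=> X p vX; exact: aE.
split => [p r u v tu tv|X vX].
  rewrite -(Tlin (fun=> r)); [|exact: smooth_cst|exact: ve|exact: ve].
  have tc := tangent_comb r tu tv.
  apply: Teq; [exact: ve| |by rewrite !ee].
  by apply: vf_comb; [exact: mM|exact: smooth_cst|exact: ve|exact: ve].
have -> : (fun p => T (e (p, X p)) p) = T X by rewrite funeqE => p; exact: aE.
exact: Tsm.
Qed.

End tensoriality.

(** * Raising indices with a nondegenerate tensor *)

Section musical.
Context {R : realType} {M : premanifold R} (mM : manifold M).
Local Notation n := (mdim M).
Implicit Types (p q : M) (h k : M -> R) (X Y V : vfield M).

Lemma smooth_near_det m (A : M -> 'M[R]_m) p : (forall i j, smooth_near (fun q => A q i j) p) ->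
  smooth_near (fun q => \det (A q)) p.
Proof.
move=> sA; rewrite /determinant; apply: smooth_near_sum => // s _.
apply: smooth_nearM => //; first exact: smooth_near_cst.
exact: smooth_near_prod.
Qed.

Lemma smooth_near_invmx m (A : M -> 'M[R]_m) p : (forall i j, smooth_near (fun q => A q i j) p) ->
  (\forall q \near p, A q \in unitmx) ->
  forall i j, smooth_near (fun q => invmx (A q) i j) p.
Proof.
move=> sA uA i j.
have sd := smooth_near_det sA.
have d0 : \det (A p) != 0 by have := nbhs_singleton uA; rewrite unitmxE unitfE.
apply: (smooth_near_eq mM (h := fun q => (\det (A q))^-1 * cofactor (A q) j i)).
  by apply: filterS uA => q uq; rewrite /invmx uq !mxE.
apply: smooth_nearM => //; first exact: smooth_near_inv.
rewrite /cofactor; apply: smooth_nearM => //; first exact: smooth_near_cst.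
apply: smooth_near_det => i' j'.
by under eq_fun do rewrite !mxE.
Qed.

Section nondegenerate.
Variable g : tensor2 M.
Hypothesis sg : smooth_tensor2 g.
Hypothesis ndg : forall p u, tangent p u -> (forall v, tangent p v -> g p u v = 0) -> u = 0.

Lemma nondeg_eq p u v : tangent p u -> tangent p v ->
  (forall w, tangent p w -> g p u w = g p v w) -> u = v.
Proof.
move=> tu tv H; apply/eqP; rewrite -subr_eq0; apply/eqP; apply: (ndg (p := p)).
  exact: tangentB.
by move=> w tw; rewrite (tensor2Bl sg)// H// subrr.
Qed.

Lemma nondeg_eq_vf p u v : tangent p u -> tangent p v ->
  (forall W, vector_field W -> g p u (W p) = g p v (W p)) -> u = v.
Proof.
move=> tu tv H; apply: (nondeg_eq tu tv) => w tw.
by have [W vW <-] := tangent_extend mM tw; exact: H.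
Qed.

(** In a frame the dual vector is given by the inverse Gram matrix. Its entries are cofactors over
    the determinant, hence smooth; this is where smoothness of the field comes from. *)
Lemma musical a : smooth_form1 a -> exists2 X : vfield M, vector_field X &
  forall p v, tangent p v -> g p (X p) v = a p v.
Proof.
move=> sa.
pose G (E : 'I_n -> vfield M) q := \matrix_(i, j) g q (E i q) (E j q).
pose w (E : 'I_n -> vfield M) q := \sum_i ((\row_j a q (E j q)) *m invmx (G E q)) 0 i *: E i q.
have frame p : exists (E : 'I_n -> vfield M) (x : 'I_n -> M -> R),
  [/\ forall i, vector_field (E i), forall i, smooth (x i) &
   \forall q \near p, G E q \in unitmx /\ forall v, tangent q v -> g q (w E q) v = a q v].
  have [E [x [vE sx Ex]]] := local_frame mM p; exists E, x; split => //.
  apply: filterS Ex => q [Eq dual].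
  have tE i : tangent q (E i q) by exact: vf_tangent.
  (* A row vector killed by the Gram matrix gives a combination of the frame orthogonal to
     everything, hence 0; the dual functions [x j] then read off that its coefficients vanish. *)
  have Gu : G E q \in unitmx.
    rewrite -row_free_unit; apply: inj_row_free => c cG.
    have w0 : \sum_i c 0 i *: E i q = 0.
      apply: (ndg (p := q)); first by apply: tangent_sum => i _; exact: tangentZ.
      move=> v tv; rewrite (Eq v tv) (tensor2_sumr sg)//; last first.
        by apply: tangent_sum => i _; exact: tangentZ.
      rewrite big1// => j _; rewrite (tensor2_suml sg)//.
      have /matrixP/(_ 0 j) := cG; rewrite !mxE => cG0.
      rewrite (_ : \sum_i _ = 0) ?mulr0// -[RHS]cG0.
      by apply: eq_bigr => i _; rewrite mxE.
    apply/matrixP => i j; rewrite ord1 mxE.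
    have := congr1 (fun w : tvec M => w (x j)) w0.
    rewrite tvec_sumE tvec0E (bigD1 j)//= tvecZE dual eqxx mulr1 big1 ?addr0// => k kj.
    by rewrite tvecZE dual (negbTE kj) mulr0.
  split => // v tv; rewrite {1}(Eq v tv) {2}(Eq v tv) (form1_sum sa)//.
  have tw : tangent q (w E q) by apply: tangent_sum => i _; exact: tangentZ.
  rewrite (tensor2_sumr sg)//; apply: eq_bigr => j _; congr (_ * _).
  rewrite (tensor2_suml sg)//.
  transitivity (((\row_j a q (E j q)) *m invmx (G E q) *m G E q) 0 j).
    by rewrite [RHS]mxE; apply: eq_bigr => i _; congr (_ * _); rewrite mxE.
  by rewrite mulmxKV// mxE.
have /choice[X HX] : forall p, exists w, tangent p w /\ forall v, tangent p v -> g p w v = a p v.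
  move=> p; have [E [x [vE sx /nbhs_singleton[_ H]]]] := frame p.
  eexists; split; last exact: H.
  by apply: tangent_sum => i _; apply: tangentZ; exact: vf_tangent.
exists X; last by move=> p; case: (HX p).
split => [p|h sh]; first by case: (HX p).
apply/(smoothP mM) => p; have [E [x [vE sx H]]] := frame p.
have uG : \forall q \near p, G E q \in unitmx by apply: filterS H => q [].
have sG i j : smooth_near (fun q => G E q i j) p.
  under eq_fun do rewrite mxE.
  exact: ((smoothP mM _).1 (tensor2_smooth sg (vE i) (vE j)) p).
have := smooth_near_invmx sG uG => siG.
apply: (smooth_near_eq mM (h := fun q => \sum_i (\sum_j a q (E j q) * invmx (G E q) j i) * E i q h)).
  apply: filterS H => q [_ H].
  (* Nondegeneracy makes the pointwise choice unique, so it coincides near [p] with the frame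
     expression. *)
  have -> : X q = w E q.
    have [tX XE] := HX q; apply: (nondeg_eq (p := q)) => //.
      by apply: tangent_sum => i _; apply: tangentZ; exact: vf_tangent.
    by move=> v tv; rewrite XE// -H.
  rewrite /w tvec_sumE; apply: eq_bigr => i _; rewrite tvecZE mxE; congr (_ * _).
  by apply: eq_bigr => j _; rewrite mxE.
apply: smooth_near_sum => // i _; apply: smooth_nearM => //; last first.
  exact: ((smoothP mM _).1 (vf_smooth (vE i) sh) p).
apply: smooth_near_sum => // j _; apply: smooth_nearM => //.
exact: ((smoothP mM _).1 (form1_smooth sa (vE j)) p).
Qed.

End nondegenerate.
End musical.

(** * Existence of the Levi-Civita connection *)

Section levi_civita_existence.
Context {R : realType} {M : premanifold R}.
Implicit Types (p q : M) (h k : M -> R) (X Y V : vfield M).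
Variable g : tensor2 M.
Hypothesis pg : pseudo_riemannian g.
Let mM : manifold M. Proof. by case: pg. Qed.
Let sg : smooth_tensor2 g. Proof. by case: pg. Qed.
Let ndg : forall p u, tangent p u -> (forall v, tangent p v -> g p u v = 0) -> u = 0.
Proof. by case: pg. Qed.

(** The value of g (D X Y, V) that metric compatibility and vanishing torsion force. *)
Definition koszul X Y V p : R :=
  2^-1 * (X p (fun q => g q (Y q) (V q)) + Y p (fun q => g q (X q) (V q))
   - V p (fun q => g q (X q) (Y q)) + g p (bracket X Y p) (V p)
   - g p (bracket X V p) (Y p) - g p (bracket Y V p) (X p)).

Lemma gsym p X Y : vector_field X -> vector_field Y -> g p (X p) (Y p) = g p (Y p) (X p).
Proof. by case: pg => _ _ + _ vX vY; apply; exact: vf_tangent. Qed.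

Lemma gsym_fun X Y : vector_field X -> vector_field Y ->
  (fun q => g q (X q) (Y q)) = fun q => g q (Y q) (X q).
Proof. by move=> vX vY; rewrite funeqE => q; exact: gsym. Qed.

Let sgf X Y : vector_field X -> vector_field Y -> smooth (fun q => g q (X q) (Y q)).
Proof. by move=> vX vY; exact: tensor2_smooth. Qed.

Let dcombl X Y V W h p : vector_field X -> vector_field Y -> vector_field V -> vector_field W ->
  smooth h -> W p (fun q => g q (h q *: X q + Y q) (V q)) =
    W p h * g p (X p) (V p) + h p * W p (fun q => g q (X q) (V q)) + W p (fun q => g q (Y q) (V q)).
Proof.
move=> vX vY vV vW sh; have tW := vf_tangent p vW.
under eq_fun do rewrite (tensor2_combl sg _ (vf_tangent _ vX) (vf_tangent _ vY) (vf_tangent _ vV)).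
by rewrite (tangentD_fun tW (smoothM mM sh (sgf vX vV)) (sgf vY vV)) (tangent_mul tW sh (sgf vX vV)).
Qed.

Let dcombr X Y V W h p : vector_field X -> vector_field Y -> vector_field V -> vector_field W ->
  smooth h -> W p (fun q => g q (V q) (h q *: X q + Y q)) =
    W p h * g p (V p) (X p) + h p * W p (fun q => g q (V q) (X q)) + W p (fun q => g q (V q) (Y q)).
Proof.
move=> vX vY vV vW sh; have tW := vf_tangent p vW.
under eq_fun do rewrite (tensor2_combr sg _ (vf_tangent _ vX) (vf_tangent _ vY) (vf_tangent _ vV)).
by rewrite (tangentD_fun tW (smoothM mM sh (sgf vV vX)) (sgf vV vY)) (tangent_mul tW sh (sgf vV vX)).
Qed.

Let bcombl h X X' Y V p : smooth h -> vector_field X -> vector_field X' -> vector_field Y -> vector_field V ->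
  g p (bracket (fun q => h q *: X q + X' q) Y p) (V p) =
  h p * g p (bracket X Y p) (V p) - Y p h * g p (X p) (V p) + g p (bracket X' Y p) (V p).
Proof.
move=> sh vX vX' vY vV; rewrite bracket_comb//.
have t1 := vf_tangent p (vf_bracket mM vX vY); have t2 := vf_tangent p (vf_bracket mM vX' vY).
have tX := vf_tangent p vX; have tV := vf_tangent p vV.
have tZ1 := tangentZ (h p) t1; have tZ2 := tangentZ (Y p h) tX.
rewrite (tensor2Dl sg)//; last exact: tangentB.
by rewrite (tensor2Bl sg)// !(tensor2Zl sg).
Qed.

Let bcombr h X X' Y V p : smooth h -> vector_field X -> vector_field X' -> vector_field Y -> vector_field V ->
  g p (bracket Y (fun q => h q *: X q + X' q) p) (V p) =
  h p * g p (bracket Y X p) (V p) + Y p h * g p (X p) (V p) + g p (bracket Y X' p) (V p).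
Proof.
move=> sh vX vX' vY vV; have vc := vf_comb mM sh vX vX'.
have N A B : vector_field A -> vector_field B -> g p (bracket A B p) (V p) = - g p (bracket B A p) (V p).
  move=> vA vB; rewrite bracketC (tensor2Nl sg)//; first exact: vf_tangent (vf_bracket mM vB vA).
  exact: vf_tangent.
rewrite (N _ _ vY vc) bcombl// (N _ _ vY vX) (N _ _ vY vX'); ring.
Qed.

Let tcombl h X X' V p : vector_field X -> vector_field X' -> vector_field V ->
  g p (h p *: X p + X' p) (V p) = h p * g p (X p) (V p) + g p (X' p) (V p).
Proof. by move=> vX vX' vV; rewrite (tensor2_combl sg)//; exact: vf_tangent. Qed.

Let tcombr h X X' w p : vector_field X -> vector_field X' -> tangent p w ->
  g p w (h p *: X p + X' p) = h p * g p w (X p) + g p w (X' p).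
Proof. by move=> vX vX' vV; rewrite (tensor2_combr sg)//; exact: vf_tangent. Qed.

(** In the last argument the terms with derivatives of the coefficient h cancel, up to the symmetry
    of [g]; raising the index will then produce D X Y. *)
Lemma koszul_tensorial X Y : vector_field X -> vector_field Y ->
  exists2 a : form1 M, smooth_form1 a & forall V p, vector_field V -> a p (V p) = koszul X Y V p.
Proof.
move=> vX vY; apply: (tensorial mM) => [h V V' p sh vV vV'|V vV].
  rewrite /koszul !dcombr// !bcombr// !tcombr//; last exact: vf_tangent (vf_bracket mM vX vY).
  rewrite tvecE_comb (gsym p vV vY) (gsym p vV vX); ring.
have sb A B C : vector_field A -> vector_field B -> vector_field C ->
    smooth (fun p => g p (bracket A B p) (C p)).
  by move=> vA vB vC; exact: tensor2_smooth (vf_bracket mM vA vB) vC.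
have sd A B C : vector_field A -> vector_field B -> vector_field C ->
    smooth (fun p => A p (fun q => g q (B q) (C q))).
  by move=> vA vB vC; apply: vf_smooth => //; exact: sgf.
apply: smoothM => //; first exact: smooth_cst.
apply: (smoothB mM); last exact: sb.
apply: (smoothB mM); last exact: sb.
apply: (smoothD mM); last exact: sb.
apply: (smoothB mM); last exact: sd.
by apply: (smoothD mM); exact: sd.
Qed.

Lemma koszul_exists : exists D : vfield M -> vfield M -> vfield M,
  forall X Y, vector_field X -> vector_field Y -> vector_field (D X Y) /\
    forall V p, vector_field V -> g p (D X Y p) (V p) = koszul X Y V p.
Proof.
have H (XY : vfield M * vfield M) : exists Z : vfield M, vector_field XY.1 -> vector_field XY.2 ->
    vector_field Z /\ forall V p, vector_field V -> g p (Z p) (V p) = koszul XY.1 XY.2 V p.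
  case: XY => X Y /=; have [vX|nX] := pselect (vector_field X); last by exists X.
  have [vY|nY] := pselect (vector_field Y); last by exists X.
  have [a sa aE] := koszul_tensorial vX vY.
  have [Z vZ ZE] := musical mM sg ndg sa; exists Z => _ _; split => // V p vV.
  by rewrite ZE ?aE//; exact: vf_tangent.
have /choice[D HD] := H; exists (fun X Y => D (X, Y)) => X Y vX vY.
exact: (HD (X, Y)).
Qed.

(** By nondegeneracy each axiom is tested against arbitrary fields V, where it becomes a linear
    identity between the terms of Koszul's formula. *)
Lemma koszul_levi_civita (D : vfield M -> vfield M -> vfield M) :
  (forall X Y, vector_field X -> vector_field Y -> vector_field (D X Y) /\
    forall V p, vector_field V -> g p (D X Y p) (V p) = koszul X Y V p) ->
  levi_civita g D.
Proof.
move=> HD; have vD X Y : vector_field X -> vector_field Y -> vector_field (D X Y).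
  by move=> vX vY; case: (HD X Y vX vY).
have DE X Y V p : vector_field X -> vector_field Y -> vector_field V ->
    g p (D X Y p) (V p) = koszul X Y V p.
  by move=> vX vY; case: (HD X Y vX vY) => _ + vV; apply.
have tv X p : vector_field X -> tangent p (X p) by exact: vf_tangent.
have vc h X X' : smooth h -> vector_field X -> vector_field X' -> vector_field (fun q => h q *: X q + X' q).
  exact: vf_comb.
have s1 := smooth_cst mM (1 : R); have v0 := vf0 mM.
have fD Y Y' : (fun q => Y q + Y' q) = (fun q => (1 : R) *: Y q + Y' q) :> vfield M.
  by rewrite funeqE => q; rewrite scale1r.
have fZ h Y : (fun q => h q *: Y q) = (fun q => h q *: Y q + 0) :> vfield M.
  by rewrite funeqE => q; rewrite addr0.
have X1 X p : vector_field X -> X p (fun=> 1 : R) = 0 by move=> vX; exact: (tangent_cst mM 1 (tv _ p vX)).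
(* One rule for the second argument covers both remaining axioms: additivity is the case h = 1, the
   Leibniz rule the case Y' = 0. *)
have Dcomb h X Y Y' p : smooth h -> vector_field X -> vector_field Y -> vector_field Y' ->
    D X (fun q => h q *: Y q + Y' q) p = X p h *: Y p + h p *: D X Y p + D X Y' p.
  move=> sh vX vY vY'; apply: (nondeg_eq_vf mM sg ndg (p := p)).
  + by apply: tv; apply: vD => //; exact: vc.
  + apply: tangentD; last by apply: tv; exact: vD.
    by apply: tangentD; apply: tangentZ; apply: tv => //; exact: vD.
  move=> V vV; have tD := tv _ p (vD _ _ vX vY); have tD' := tv _ p (vD _ _ vX vY').
  have tV := tv _ p vV; have tY := tv _ p vY.
  have t1 := tangentZ (X p h) tY; have t2 := tangentZ (h p) tD.
  rewrite (tensor2Dl sg (tangentD t1 t2) tD' tV) (tensor2Dl sg t1 t2 tV) !(tensor2Zl sg)//.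
  rewrite !DE//; last exact: vc.
  rewrite /koszul !dcombl// !dcombr// !bcombl// !bcombr// tvecE_comb.
  rewrite !(tcombr h)//; last exact: tv _ _ (vf_bracket mM vX vV).
  rewrite (gsym p vX vY); lra.
split; first split.
- exact: vD.
- move=> h X X' Y sh vX vX' vY p; apply: (nondeg_eq_vf mM sg ndg (p := p)).
  + by apply: tv; apply: vD => //; exact: vc.
  + by apply: tangent_comb; apply: tv; exact: vD.
  move=> V vV; rewrite (tensor2_combl sg _ (tv _ p (vD _ _ vX vY)) (tv _ p (vD _ _ vX' vY)) (tv _ p vV)).
  rewrite !DE//; last exact: vc.
  rewrite /koszul !dcombl// !bcombl// tvecE_comb !tcombr//; last exact: tv _ _ (vf_bracket mM vY vV).
  by ring.
- move=> X Y Y' vX vY vY' p; rewrite fD Dcomb// X1// scale0r add0r.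
  by rewrite scale1r.
- move=> h X Y sh vX vY p; rewrite (fZ h Y) Dcomb//.
  (* Applied to zero fields, the rule reads D X 0 = D X 0 + D X 0, so the leftover term D X 0
     vanishes. *)
  have := Dcomb (fun=> 1) X (fun=> 0) (fun=> 0) p s1 vX v0 v0.
  have -> : (fun=> (1 : R) *: (0 : tvec M) + 0) = (fun=> 0) :> vfield M.
    by rewrite funeqE => q; rewrite scaler0 addr0.
  rewrite X1// scaler0 add0r scale1r => /eqP; rewrite -subr_eq0 opprD addrA subrr sub0r oppr_eq0.
  by move=> /eqP ->; rewrite addr0.
- move=> X Y vX vY p; apply: (nondeg_eq_vf mM sg ndg (p := p)).
  + by apply: tangentB; apply: tv; exact: vD.
  + exact: tv _ _ (vf_bracket mM vX vY).
  move=> V vV; rewrite (tensor2Bl sg)//; [|exact: tv _ _ (vD _ _ vX vY)|exact: tv _ _ (vD _ _ vY vX)|exact: tv].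
  rewrite !DE// /koszul (gsym_fun vX vY) [bracket Y X p]bracketC.
  rewrite (tensor2Nl sg)//; [|exact: tv _ _ (vf_bracket mM vX vY)|exact: tv].
  by lra.
- move=> X Y V vX vY vV p; have vB := vf_bracket mM.
  have vXY := vD _ _ vX vY; have vXV := vD _ _ vX vV.
  rewrite (gsym p vY vXV) !DE// /koszul.
  rewrite (gsym_fun vV vY) (bracketC Y V p) (tensor2Nl sg); [|exact: tv _ _ (vB _ _ vY vV)|exact: tv].
  rewrite (gsym_fun vX vV) (gsym_fun vX vY); lra.
Qed.

End levi_civita_existence.

(** * Principal circle bundles *)

(** Reduce s - s' modulo 2 pi to r in [0, 2 pi[. Then cos r = 1, so sin (r / 2) = 0, which is
    impossible for r > 0 since r / 2 would lie strictly between 0 and pi. The lemma makes the action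
    depend only on the point of the circle. *)
Lemma cos_sin_eq_shift (R : realType) (s s' : R) : s' <= s -> cos s = cos s' -> sin s = sin s' ->
  exists k : nat, s = s' + (2 * pi) *+ k.
Proof.
move=> ss' cE sE; pose d := s - s'; have pi2 : 0 < 2 * pi :> R by rewrite mulr_gt0// pi_gt0.
have d0 : 0 <= d / (2 * pi) by rewrite divr_ge0 ?subr_ge0// ltW.
have cd : cos d = 1 by rewrite cosB cE sE -!expr2 cos2Dsin2.
pose k := Num.truncn (d / (2 * pi)); exists k.
have /andP[k1 k2] : k%:R <= d / (2 * pi) < k.+1%:R by exact: truncn_itv.
pose r := d - (2 * pi) *+ k.
have r0 : 0 <= r by rewrite subr_ge0 -mulr_natl -ler_pdivlMr.
have r2 : r < 2 * pi.
  move: k2; rewrite ltr_pdivrMr// -natr1 mulrDl mul1r.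
  have -> : k%:R * (2 * pi) = (2 * pi) *+ k :> R by rewrite [LHS]mulr_natl.
  by move=> H; rewrite /r; lra.
have cr : cos r = 1.
  rewrite -cd -[in RHS](subrK ((2 * pi) *+ k) d) -/r.
  by rewrite (periodicn (f := cos) (T := 2 * pi))// => x; rewrite mulr_natl cosD2pi.
suff : r = 0.
  move=> /eqP; rewrite subr_eq0 => /eqP <-; rewrite /d; ring.
apply/eqP; rewrite eq_le r0 andbT leNgt; apply/negP => rp.
have h1 : 0 < r / 2 < pi by apply/andP; split; lra.
have := sin_gt0_pi h1; have : cos r = 1 - 2 * (sin (r / 2)) ^+ 2.
  have rE : r = r / 2 + r / 2 by lra.
  by rewrite {1}rE cosD; have := cos2Dsin2 (r / 2); lra.
rewrite cr => H s0; have : sin (r / 2) ^+ 2 = 0 by lra.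
by move/eqP; rewrite sqrf_eq0 => /eqP s1; rewrite s1 ltxx in s0.
Qed.

(** On the right half of the unit circle the angle is a smooth function of the point. *)
Lemma cos_sin_atan (R : realType) (a b : R) : 0 < a -> a ^+ 2 + b ^+ 2 = 1 ->
  cos (atan (b / a)) = a /\ sin (atan (b / a)) = b.
Proof.
move=> a0 ab; have an0 : a != 0 by rewrite gt_eqF.
have c : cos (atan (b / a)) = a.
  rewrite cos_atan.
  have -> : 1 + (b / a) ^+ 2 = (a^-1) ^+ 2.
    by rewrite expr_div_n -[X in X + _](divff (expf_neq0 2 an0)) -mulrDl ab mul1r exprVn.
  by rewrite sqrtr_sqr ger0_norm ?invrK// invr_ge0 ltW.
split => //; have := atanK (b / a); rewrite /tan c => /(congr1 ( *%R^~ a)).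
by rewrite !divfK.
Qed.

Section local_push.
Context {R : realType} {M N : premanifold R} (mM : manifold M) (mN : manifold N).

(** Push-forward along a map smooth near [p] only, such as a local section of a bundle: test
    functions are pulled back and multiplied by a cutoff that is 1 near [p]. *)
Lemma local_push (phi : M -> N) p v : (\forall q \near p, smooth_map_at phi q) -> tangent p v ->
  exists2 u : tvec N, tangent (phi p) u &
  forall h k, smooth h -> smooth k -> (\forall q \near p, k q = h (phi q)) -> u h = v k.
Proof.
move=> sphi tv; have [W [oW Wp] WH] : exists2 W, open_nbhs p W & W `<=` [set q | smooth_map_at phi q].
  by move: sphi; rewrite /prop_near1 nbhsE.
have [b [sb b1 [C cC [CW b0]]]] := bump_exists mM oW Wp.
have sc h : smooth h -> smooth (fun q => b q * h (phi q)).
  move=> sh; apply: (smooth_cutoff mM cC CW b0 sb) => q /WH sq.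
  exact: (smooth_near_comp sq ((smoothP mN h).1 sh (phi q))).
have bp := nbhs_singleton b1.
exists (restrict_smooth (fun h => v (fun q => b q * h (phi q)))); last first.
  move=> h k sh sk kE; rewrite restrict_smoothE//.
  apply: (tangent_near mM tv (sc _ sh) sk).
  by apply: filterS2 b1 kE => q -> ->; rewrite mul1r.
split.
- by move=> h nh; rewrite restrict_smooth_ns.
- move=> a h k sh sk; rewrite !restrict_smoothE//; last first.
    by apply: smoothD => //; apply: smoothM => //; exact: smooth_cst.
  rewrite -(tangent_lin _ tv (sc _ sh) (sc _ sk)); congr v.
  by rewrite funeqE => q; ring.
- move=> h k sh sk; rewrite !restrict_smoothE//; last exact: smoothM.
  have := tangent_mul tv (sc _ sh) (sc _ sk); rewrite bp !mul1r => <-.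
  apply: (tangent_near mM tv); [exact: sc (smoothM mN sh sk)|exact: (@smoothM _ _ mM (fun q => b q * h (phi q)) (fun q => b q * k (phi q)) (sc _ sh) (sc _ sk))|].
  by apply: filterS b1 => q ->; rewrite !mul1r.
Qed.

End local_push.

(** * Local sections, lifts and vertical vectors *)

Section circle_bundle.
Context {R : realType} {M P : premanifold R} {pr : P -> M} {act : R -> P -> P}.
Hypothesis bundle : principal_circle_bundle pr act.
Let mP : manifold P. Proof. by case: bundle. Qed.
Let mM : manifold M. Proof. by case: bundle. Qed.
Let mPR := prodR_manifold mP.
Let mMR := prodR_manifold mM.
Local Notation XP := (fundamental_vf act).

Lemma bundle_proj_smooth p : smooth_map_at pr p.
Proof. by case: bundle => _ _ spr _ _; exact: (smooth_on_at mP mM openT spr I). Qed.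

Lemma act_smooth2 (y : prodR P) : smooth_map_at (fun y : prodR P => act y.2 y.1 : P) y.
Proof. by case: bundle => _ _ _ [sact _ _ _] _; exact: (smooth_on_at mPR mP openT sact I). Qed.

Lemma act0 p : act 0 p = p. Proof. by case: bundle => _ _ _ [_ + _ _] _. Qed.

Lemma actD s t p : act (s + t) p = act s (act t p).
Proof. by case: bundle => _ _ _ [_ _ + _] _. Qed.

Lemma act_2pi p k : act ((2 * pi) *+ k) p = p.
Proof.
elim: k => [|k IH]; first by rewrite mulr0n act0.
by rewrite mulrS actD IH; case: bundle => _ _ _ [_ _ _ +] _.
Qed.

Lemma act_smooth s p : smooth_map_at (act s) p.
Proof.
exact: (smooth_map_at_comp (smooth_map_at_slice mP s p) (act_smooth2 (slice s p))).
Qed.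

Lemma act_eq s s' p : cos s = cos s' -> sin s = sin s' -> act s p = act s' p.
Proof.
wlog le : s s' / s' <= s.
  by move=> H cE sE; case: (leP s' s) => [/H|/ltW /H]; [apply|move/(_ (esym cE) (esym sE))].
move=> cE sE; have [k ->] := cos_sin_eq_shift le cE sE.
by rewrite actD act_2pi.
Qed.

Lemma proj_act s p : pr (act s p) = pr p.
Proof.
case: bundle => _ _ _ _ /(_ (pr p))[U [chi1 [chi2 [sigma [oU Up [_ _ _ tr inv]]]]]].
have [s0 [_ _ {1}->]] := tr p Up; rewrite -actD.
by case: (inv _ (s + s0) Up).
Qed.

(** A trivialisation recentred at [p]: the section passes through [p] and the angle, which is only
    defined up to 2 pi, becomes a genuine smooth function [S] near [p], vanishing at [p]. *)
Lemma bundle_local p : exists (U : set M) (sigma : M -> P) (S : P -> R),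
  [/\ open U, U (pr p), forall x, U x -> smooth_map_at sigma x & forall x, U x -> pr (sigma x) = x] /\
  [/\ sigma (pr p) = p, smooth S, S p = 0 & \forall q \near p, q = act (S q) (sigma (pr q))].
Proof.
have [_ _ _ _ /(_ (pr p))[U [chi1 [chi2 [sigma [oU Up [sc1 sc2 ss tr inv]]]]]]] := bundle.
have [s0 [c1p c2p pE]] := tr p Up.
have oV : open (pr @^-1` U).
  by apply: open_comp => // q _; case: (bundle_proj_smooth q).
have nV := open_nbhs_nbhs (conj oV (Up : (pr @^-1` U) p)).
have sch1 := (smooth_fun_onP mP chi1 oV).1 sc1 p Up.
have sch2 := (smooth_fun_onP mP chi2 oV).1 sc2 p Up.
(* Rotating by the angle s0 of [p] moves the circle coordinates of [p] to (1, 0), so that nearby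
   points stay in the right half-plane where the arctangent recovers the angle. *)
pose e1 q := cos s0 * chi1 q + sin s0 * chi2 q.
pose e2 q := cos s0 * chi2 q - sin s0 * chi1 q.
have se1 : smooth_near e1 p.
  by apply: (smooth_nearD mP); apply: (smooth_nearM mP) => //; exact: smooth_near_cst.
have se2 : smooth_near e2 p.
  by apply: (smooth_nearB mP); apply: (smooth_nearM mP) => //; exact: smooth_near_cst.
have e1p : e1 p = 1 by rewrite /e1 c1p c2p -!expr2 cos2Dsin2.
have e2p : e2 p = 0 by rewrite /e2 c1p c2p; ring.
have sS : smooth_near (fun q => atan (e2 q / e1 q)) p.
  apply: (smooth_near_atan mP); apply: (smooth_nearM mP) => //.
  by apply: (smooth_near_inv mP) => //; rewrite e1p oner_neq0.
have [S sS' SE] := smooth_extension mP sS.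
exists U, (act s0 \o sigma), S; split; split => //.
- move=> x Ux; apply: smooth_map_at_comp (act_smooth _ _).
  exact: (smooth_on_at mM mP oU ss Ux).
- by move=> x Ux; case: (inv x s0 Ux).
- by rewrite (nbhs_singleton SE) e2p mul0r atan0.
- have ne1 : \forall q \near p, 0 < e1 q.
    have e1pos : [set x : R | 0 < x] (e1 p) by rewrite /= e1p.
    exact: (smooth_near_continuous mP se1 (open_nbhs_nbhs (conj (@open_gt _ 0) e1pos))).
  near=> q; have Uq : U (pr q) by near: q.
  have [s [c1q c2q {1}->]] := tr q Uq.
  have -> : S q = atan (e2 q / e1 q) by near: q.
  have e1q : e1 q = cos (s - s0) by rewrite /e1 c1q c2q cosB; ring.
  have e2q : e2 q = sin (s - s0) by rewrite /e2 c1q c2q sinB; ring.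
  have e1q0 : 0 < e1 q by near: q.
  have [|cE sE] := @cos_sin_atan _ (e1 q) (e2 q) e1q0.
    by rewrite e1q e2q cos2Dsin2.
  rewrite /= -actD; apply: act_eq.
    by rewrite cosD cE sE e1q e2q -cosD subrK.
  by rewrite sinD cE sE e1q e2q -sinD subrK.
Unshelve. all: by end_near. Qed.

Lemma fundamental_vfE p : XP p = push (fun y : prodR P => act y.2 y.1 : P) (partial_t (p, 0) : tvec (prodR P)).
Proof.
rewrite funeqE => h; have [sh|nh] := pselect (smooth h); last first.
  by rewrite push_ns// /fundamental_vf restrict_smooth_ns.
rewrite push_smoothE// /fundamental_vf /partial_t !restrict_smoothE//.
exact: (smooth_comp mPR mP act_smooth2).
Qed.

Lemma vector_field_fundamental : vector_field XP.
Proof.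
split=> [p|h sh].
  rewrite fundamental_vfE -[p in tangent p](act0 p).
  exact: (push_tangent mPR mP act_smooth2 (tangent_partial_t mP (p, 0))).
under eq_fun do rewrite fundamental_vfE push_smoothE//.
have s1 := vf_smooth (vector_field_partial_t mP) (smooth_comp mPR mP act_smooth2 sh).
exact: (smooth_comp mP mPR (smooth_map_at_slice mP 0) s1).
Qed.

Lemma push_proj_fundamental p : push pr (XP p) = 0.
Proof.
rewrite funeqE => h; have [sh|nh] := pselect (smooth h); last exact: push_ns.
rewrite push_smoothE// /fundamental_vf restrict_smoothE; last first.
  exact: (smooth_comp mP mM bundle_proj_smooth).
under eq_fun do rewrite /= proj_act.
by rewrite derive1_cst.
Qed.

(** Push [v] along the local section through [p]. *)
Lemma lift_exists p v : tangent (pr p) v -> exists2 u, tangent p u & push pr u = v.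
Proof.
move=> tv; have [U [sigma [S [[oU Up ss prs] [sp sS Sp SE]]]]] := bundle_local p.
have nU := open_nbhs_nbhs (conj oU Up).
have [|u tu uE] := local_push mM mP (_ : \forall x \near pr p, smooth_map_at sigma x) tv.
  by apply: filterS nU => x; exact: ss.
rewrite sp in tu; exists u => //; rewrite funeqE => h.
have [sh|nh] := pselect (smooth h); last by rewrite push_ns// (tangent_ns tv).
rewrite push_smoothE//; apply: uE => //; first exact: (smooth_comp mP mM bundle_proj_smooth).
by apply: filterS nU => x /prs /= ->.
Qed.

(** Near [p] the identity of [P] factors as q |-> (pr q, S q) |-> act (S q) (sigma (pr q)). The
    first map sends a vertical [u] to u S times the line direction, which the second sends to u S
    times the fundamental field. *)
Lemma ker_proj p u : tangent p u -> push pr u = 0 -> exists a : R, u = a *: XP p.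
Proof.
move=> tu u0; have [U [sigma [S [[oU Up ss prs] [sp sS Sp SE]]]]] := bundle_local p.
exists (u S); have tX := vf_tangent p vector_field_fundamental.
apply: (tangent_ext tu (tangentZ _ tX)) => h sh.
pose y0 : prodR M := (pr p, 0).
pose G (y : prodR M) := h (act y.2 (sigma y.1)).
have sG : smooth_near G y0.
  have s1 : smooth_map_at (fun y : prodR M => (sigma y.1, y.2) : prodR P) y0.
    apply: (smooth_map_at_pair mP mMR); last exact: smooth_near_snd.
    exact: (smooth_map_at_comp (smooth_map_at_fst mM y0) (ss _ Up)).
  have s2 := smooth_map_at_comp s1 (act_smooth2 _).
  exact: (smooth_near_comp s2 ((smoothP mP h).1 sh _)).
have [G' sG' GE] := smooth_extension mMR sG.
pose Phi (q : P) : prodR M := (pr q, S q).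
have sPhi q : smooth_map_at Phi q.
  apply: (smooth_map_at_pair mM mP); first exact: bundle_proj_smooth.
  exact: ((smoothP mP S).1 sS q).
have hE : \forall q \near p, h q = (G' \o Phi) q.
  have cPhi : {for p, continuous Phi} by case: (sPhi p).
  have yE : Phi p = y0 by rewrite /Phi Sp.
  have nG0 : nbhs (Phi p) [set y | G' y = G y] by rewrite yE.
  have nG : \forall q \near p, G' (Phi q) = G (Phi q) := cPhi _ nG0.
  by apply: filterS2 nG SE => q /= -> {1}->.
have sGP := smooth_comp mP mMR sPhi sG'.
rewrite (tangent_near mP tu sh sGP hE) -(push_smoothE Phi u sG').
have tPhi := push_tangent mP mMR sPhi tu.
rewrite [push Phi u](tangent_prodR mM tPhi) (push_push _ _ mMR mM (smooth_map_at_fst mM)).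
have -> : push (fst \o Phi) u = push pr u by [].
rewrite u0 push0 add0r !tvecZE push_smoothE; last exact: smooth_snd.
congr (_ * _); rewrite (_ : Phi p = y0); last by rewrite /Phi Sp.
rewrite /partial_t /fundamental_vf !restrict_smoothE//=.
rewrite !derive1E; apply: near_eq_derive.
have cs : {for 0, continuous (fun t : R => (pr p, t) : prodR M)}.
  by apply: continuous_pair; [exact: cst_continuous|exact: id].
have nG : \forall t \near (0 : R), G' (pr p, t) = G (pr p, t) := cs _ GE.
by apply: filterS nG => t ->; rewrite /G /= sp.
Qed.

End circle_bundle.

(** * Complex structures *)

Section almost_complex_structures.
Context {R : realType} {M : premanifold R} (mM : manifold M).
Variable J : endo M.
Hypothesis cJ : almost_complex J.
Implicit Types (p : M) (u v : tvec M) (X Y V : vfield M).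

Lemma endo_tangent p u : tangent p u -> tangent p (J p u).
Proof. by case: cJ => -[+ _ _] _; apply. Qed.

Lemma endo_comb p r u v : tangent p u -> tangent p v -> J p (r *: u + v) = r *: J p u + J p v.
Proof. by case: cJ => -[_ + _] _; apply. Qed.

Lemma endo_vf X : vector_field X -> vector_field (fun p => J p (X p)).
Proof. by case: cJ => -[_ _ +] _; apply. Qed.

Lemma endoK p u : tangent p u -> J p (J p u) = - u.
Proof. by case: cJ => _; apply. Qed.

Lemma endo0 p : J p 0 = 0.
Proof.
have := endo_comb 1 (tangent0 p) (tangent0 p); rewrite scaler0 add0r scale1r => E.
by apply: (addrI (J p 0)); rewrite -E addr0.
Qed.

Lemma endoD p u v : tangent p u -> tangent p v -> J p (u + v) = J p u + J p v.
Proof. by move=> tu tv; rewrite -[u]scale1r endo_comb// !scale1r. Qed.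

Lemma endoZ p r u : tangent p u -> J p (r *: u) = r *: J p u.
Proof. by move=> tu; rewrite -[r *: u]addr0 endo_comb ?endo0 ?addr0//; exact: tangent0. Qed.

Definition form1_endo (a : form1 M) : form1 M := fun p u => a p (J p u).

Lemma smooth_form1_endo a : smooth_form1 a -> smooth_form1 (form1_endo a).
Proof.
move=> sa; split => [p r u v tu tv|X vX]; rewrite /form1_endo.
  by rewrite endo_comb// (form1_comb sa)//; exact: endo_tangent.
exact: (form1_smooth sa (endo_vf vX)).
Qed.

Definition nijenhuis X Y : vfield M := fun p =>
  bracket (fun q => J q (X q)) (fun q => J q (Y q)) p
  - J p (bracket (fun q => J q (X q)) Y p) - J p (bracket X (fun q => J q (Y q)) p)
  - bracket X Y p.

Lemma nijenhuis_tangent X Y p : vector_field X -> vector_field Y -> tangent p (nijenhuis X Y p).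
Proof.
move=> vX vY; have tb A B : vector_field A -> vector_field B -> tangent p (bracket A B p).
  by move=> vA vB; exact: vf_tangent (vf_bracket mM vA vB).
have vJX := endo_vf vX; have vJY := endo_vf vY.
apply: tangentB; last exact: tb.
apply: tangentB; last by apply: endo_tangent; exact: tb.
by apply: tangentB; [exact: tb|apply: endo_tangent; exact: tb].
Qed.

(* The dual of the Nijenhuis tensor only involves exterior derivatives of
   one-forms, hence can be evaluated without extending tangent vectors. *)
Lemma form1_nijenhuis a X Y p : smooth_form1 a -> vector_field X -> vector_field Y ->
  a p (nijenhuis X Y p) =
  extd (form1_endo a) p (J p (X p)) (Y p) + extd (form1_endo a) p (X p) (J p (Y p))
  - extd a p (J p (X p)) (J p (Y p)) + extd a p (X p) (Y p).
Proof.
move=> sa vX vY; have vJX := endo_vf vX; have vJY := endo_vf vY.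
have tb A B : vector_field A -> vector_field B -> tangent p (bracket A B p).
  by move=> vA vB; exact: vf_tangent (vf_bracket mM vA vB).
have sJ := smooth_form1_endo sa.
rewrite (extdE mM p sJ vJX vY) (extdE mM p sJ vX vJY) (extdE mM p sa vJX vJY) (extdE mM p sa vX vY).
have tJb A B : vector_field A -> vector_field B -> tangent p (J p (bracket A B p)).
  by move=> vA vB; apply: endo_tangent; exact: tb.
have JJ A : vector_field A -> (fun q => a q (J q (J q (A q)))) = fun q => - a q (A q).
  move=> vA; rewrite funeqE => q; have tA := vf_tangent q vA.
  by rewrite endoK// (form1N sa).
rewrite /form1_endo (JJ _ vX) (JJ _ vY).
rewrite (tangentN_fun mM (vf_tangent p vX) (form1_smooth sa vY)).
rewrite (tangentN_fun mM (vf_tangent p vY) (form1_smooth sa vX)).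
have t1 := tb _ _ vJX vJY; have t2 := tJb _ _ vJX vY; have t3 := tJb _ _ vX vJY.
have t4 := tb _ _ vX vY; have t12 := tangentB t1 t2; have t123 := tangentB t12 t3.
rewrite /nijenhuis (form1B sa t123 t4) (form1B sa t12 t3) (form1B sa t1 t2); ring.
Qed.

End almost_complex_structures.

Section kahler_with_killing_field.
Context {R : realType} {M : premanifold R}.
Variables (g : tensor2 M) (J : endo M) (Z : vfield M) (f : M -> R).
Hypothesis pk : pseudo_kahler g J.
Hypothesis kZ : killing g Z.
Hypothesis sf : smooth f.
Hypothesis fE : forall p u, tangent p u -> dfun f p u = - fundamental_form g J p (Z p) u.
Implicit Types (p : M) (u v : tvec M) (X Y V : vfield M).

Definition flat_form : form1 M := fun x u => g x (Z x) u.
Definition shifted_moment : M -> R := fun x => f x - 2^-1 * g x (Z x) (Z x).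
Definition curvature_form : tensor2 M :=
  fun x u v => fundamental_form g J x u v - 2^-1 * extd flat_form x u v.

Local Notation omega := (fundamental_form g J).
Local Notation JZ := (fun p : M => J p (Z p)).
Local Notation beta := flat_form.
Local Notation f1 := shifted_moment.
Local Notation F := curvature_form.

Lemma pk_pr : pseudo_riemannian g. Proof. by case: pk => -[]. Qed.
Lemma pk_manifold : manifold M. Proof. by case: pk_pr. Qed.
Lemma pk_tensor : smooth_tensor2 g. Proof. by case: pk_pr. Qed.
Lemma pk_ac : almost_complex J. Proof. by case: pk => -[]. Qed.
Lemma killing_vf : vector_field Z. Proof. by case: kZ. Qed.
Let mM := pk_manifold.
Let sg := pk_tensor.
Let cJ := pk_ac.
Let vZ := killing_vf.

Lemma pk_sym p u v : tangent p u -> tangent p v -> g p u v = g p v u.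
Proof. by case: pk_pr => _ _ + _; apply. Qed.

Lemma pk_nondeg p u : tangent p u -> (forall v, tangent p v -> g p u v = 0) -> u = 0.
Proof. by case: pk_pr => _ _ _; apply. Qed.

Lemma pk_skew p u v : tangent p u -> tangent p v -> g p (J p u) v = - g p u (J p v).
Proof. by case: pk => -[_ _ + _] _; apply. Qed.

Lemma pk_isometry p u v : tangent p u -> tangent p v -> g p (J p u) (J p v) = g p u v.
Proof.
move=> tu tv; have tJv := endo_tangent cJ tv; have tJu := endo_tangent cJ tu.
by rewrite pk_skew// (endoK cJ)// (tensor2Nr sg)// opprK.
Qed.

Lemma omega_anti p u v : tangent p u -> tangent p v -> omega p v u = - omega p u v.
Proof.
move=> tu tv; have tJv := endo_tangent cJ tv.
by rewrite /fundamental_form pk_sym// pk_skew ?opprK//.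
Qed.

Lemma omega_J p u v : tangent p u -> tangent p v -> omega p (J p u) (J p v) = omega p u v.
Proof. by move=> tu tv; rewrite /fundamental_form pk_isometry//; exact: endo_tangent. Qed.

Lemma smooth_omega : smooth_tensor2 omega.
Proof.
have tJ p u : tangent p u -> tangent p (J p u) := @endo_tangent _ _ _ cJ p u.
split=> [p r u v w tu tv tw|p r u v w tu tv tw|X Y vX vY]; rewrite /fundamental_form.
- by rewrite (endo_comb cJ)// (tensor2_combl sg)//; exact: tJ.
- by rewrite (tensor2_combr sg)//; exact: tJ.
- exact: (tensor2_smooth sg (endo_vf cJ vX) vY).
Qed.

Lemma smooth_beta : smooth_form1 beta.
Proof.
split=> [p r u v tu tv|X vX]; last exact: tensor2_smooth.
by rewrite /flat_form (tensor2_combr sg)//; exact: vf_tangent.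
Qed.

Lemma df_grad p u : tangent p u -> u f = - g p (J p (Z p)) u.
Proof. by move=> tu; have := fE tu. Qed.

(** Z preserves g as a Killing field, and omega since omega is closed and omega (Z, .) = - df is
    closed; hence it preserves J. *)
Lemma lie_J X p : vector_field X ->
  bracket Z (fun q => J q (X q)) p = J p (bracket Z X p).
Proof.
move=> vX; have vJX := endo_vf cJ vX; have vB := vf_bracket mM.
have tv A : vector_field A -> tangent p (A p) by move=> vA; exact: vf_tangent.
apply: (nondeg_eq_vf mM sg pk_nondeg (p := p)).
- exact: tv (vB _ _ vZ vJX).
- by apply: (endo_tangent cJ); exact: tv (vB _ _ vZ vX).
move=> Y vY; case: kZ => _ /(_ _ _ vJX vY p) K.
have cl : closed2 omega by case: pk => -[].
have := cl Z X Y vZ vX vY p.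
have oZ A : vector_field A -> (fun q => omega q (Z q) (A q)) = fun q => - A q f.
  by move=> vA; rewrite funeqE => q; rewrite (df_grad (p := q)) ?opprK//; exact: vf_tangent.
have oZ' A : vector_field A -> (fun q => omega q (A q) (Z q)) = fun q => A q f.
  move=> vA; rewrite funeqE => q; have tA := vf_tangent q vA; have tZ := vf_tangent q vZ.
  by rewrite omega_anti// (df_grad tA).
rewrite (oZ' _ vY) (oZ _ vX).
have -> : omega p (bracket X Y p) (Z p) = bracket X Y p f.
  by have := congr1 (fun k => k p) (oZ' _ (vB _ _ vX vY)).
rewrite (tangentN_fun mM (tv _ vY) (vf_smooth vX sf)).
rewrite (bracketC Z Y) (tensor2Nl smooth_omega (tv _ (vB _ _ vZ vY)) (tv _ vX)).
rewrite (omega_anti (tv _ vX) (tv _ (vB _ _ vZ vY))).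
have -> : bracket X Y p f = X p (fun q => Y q f) - Y p (fun q => X q f) by [].
rewrite /fundamental_form K => H; lra.
Qed.

(** Z preserves beta, so Cartan's formula leaves minus the differential of beta (Z). *)
Lemma extd_beta_Z p u : tangent p u -> extd beta p (Z p) u = - u (fun q => g q (Z q) (Z q)).
Proof.
move=> tu; have [X vX <-] := tangent_extend mM tu.
rewrite (extdE mM p smooth_beta vZ vX).
case: kZ => _ /(_ _ _ vZ vX p) ->.
have -> : bracket Z Z p = 0 by rewrite funeqE => h; rewrite /bracket subrr.
by rewrite (tensor2_0l sg (vf_tangent p vX)) /flat_form; ring.
Qed.

(** The local fact [L] says that d beta = - L_JZ omega, as beta = - omega (JZ, .) and omega is
    closed; the right side is J-invariant because both JZ and omega are compatible with J. *)
Lemma extd_beta_J p u v : tangent p u -> tangent p v ->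
  extd beta p (J p u) (J p v) = extd beta p u v.
Proof.
move=> tu tv; have [X vX <-] := tangent_extend mM tu; have [Y vY <-] := tangent_extend mM tv.
have vJX := endo_vf cJ vX; have vJY := endo_vf cJ vY; have vJZ := endo_vf cJ vZ.
have vB := vf_bracket mM.
have tf (A : vfield M) q : vector_field A -> tangent q (A q) by move=> vA; exact: vf_tangent.
have cl : closed2 omega by case: pk => -[].
have bE (A : vfield M) q : vector_field A -> g q (Z q) (A q) = - omega q (J q (Z q)) (A q).
  move=> vA; have tZ := tf _ q vZ; have tA := tf _ q vA.
  by rewrite /fundamental_form (endoK cJ)// (tensor2Nl sg)// opprK.
have L (A B : vfield M) : vector_field A -> vector_field B -> extd beta p (A p) (B p) =
    - (J p (Z p) (fun q => omega q (A q) (B q)) - omega p (bracket JZ A p) (B p)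
       - omega p (A p) (bracket JZ B p)).
  move=> vA vB'; rewrite (extdE mM p smooth_beta vA vB').
  have E C : vector_field C -> (fun q => g q (Z q) (C q)) = fun q => - omega q (J q (Z q)) (C q).
    by move=> vC; rewrite funeqE => q; exact: bE.
  rewrite /flat_form (E _ vA) (E _ vB') (bE (bracket A B) p (vB _ _ vA vB')).
  have so C D : vector_field C -> vector_field D -> smooth (fun q => omega q (C q) (D q)).
    by move=> vC vD; exact: tensor2_smooth smooth_omega vC vD.
  rewrite (tangentN_fun mM (tf _ p vA) (so _ _ vJZ vB')) (tangentN_fun mM (tf _ p vB') (so _ _ vJZ vA)).
  have := cl JZ A B vJZ vA vB' p.
  have -> : (fun q => omega q (B q) (J q (Z q))) = fun q => - omega q (J q (Z q)) (B q).
    by rewrite funeqE => q; rewrite omega_anti//; [exact: tf _ _ vJZ|exact: tf].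
  rewrite (tangentN_fun mM (tf _ p vA) (so _ _ vJZ vB')).
  rewrite (omega_anti (tf _ p vJZ) (tf _ p (vB _ _ vA vB'))).
  rewrite (bracketC JZ B) (tensor2Nl smooth_omega (tf _ p (vB _ _ vJZ vB')) (tf _ p vA)).
  rewrite (omega_anti (tf _ p vA) (tf _ p (vB _ _ vJZ vB'))); lra.
(* In N (Z, A) = 0 the terms J [Z, JA] and [Z, A] cancel by [lie_J]; what is left says that JZ
   preserves J. *)
have LJ A : vector_field A -> bracket JZ (fun q => J q (A q)) p = J p (bracket JZ A p).
  move=> vA; case: pk => _ /(_ _ _ vZ vA p) /=.
  rewrite (lie_J p vA) (endoK cJ (tf _ p (vB _ _ vZ vA))) opprK.
  by move/eqP; rewrite addrK subr_eq0 => /eqP.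
rewrite (L _ _ vJX vJY) (L _ _ vX vY) (LJ _ vX) (LJ _ vY).
have -> : (fun q => omega q (J q (X q)) (J q (Y q))) = fun q => omega q (X q) (Y q).
  by rewrite funeqE => q; rewrite omega_J//; exact: tf.
by rewrite !omega_J//; [exact: tf|exact: tf _ _ (vB _ _ vJZ vY)|exact: tf _ _ (vB _ _ vJZ vX)|exact: tf].
Qed.

Lemma smooth_curvature : smooth_tensor2 F.
Proof.
have := smooth_tensor2D mM smooth_omega
  (smooth_tensor2Z mM (smooth_cst mM (- 2^-1)) (smooth_extd mM smooth_beta)).
congr smooth_tensor2; apply: funext => p; apply: funext => u; apply: funext => v.
by rewrite mulNr.
Qed.

Lemma curvature_anti p u v : tangent p u -> tangent p v -> F p v u = - F p u v.
Proof.
move=> tu tv; rewrite /curvature_form omega_anti// (extd_anti mM smooth_beta tu tv); ring.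
Qed.

Lemma curvature_J p u v : tangent p u -> tangent p v -> F p (J p u) (J p v) = F p u v.
Proof. by move=> tu tv; rewrite /curvature_form omega_J// extd_beta_J. Qed.

Lemma curvature_skew p u v : tangent p u -> tangent p v -> F p (J p u) v = - F p u (J p v).
Proof.
move=> tu tv; have tJv := endo_tangent cJ tv; have tJu := endo_tangent cJ tu.
have := curvature_J tu tJv; rewrite (endoK cJ tv) (tensor2Nr smooth_curvature)//.
by move=> <-; rewrite opprK.
Qed.

Lemma smooth_f1 : smooth f1.
Proof.
apply: (smoothB mM sf); apply: (smoothM mM); first exact: smooth_cst.
exact: tensor2_smooth.
Qed.

(** The definition of f1 is made for this: omega (Z, .) = - df, and - d beta (Z, .) / 2 = d (g (Z,
    Z)) / 2. *)
Lemma curvature_Z p u : tangent p u -> F p (Z p) u = - u f1.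
Proof.
move=> tu; have sZZ := tensor2_smooth sg vZ vZ; rewrite /curvature_form.
rewrite (tangentB_fun mM tu sf); last by apply: (smoothM mM) => //; exact: smooth_cst.
rewrite (tangentZ_fun mM _ tu sZZ) extd_beta_Z// (df_grad tu) /fundamental_form; ring.
Qed.

(** Apply [form1_nijenhuis] to dh: the left side is 0 by integrability and the terms in d (dh)
    vanish. *)
Lemma dJ_J h p u v : smooth h -> tangent p u -> tangent p v ->
  extd (form1_endo J (dfun h)) p (J p u) v + extd (form1_endo J (dfun h)) p u (J p v) = 0.
Proof.
move=> sh tu tv; have [X vX <-] := tangent_extend mM tu; have [Y vY <-] := tangent_extend mM tv.
have sd := smooth_form1_dfun sh.
have := form1_nijenhuis mM cJ p sd vX vY.
have -> : nijenhuis J X Y p = 0 by case: pk => _; apply.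
rewrite (form1_0 p sd) !(extd_dfun mM sh); [|exact: vf_tangent|exact: vf_tangent| |].
- by lra.
- by apply: (endo_tangent cJ); exact: vf_tangent.
- by apply: (endo_tangent cJ); exact: vf_tangent.
Qed.

Lemma dJ_Z h p u : smooth h -> tangent p u ->
  extd (form1_endo J (dfun h)) p (Z p) u =
  J p u (fun q => Z q h) - u (fun q => J q (Z q) h).
Proof.
move=> sh tu; have [X vX <-] := tangent_extend mM tu.
have sd := smooth_form1_dfun sh.
rewrite (extdE mM p (smooth_form1_endo cJ sd) vZ vX) /form1_endo /dfun -lie_J//.
rewrite /bracket; ring.
Qed.

End kahler_with_killing_field.

(** * Orthonormal frames and signature *)

Section orthonormal_frames.
Context {R : realType} {M : premanifold R}.
Implicit Types (g : tensor2 M) (p : M).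

(** Frames are indexed by an arbitrary finite type with a sign function, so that adding vectors
    means passing to a sum type and reordering is a separate step. *)
Definition ortho_frame g p (I : finType) (s : I -> R) (e : I -> tvec M) : Prop :=
  [/\ forall i, tangent p (e i),
      forall u, tangent p u -> exists c : I -> R, u = \sum_i c i *: e i
    & forall i j, g p (e i) (e j) = if i == j then s i else 0].

Lemma ortho_frame_reindex g p (I I' : finType) (h : I' -> I) s e : bijective h ->
  ortho_frame g p s e -> ortho_frame g p (s \o h) (e \o h).
Proof.
move=> bh [te se ge]; split => [i|u tu|i j]; first exact: te.
- have [c ->] := se u tu; exists (c \o h).
  by rewrite (reindex h)//; exact: onW_bij.
- by rewrite /= ge (inj_eq (bij_inj bh)).
Qed.

Definition sign_upto (a n : nat) (i : 'I_n) : R := if (i < a)%N then 1 else -1.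

Lemma has_signatureP g a b :
  has_signature g a b <-> forall p, exists e, ortho_frame g p (@sign_upto a (a + b)) e.
Proof. by split => H p; have [e He] := H p; exists e. Qed.

End orthonormal_frames.

Section index_shuffles.
Variables a b c : nat.

(** [has_signature] lists the positive directions first, so c new positive ones go between the a old
    positive and the b negative ones. *)
Definition insert_mid (i : 'I_(a + c + b)) : 'I_(a + b) + 'I_c :=
  match fintype.split i with
  | inl j => match fintype.split j with inl j1 => inl (lshift b j1) | inr j2 => inr j2 end
  | inr j => inl (rshift a j)
  end.

Definition insert_end (i : 'I_(a + (b + c))) : 'I_(a + b) + 'I_c :=
  match fintype.split i with
  | inl j => inl (lshift b j)
  | inr j => match fintype.split j with inl j1 => inl (rshift a j1) | inr j2 => inr j2 end
  end.

Lemma split_lshift m n (i : 'I_m) : fintype.split (lshift n i) = inl i.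
Proof. exact: (unsplitK (inl i)). Qed.

Lemma split_rshift m n (i : 'I_n) : fintype.split (rshift m i) = inr i.
Proof. exact: (unsplitK (inr i)). Qed.

Lemma insert_mid_bij : bijective insert_mid.
Proof.
exists (fun x => match x with
  | inl j => match fintype.split j with inl j1 => lshift b (lshift c j1) | inr j2 => rshift (a + c) j2 end
  | inr j => lshift b (rshift a j) end) => [i|[i|i]]; rewrite /insert_mid.
- case: (split_ordP i) => j -> //; last by rewrite split_rshift.
  by case: (split_ordP j) => k ->; rewrite ?split_lshift.
- by case: (split_ordP i) => j ->; rewrite !(split_lshift, split_rshift).
- by rewrite !(split_lshift, split_rshift).
Qed.

Lemma insert_end_bij : bijective insert_end.
Proof.
exists (fun x => match x with
  | inl j => match fintype.split j with inl j1 => lshift (b + c) j1 | inr j2 => rshift a (lshift c j2) end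
  | inr j => rshift a (rshift b j) end) => [i|[i|i]]; rewrite /insert_end.
- case: (split_ordP i) => j -> //; first by rewrite split_lshift.
  by case: (split_ordP j) => k ->; rewrite ?split_rshift.
- by case: (split_ordP i) => j ->; rewrite !(split_lshift, split_rshift).
- by rewrite !(split_lshift, split_rshift).
Qed.

Variable R : realType.

Lemma sign_insert_mid : @sign_upto R (a + c) (a + c + b) =
  (fun x => match x with inl i => sign_upto a i | inr _ => 1 end) \o insert_mid.
Proof.
apply: funext => i; rewrite /insert_mid /sign_upto /=; case: (split_ordP i) => j _ /=.
  by case: (split_ordP j) => k _ //=; rewrite ltn_ord.
by rewrite ltnNge leq_addr.
Qed.

Lemma sign_insert_end : @sign_upto R a (a + (b + c)) =
  (fun x => match x with inl i => sign_upto a i | inr _ => -1 end) \o insert_end.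
Proof.
apply: funext => i; rewrite /insert_end /sign_upto /=; case: splitP => j _ /=.
  by rewrite ltn_ord.
by case: (split_ordP j) => k _ //=; rewrite ltnNge leq_addr.
Qed.

End index_shuffles.

(** * The conical metric *)

Section homothetic_gradient_field.
Context {R : realType} {M : premanifold R} (mM : manifold M).
Variable xi : vfield M.
Hypothesis vxi : vector_field xi.
Implicit Types (p : M) (X Y V : vfield M).

(** Koszul's formula says that 2 g (D X xi, V) is (L_xi g) (X, V) plus the exterior derivative of g
    (xi, .) on (X, V). The first is 2 g (X, V) and the second is 0. *)
Lemma conical_criterion (g : tensor2 M) (k : M -> R) : pseudo_riemannian g ->
  (forall p, g p (xi p) (xi p) != 0) -> smooth k ->
  (forall p v, tangent p v -> g p (xi p) v = v k) ->
  (forall X Y p, vector_field X -> vector_field Y -> xi p (fun q => g q (X q) (Y q)) =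
     2 * g p (X p) (Y p) + g p (bracket xi X p) (Y p) + g p (X p) (bracket xi Y p)) ->
  conical g xi.
Proof.
move=> pg xi0 sk gk lie; split => //; have [D HD] := koszul_exists pg.
exists D; first exact: koszul_levi_civita.
have [_ sg gs gnd] := pg; have vB := vf_bracket mM.
move=> X vX p; have [vD DE] := HD X xi vX vxi.
have tv (A : vfield M) q : vector_field A -> tangent q (A q) by move=> vA; exact: vf_tangent.
apply: (nondeg_eq_vf mM sg gnd (p := p)); [exact: tv|exact: tv|] => V vV.
rewrite DE// /koszul (lie _ _ _ vX vV).
have E (A : vfield M) : vector_field A -> (fun q => g q (xi q) (A q)) = fun q => A q k.
  by move=> vA; rewrite funeqE => q; apply: gk; exact: tv.
have E' (A : vfield M) : vector_field A -> (fun q => g q (A q) (xi q)) = fun q => A q k.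
  by move=> vA; rewrite -(E _ vA) funeqE => q; apply: gs; exact: tv.
rewrite (E _ vV) (E' _ vX).
have -> : g p (bracket X V p) (xi p) = bracket X V p k.
  exact: (congr1 (fun h => h p) (E' _ (vB _ _ vX vV))).
rewrite (bracketC xi X) (tensor2Nl sg (tv _ _ (vB _ _ vxi vX)) (tv _ _ vV)).
rewrite (gs p (X p) (bracket xi V p) (tv _ _ vX) (tv _ _ (vB _ _ vxi vV))) /bracket; lra.
Qed.

Definition lie_invariant1 (a : form1 M) := forall X p, vector_field X ->
  xi p (fun q => a q (X q)) = a p (bracket xi X p).

Definition lie_invariant2 (b : tensor2 M) := forall X Y p, vector_field X -> vector_field Y ->
  xi p (fun q => b q (X q) (Y q)) = b p (bracket xi X p) (Y p) + b p (X p) (bracket xi Y p).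

Let txi p : tangent p (xi p). Proof. exact: vf_tangent. Qed.

Lemma lie_invariant2_prod a a' : smooth_form1 a -> smooth_form1 a' ->
  lie_invariant1 a -> lie_invariant1 a' -> lie_invariant2 (fun p u v => a p u * a' p v).
Proof.
move=> sa sa' ia ia' X Y p vX vY.
by rewrite (tangent_mul (txi p) (form1_smooth sa vX) (form1_smooth sa' vY)) ia// ia'.
Qed.

Lemma lie_invariant2Z h b : smooth h -> smooth_tensor2 b -> (forall p, xi p h = 0) ->
  lie_invariant2 b -> lie_invariant2 (fun p u v => h p * b p u v).
Proof.
move=> sh sb h0 ib X Y p vX vY.
rewrite (tangent_mul (txi p) sh (tensor2_smooth sb vX vY)) h0 ib//; ring.
Qed.

Lemma lie_invariant2D b b' : smooth_tensor2 b -> smooth_tensor2 b' ->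
  lie_invariant2 b -> lie_invariant2 b' -> lie_invariant2 (fun p u v => b p u v + b' p u v).
Proof.
move=> sb sb' ib ib' X Y p vX vY.
rewrite (tangentD_fun (txi p) (tensor2_smooth sb vX vY) (tensor2_smooth sb' vX vY)) ib// ib'//; ring.
Qed.

Lemma lie_invariant1_dfun h : smooth h -> (exists c : R, forall p, xi p h = c) ->
  lie_invariant1 (dfun h).
Proof.
move=> sh [c hc] X p vX; rewrite /dfun /bracket.
have -> : (fun q => xi q h) = fun=> c by rewrite funeqE.
by rewrite (tangent_cst mM c (vf_tangent p vX)) subr0.
Qed.

Section pullback.
Context {N : premanifold R} (mN : manifold N) (phi : M -> N).
Hypothesis sphi : forall p, smooth_map_at phi p.
Hypothesis xi0 : forall p, push phi (xi p) = 0.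

Lemma push_zero_fun k p : smooth k -> xi p (k \o phi) = 0.
Proof. by move=> sk; rewrite -(push_smoothE phi (xi p) sk) xi0. Qed.

Let bracket_pull k X p : smooth k -> vector_field X ->
  xi p (fun q => X q (k \o phi)) = bracket xi X p (k \o phi).
Proof.
move=> sk vX; rewrite /bracket.
have -> : (fun q => xi q (k \o phi)) = fun=> 0 by rewrite funeqE => q; exact: push_zero_fun.
by rewrite (tangent_cst mM 0 (vf_tangent p vX)) subr0.
Qed.

(** Locally a pulled-back form is a sum of (h o phi) d (k o phi), and xi annihilates all these
    functions. *)
Lemma lie_invariant1_pull a : smooth_form1 a -> lie_invariant1 (pull1 phi a).
Proof.
move=> sa X p vX; have [h [k [sh sk aE]]] := form1_local mN (phi p) sa.
have sh' i := smooth_comp mM mN sphi (sh i); have sk' i := smooth_comp mM mN sphi (sk i).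
have pE := pull1_local mM mN sphi sh sk aE.
have sm i : smooth (fun q => (h i \o phi) q * X q (k i \o phi)).
  by apply: (smoothM mM) => //; exact: vf_smooth.
rewrite (@tangent_near _ _ mM p (xi p) _ (fun q => \sum_i (h i \o phi) q * X q (k i \o phi))).
- rewrite (tangent_sum_fun mM _ (txi p) sm) (nbhs_singleton pE); last exact: vf_tangent (vf_bracket mM vxi vX).
  apply: eq_bigr => i _; rewrite (tangent_mul (txi p) (sh' i) (vf_smooth vX (sk' i))).
  by rewrite push_zero_fun// mul0r add0r bracket_pull.
- exact: txi.
- by apply: form1_smooth vX; exact: smooth_pull1.
- exact: smooth_sum.
- by apply: filterS pE => q; apply; exact: vf_tangent.
Qed.

Lemma lie_invariant2_pull b : smooth_tensor2 b -> lie_invariant2 (pull2 phi b).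
Proof.
move=> sb X Y p vX vY; have [h [k [sh sk bE]]] := tensor2_local mN (phi p) sb.
have sh' i j := smooth_comp mM mN sphi (sh i j); have sk' i := smooth_comp mM mN sphi (sk i).
have pt q u : tangent q u -> tangent (phi q) (push phi u) by exact: push_tangent.
have pE : \forall q \near p, forall u v, tangent q u -> tangent q v -> pull2 phi b q u v =
    \sum_i \sum_j (h i j \o phi) q * (u (k i \o phi) * v (k j \o phi)).
  apply: filterS (near_map sphi bE) => q bq u v tu tv; rewrite /pull2 bq; [|exact: pt|exact: pt].
  by apply: eq_bigr => i _; apply: eq_bigr => j _; rewrite !push_smoothE.
have sm i j : smooth (fun q => (h i j \o phi) q * (X q (k i \o phi) * Y q (k j \o phi))).
  by apply: (smoothM mM) => //; apply: (smoothM mM); exact: vf_smooth.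
have sms i : smooth (fun q => \sum_j (h i j \o phi) q * (X q (k i \o phi) * Y q (k j \o phi))).
  exact: smooth_sum.
have tX := vf_tangent p vX; have tY := vf_tangent p vY.
have tbX := vf_tangent p (vf_bracket mM vxi vX); have tbY := vf_tangent p (vf_bracket mM vxi vY).
rewrite (@tangent_near _ _ mM p (xi p) _ (fun q => \sum_i \sum_j (h i j \o phi) q * (X q (k i \o phi) * Y q (k j \o phi)))).
- rewrite (tangent_sum_fun mM _ (txi p) sms) !(nbhs_singleton pE)// -big_split; apply: eq_bigr => i _ /=.
  rewrite (tangent_sum_fun mM _ (txi p) (sm i)) -big_split; apply: eq_bigr => j _ /=.
  have sX := vf_smooth vX (sk' i); have sY := vf_smooth vY (sk' j).
  rewrite (tangent_mul (txi p) (sh' i j) (smoothM mM sX sY)) (tangent_mul (txi p) sX sY).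
  by rewrite push_zero_fun// !bracket_pull//=; ring.
- exact: txi.
- by apply: tensor2_smooth => //; exact: smooth_pull2.
- exact: smooth_sum.
- by apply: filterS pE => q; apply; exact: vf_tangent.
Qed.

End pullback.
End homothetic_gradient_field.

(** * The cone over the circle bundle *)

Section conification.
Context {R : realType} {M P : premanifold R}.
Variables (g : tensor2 M) (J : endo M) (Z : vfield M) (f : M -> R).
Variables (pr : P -> M) (act : R -> P -> P) (eta : form1 P).
Hypothesis pk : pseudo_kahler g J.
Hypothesis kZ : killing g Z.
Hypothesis Z0 : forall x, g x (Z x) (Z x) != 0.
Hypothesis sf : smooth f.
Hypothesis fE : forall x u, tangent x u -> dfun f x u = - fundamental_form g J x (Z x) u.
Hypothesis f0 : forall x, f x != 0.
Hypothesis f10 : forall x, shifted_moment g Z f x != 0.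
Hypothesis bundle : principal_circle_bundle pr act.
Hypothesis conn : principal_connection act eta.
Hypothesis curv : forall p u v, tangent p u -> tangent p v ->
  extd eta p u v = pull2 pr (curvature_form g J Z) p u v.

Local Notation MP := (prodR P).
Local Notation f1 := (shifted_moment g Z f).
Local Notation beta := (flat_form g Z).
Local Notation F := (curvature_form g J Z).
Local Notation XP := (fundamental_vf act).
Local Notation omega := (fundamental_form g J).
Local Notation xi := (@partial_t R P).

Definition cone_proj : MP -> M := fun y => pr y.1.
Local Notation hpr := cone_proj.
Definition cone_eta : form1 MP := pull1 (fun y : MP => y.1 : P) eta.
Local Notation etah := cone_eta.
Definition cone_time : MP -> R := fun y => y.2.
Local Notation tt := cone_time.

(** This and the neighbouring definitions copy the objects bound in the final statement, so that
    results about them apply there by conversion. *)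
Definition cone_metric : tensor2 MP := fun y u v =>
  expR (2 * tt y) *
  (2 / f1 (hpr y) * (etah y u * etah y v) + pull2 hpr g y u v
   + 2 * f (hpr y) * (dfun tt y u * dfun tt y v)
   + (pull1 hpr (dfun f) y u * dfun tt y v + dfun tt y u * pull1 hpr (dfun f) y v)).
Local Notation gh := cone_metric.

Definition cone_primitive : form1 MP := fun y u =>
  expR (2 * tt y) * (etah y u + 2^-1 * pull1 hpr beta y u).
Local Notation theta := cone_primitive.
Local Notation omegah := (extd theta).
Local Notation Jh := (raise gh omegah).

Let mM : manifold M. Proof. exact: pk_manifold pk. Qed.
Let mP : manifold P. Proof. by case: bundle. Qed.
Let mMP : manifold MP. Proof. exact: prodR_manifold. Qed.
Let cJ : almost_complex J. Proof. exact: pk_ac pk. Qed.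
Let sg : smooth_tensor2 g. Proof. exact: pk_tensor pk. Qed.
Let vZ : vector_field Z. Proof. exact: killing_vf kZ. Qed.
Let sfst (y : MP) : smooth_map_at (fun y : MP => y.1 : P) y. Proof. exact: smooth_map_at_fst. Qed.
Let seta : smooth_form1 eta. Proof. by case: conn. Qed.

Lemma cone_proj_smooth y : smooth_map_at hpr y.
Proof. exact: (smooth_map_at_comp (sfst y) (bundle_proj_smooth bundle y.1)). Qed.
Let shpr := cone_proj_smooth.

Lemma cone_projE y u : tangent y u -> push hpr u = push pr (push (fun y : MP => y.1 : P) u).
Proof. by move=> tu; rewrite (push_push _ _ mP mM (bundle_proj_smooth bundle)). Qed.

Lemma smooth_cone_time : smooth tt. Proof. exact: smooth_snd. Qed.
Let stt := smooth_cone_time.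

Lemma smooth_cone_eta : smooth_form1 etah. Proof. exact: smooth_pull1. Qed.
Let setah := smooth_cone_eta.

Lemma smooth_comp_proj h : smooth h -> smooth (h \o hpr).
Proof. exact: smooth_comp. Qed.

Lemma tangent_push_proj y u : tangent y u -> tangent (hpr y) (push hpr u).
Proof. exact: push_tangent. Qed.
Let tpush := tangent_push_proj.

(** The difference of the two [P]-components projects to 0, so it is a multiple of the fundamental
    field, and [eta] shows that the multiple is 0. *)
Lemma tangent_split_inj y u u' : tangent y u -> tangent y u' -> push hpr u = push hpr u' ->
  etah y u = etah y u' -> u tt = u' tt -> u = u'.
Proof.
move=> tu tu' hE eE tE.
rewrite (tangent_prodR mP tu) (tangent_prodR mP tu').
congr (push _ _ + _ *: _); last exact: tE.
have t1 := push_tangent mMP mP sfst tu; have t2 := push_tangent mMP mP sfst tu'.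
apply/eqP; rewrite -subr_eq0; apply/eqP; set d := _ - _.
have td : tangent y.1 d by exact: tangentB.
have pd : push pr d = 0.
  rewrite /d -scaleN1r addrC push_comb scaleN1r addrC.
  by rewrite -(cone_projE tu) -(cone_projE tu') hE subrr.
have [a dE] := ker_proj bundle td pd.
have ed : eta y.1 d = 0.
  by rewrite /d (form1B seta t1 t2); move: eE; rewrite /cone_eta /pull1 => ->; rewrite subrr.
have tXP := vf_tangent y.1 (vector_field_fundamental bundle).
move: ed; rewrite dE (form1Z seta _ tXP); case: conn => _ _ ->.
by rewrite mulr1 => ->; rewrite scale0r.
Qed.

Lemma tangent_split_exists y A a c : tangent (hpr y) A -> exists u,
  [/\ tangent y u, push hpr u = A, etah y u = a & u tt = c].
Proof.
move=> tA; have [u0 tu0 u0A] := lift_exists bundle tA.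
have tXP := vf_tangent y.1 (vector_field_fundamental bundle).
(* A lift of [A] is corrected along the fundamental field, which changes the value of [eta] but not
   the projection. *)
pose u1 := (a - eta y.1 u0) *: XP y.1 + u0.
have tu1 : tangent y.1 u1 by apply: tangent_comb.
have ts := push_tangent mP mMP (smooth_map_at_slice mP y.2) tu1.
have tp := tangent_partial_t mP y.
have ts' : tangent y (push (@slice R P y.2) u1) by move: ts; case: (y).
pose u : tvec MP := c *: xi y + push (@slice R P y.2) u1; exists u.
have tu : tangent y u by exact: tangent_comb.
have fu : push (fun y : MP => y.1 : P) u = u1.
  rewrite /u push_comb (push_fst_partial_t mP) scaler0 add0r.
  exact: (push_fst_slice mP y.2 tu1).
split => //.
- rewrite (cone_projE tu) fu /u1 push_comb (push_proj_fundamental bundle) scaler0 add0r.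
  exact: u0A.
- rewrite /cone_eta /pull1 fu /u1 (form1_comb seta)//; case: conn => _ _ ->.
  by rewrite mulr1 subrK.
- rewrite /u tvecE_comb (slice_snd mP y.2 tu1).
  by rewrite (partial_t_snd mP) mulr1 addr0.
Qed.

Lemma smooth_exp_time : smooth (fun y : MP => expR (2 * tt y)).
Proof.
apply/(smoothP mMP) => z; apply: (smooth_near_expR mMP); apply: (smooth_nearM mMP).
  exact: smooth_near_cst.
exact: smooth_near_snd.
Qed.

Lemma tangent_exp_time y u : tangent y u ->
  u (fun y => expR (2 * tt y)) = 2 * expR (2 * tt y) * u tt.
Proof.
move=> tu; have sE := smooth_exp_time.
rewrite {1}(tangent_prodR mP tu) tvecDE tvecZE push_smoothE//.
have t1 := push_tangent mMP mP sfst tu.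
have -> : ((fun y : MP => expR (2 * tt y)) \o @slice R P y.2) = fun=> expR (2 * y.2) by [].
rewrite (tangent_cst mP _ t1) add0r mulrC; congr (_ * _).
rewrite /partial_t restrict_smoothE// derive1E.
have d2 : is_derive y.2 1 (fun t : R => 2 * t) 2.
  have := @is_deriveZ _ _ _ id 2 y.2 1 1 (is_derive_id _ _).
  by rewrite /GRing.scale /= mulr1.
have := @is_derive1_comp R expR (fun t => 2 * t) y.2 _ _ (is_derive_expR _) d2.
by move=> [_ ]; rewrite mulrC => <-.
Qed.

Lemma smooth_inv_f1 : smooth (fun x => 2 / f1 x).
Proof.
apply: (smoothM mM); first exact: smooth_cst.
apply/(smoothP mM) => x; apply: (smooth_near_inv mM (f10 x)).
exact: ((smoothP mM f1).1 (smooth_f1 pk kZ sf) x).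
Qed.

Let sda : smooth_form1 (pull1 hpr (dfun f)).
Proof. by apply: smooth_pull1 => //; exact: smooth_form1_dfun. Qed.
Let sdt : smooth_form1 (dfun tt). Proof. exact: smooth_form1_dfun. Qed.

(** Without the factor exp (2 t) the tensor is invariant under xi; the rescaling of the metric comes
    from that factor alone. *)
Definition cone_metric0 : tensor2 MP := fun y u v =>
  2 / f1 (hpr y) * (etah y u * etah y v) + pull2 hpr g y u v
   + 2 * f (hpr y) * (dfun tt y u * dfun tt y v)
   + (pull1 hpr (dfun f) y u * dfun tt y v + dfun tt y u * pull1 hpr (dfun f) y v).

Let s2f : smooth (fun y => 2 * f (hpr y)).
Proof. by apply: (smoothM mMP); [exact: smooth_cst|exact: smooth_comp_proj]. Qed.
Let s2f1 : smooth (fun y => 2 / f1 (hpr y)).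
Proof. exact: (smooth_comp_proj smooth_inv_f1). Qed.

Lemma smooth_cone_metric0 : smooth_tensor2 cone_metric0.
Proof.
apply: (smooth_tensor2D mMP); last first.
  by apply: (smooth_tensor2D mMP); exact: smooth_tensor2_prod.
apply: (smooth_tensor2D mMP); last first.
  by apply: (smooth_tensor2Z mMP s2f); exact: smooth_tensor2_prod.
apply: (smooth_tensor2D mMP); last exact: smooth_pull2.
by apply: (smooth_tensor2Z mMP s2f1); exact: smooth_tensor2_prod.
Qed.

Lemma smooth_cone_metric : smooth_tensor2 gh.
Proof. exact: (smooth_tensor2Z mMP smooth_exp_time smooth_cone_metric0). Qed.
Let sgh := smooth_cone_metric.

Lemma smooth_cone_primitive : smooth_form1 theta.
Proof.
apply: (smooth_form1Z mMP smooth_exp_time); apply: (smooth_form1D mMP) => //.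
apply: (smooth_form1Z mMP (smooth_cst mMP _)); apply: smooth_pull1 => //.
exact: smooth_beta pk kZ.
Qed.
Let sth := smooth_cone_primitive.

Lemma pull_df y u : tangent y u -> pull1 hpr (dfun f) y u = - g (hpr y) (J (hpr y) (Z (hpr y))) (push hpr u).
Proof. by move=> tu; exact: (df_grad fE (tpush tu)). Qed.

Lemma extd_cone_eta y u v : tangent y u -> tangent y v ->
  extd etah y u v = F (hpr y) (push hpr u) (push hpr v).
Proof.
move=> tu tv; rewrite (extd_pull1 mMP mP sfst)// curv; [|exact: push_tangent|exact: push_tangent].
by rewrite /pull2 -(cone_projE tu) -(cone_projE tv).
Qed.

(** In d theta the factor exp (2 t) contributes 2 dt ^ (eta + beta / 2), and the rest is d eta + d
    beta / 2 = omega, by the prescribed curvature. *)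
Lemma cone_formE y u v : tangent y u -> tangent y v ->
  omegah y u v = expR (2 * tt y) * (omega (hpr y) (push hpr u) (push hpr v)
    + 2 * (u tt * etah y v - v tt * etah y u)
    + (u tt * beta (hpr y) (push hpr v) - v tt * beta (hpr y) (push hpr u))).
Proof.
move=> tu tv; have sb := smooth_beta pk kZ; have sbh := smooth_pull1 mMP mM shpr sb.
have s2 := smooth_cst mMP (2^-1 : R).
have sbh2 := smooth_form1Z mMP s2 sbh.
rewrite (extdZ mMP smooth_exp_time (smooth_form1D mMP setah sbh2) tu tv).
rewrite (extdD mMP setah sbh2 tu tv) (extdZ mMP s2 sbh tu tv).
rewrite (tangent_cst mMP _ tu) (tangent_cst mMP _ tv) (tangent_exp_time tu) (tangent_exp_time tv).
rewrite (extd_pull1 mMP mM shpr sb tu tv) extd_cone_eta// /curvature_form /pull1.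
by field.
Qed.

Lemma cone_metric_sym y u v : tangent y u -> tangent y v -> gh y u v = gh y v u.
Proof.
move=> tu tv; rewrite /cone_metric /pull2 (pk_sym pk (tpush tu) (tpush tv)); ring.
Qed.

(** Test vectors with components (0, 1, 0), (B, 0, 0) and (0, 0, 1) show in turn that a = 0, that A
    = c JZ, and that 2 f1 c = 0. *)
Lemma cone_metric_nondeg y u : tangent y u -> (forall v, tangent y v -> gh y u v = 0) -> u = 0.
Proof.
move=> tu H; set x := hpr y; have tZ := vf_tangent x vZ; have tJZ := endo_tangent cJ tZ.
have tA := tpush tu.
have {}H v : tangent y v -> cone_metric0 y u v = 0.
  move=> tv; have := H v tv; rewrite /cone_metric => /eqP.
  by rewrite mulf_eq0 gt_eqF ?expR_gt0//= => /eqP.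
have a0 : etah y u = 0.
  have [v [tv vA va vc]] := tangent_split_exists (1 : R) 0 (tangent0 (hpr y)).
  have := H v tv; rewrite /cone_metric0 /pull2 /pull1 /dfun vA va vc (tensor2_0r sg tA) !mulr0 !addr0 mulr1.
  move/eqP; rewrite !mulf_eq0 invr_eq0 (negbTE (f10 _)) /=; have -> : (2 == 0 :> R) = false by rewrite pnatr_eq0.
  by move/eqP.
have Bc B : tangent x B -> g x (push hpr u - u tt *: J x (Z x)) B = 0.
  move=> tB; have [v [tv vA va vc]] := @tangent_split_exists y B 0 0 tB.
  have := H v tv; rewrite /cone_metric0 /pull2 (pull_df tu) (pull_df tv) /dfun vA va vc.
  rewrite (tensor2Bl sg tA (tangentZ _ tJZ) tB) (tensor2Zl sg _ tJZ tB) => H'; rewrite -[RHS]H'; ring.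
have AE : push hpr u = u tt *: J x (Z x).
  apply/eqP; rewrite -subr_eq0; apply/eqP; apply: (pk_nondeg pk (p := x)) => //.
  by apply: tangentB => //; exact: tangentZ.
have c0 : u tt = 0.
  have [v [tv vA va vc]] := @tangent_split_exists y 0 0 1 (tangent0 (hpr y)).
  have := H v tv; rewrite /cone_metric0 /pull2 (pull_df tu) (pull_df tv) /dfun vA va vc AE.
  rewrite !(tensor2_0r sg)//; last exact: tangentZ.
  rewrite (tensor2Zr sg _ tJZ tJZ) (pk_isometry pk tZ tZ) => H'.
  have : 2 * f1 x * u tt = 0 by rewrite /shifted_moment -[RHS]H'; field; exact: f10.
  move/eqP; rewrite !mulf_eq0 (negbTE (f10 _)) orbF; have -> : (2 == 0 :> R) = false by rewrite pnatr_eq0.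
  by move/eqP.
apply: (tangent_split_inj tu (tangent0 y)).
- by rewrite push0 AE c0 scale0r.
- by rewrite a0 (form1_0 y setah).
- by rewrite c0.
Qed.

Lemma cone_pseudo_riemannian : pseudo_riemannian gh.
Proof.
split => //; first by move=> p u v; exact: cone_metric_sym.
by move=> p u; exact: cone_metric_nondeg.
Qed.

Lemma metric_JZZ x : g x (J x (Z x)) (Z x) = 0.
Proof.
have tZ := vf_tangent x vZ; have tJZ := endo_tangent cJ tZ.
have := pk_skew pk tZ tZ; rewrite (pk_sym pk tJZ tZ); lra.
Qed.

(** The components of w solve gh (w, .) = omegah (u, .). The eta-coefficient gives eta w = f1 c, the
    M-coefficient gives A' = c' JZ + c Z + J A, and the dt-coefficient then reads 2 f1 c' - g (Z, A)
    = - 2 a - g (Z, A). *)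
Lemma cone_J_exists y u : tangent y u -> exists w,
  [/\ tangent y w,
      push hpr w = (w tt *: J (hpr y) (Z (hpr y)) + u tt *: Z (hpr y)) + J (hpr y) (push hpr u),
      etah y w = f1 (hpr y) * u tt & w tt = - (etah y u / f1 (hpr y))] /\
  forall v, tangent y v -> gh y w v = omegah y u v.
Proof.
move=> tu; set x := hpr y; have tA := tpush tu.
have tZ := vf_tangent x vZ; have tJZ := endo_tangent cJ tZ; have tJA := endo_tangent cJ tA.
set m := - (etah y u / f1 x).
have tZZ : tangent x (m *: J x (Z x) + u tt *: Z x) by apply: tangent_comb => //; exact: tangentZ.
have [w [tw wA wa wc]] := @tangent_split_exists y _ (f1 x * u tt) m (tangentD tZZ tJA).
exists w; split; first by rewrite wc.
move=> v tv; have tB := tpush tv.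
rewrite (cone_formE tu tv) /cone_metric /pull2 (pull_df tw) (pull_df tv) /dfun wA wa wc.
have [tZJ tuZ] := (tangentZ m tJZ, tangentZ (u tt) tZ).
rewrite (tensor2Dl sg tZZ tJA tB) (tensor2Dl sg tZJ tuZ tB) !(tensor2Zl sg)//.
rewrite (tensor2Dr sg tZZ tJA tJZ) (tensor2Dr sg tZJ tuZ tJZ) !(tensor2Zr sg)//.
rewrite !(pk_isometry pk)// metric_JZZ /fundamental_form /flat_form /shifted_moment -/x.
rewrite -[_ - _]/(f1 x) /m; have f1E := f10 x.
have -> : f x = f1 x + 2^-1 * g x (Z x) (Z x) by rewrite /shifted_moment subrK.
by field.
Qed.

Lemma cone_J_spec y u : tangent y u -> tangent y (Jh y u) /\
  forall v, tangent y v -> gh y (Jh y u) v = omegah y u v.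
Proof.
move=> tu; have [w [[tw _ _ _] wE]] := cone_J_exists tu.
exact: (@xgetPex _ 0 [set x : tvec MP | tangent y x /\ forall v, tangent y v -> gh y x v = omegah y u v]
  (ex_intro _ w (conj tw wE))).
Qed.

Lemma cone_J_tangent y u : tangent y u -> tangent y (Jh y u).
Proof. by case/cone_J_spec. Qed.
Let tJh := cone_J_tangent.

Lemma cone_J_split y u : tangent y u ->
  [/\ push hpr (Jh y u) = ((Jh y u) tt *: J (hpr y) (Z (hpr y)) + u tt *: Z (hpr y)) + J (hpr y) (push hpr u),
      etah y (Jh y u) = f1 (hpr y) * u tt & (Jh y u) tt = - (etah y u / f1 (hpr y))].
Proof.
move=> tu; have [tJ JE] := cone_J_spec tu; have [w [[tw wA wa wc] wE]] := cone_J_exists tu.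
have -> : Jh y u = w.
  apply: (nondeg_eq sgh cone_metric_nondeg tJ tw) => v tv.
  by rewrite JE// wE.
by [].
Qed.

Lemma cone_J_time y u : tangent y u -> f1 (hpr y) * (Jh y u) tt = - etah y u.
Proof. by move=> /cone_J_split[_ _ ->]; rewrite mulrN mulrC divfK//; exact: f10. Qed.

Lemma cone_JK y u : tangent y u -> Jh y (Jh y u) = - u.
Proof.
move=> tu; have [hE eE tE] := cone_J_split tu; have tJu := tJh tu.
have [hE' eE' tE'] := cone_J_split tJu; set x := hpr y.
have tA := tpush tu; have tZ := vf_tangent x vZ; have tJZ := endo_tangent cJ tZ.
have tt' : (Jh y (Jh y u)) tt = - u tt.
  by rewrite tE' eE mulrAC divff ?mul1r//; exact: f10.
apply: (tangent_split_inj (tJh tJu) (tangentN tu)).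
- rewrite hE' tt' hE -/x.
  have tJA := endo_tangent cJ tA; have t1 := tangentZ ((Jh y u) tt) tJZ; have t2 := tangentZ (u tt) tZ.
  rewrite (endoD cJ (tangentD t1 t2) tJA) (endoD cJ t1 t2) !(endoZ cJ)// !(endoK cJ)//.
  rewrite -[- u]scaleN1r pushZ scaleN1r; apply: funext => h.
  by rewrite !(tvecDE, tvecZE, tvecNE); ring.
- by rewrite eE' tE mulrN mulrC divfK ?(form1N setah tu)//; exact: f10.
- by rewrite tt'.
Qed.

Lemma cone_J_almost_complex : almost_complex Jh.
Proof.
split; last by move=> y u; exact: cone_JK.
split => [y u|y r u v tu tv|X vX]; first exact: tJh.
- have tc := tangent_comb r tu tv; have tJu := tJh tu; have tJv := tJh tv.
  apply: (nondeg_eq sgh cone_metric_nondeg (tJh tc) (tangent_comb r tJu tJv)) => w tw.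
  rewrite (tensor2_combl sgh)// !(cone_J_spec _).2//.
  exact: (tensor2_combl (smooth_extd mMP sth)).
(* Smoothness is not visible from the pointwise choice in [raise]: the field Jh X is recognised as
   the one dual to the one-form omegah (X, .). *)
- have sa : smooth_form1 (fun y v => omegah y (X y) v).
    have se := smooth_extd mMP sth.
    split => [p r u v tu tv|Y vY]; last exact: (tensor2_smooth se).
    by rewrite (tensor2_combr se)//; exact: vf_tangent.
  have [Y vY YE] := musical mMP sgh cone_metric_nondeg sa.
  suff -> : (fun p => Jh p (X p)) = Y by [].
  apply: funext => p; have tX := vf_tangent p vX.
  apply: (nondeg_eq sgh cone_metric_nondeg (tJh tX) (vf_tangent p vY)) => v tv.
  by rewrite YE// (cone_J_spec tX).2.
Qed.
Let cJh := cone_J_almost_complex.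

Lemma cone_J_skew y u v : tangent y u -> tangent y v -> gh y (Jh y u) v = - gh y u (Jh y v).
Proof.
move=> tu tv; rewrite (cone_J_spec tu).2// (extd_anti mMP sth tv tu).
by rewrite -(cone_J_spec tv).2// cone_metric_sym//; exact: tJh.
Qed.

Lemma cone_closed : closed2 (fundamental_form gh Jh).
Proof.
move=> X Y V vX vY vV p; have vB := vf_bracket mMP.
have E (A B : vfield MP) : vector_field A -> vector_field B ->
    (fun q => fundamental_form gh Jh q (A q) (B q)) = fun q => omegah q (A q) (B q).
  move=> vA vB'; apply: funext => q.
  by rewrite /fundamental_form (cone_J_spec (vf_tangent q vA)).2//; exact: vf_tangent.
rewrite (E _ _ vY vV) (E _ _ vV vX) (E _ _ vX vY).
have E' (A B : vfield MP) : vector_field A -> vector_field B ->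
    fundamental_form gh Jh p (A p) (B p) = omegah p (A p) (B p).
  by move=> vA vB'; exact: (congr1 (fun h => h p) (E _ _ vA vB')).
rewrite (E' _ _ (vB _ _ vX vY) vV) (E' _ _ (vB _ _ vY vV) vX) (E' _ _ (vB _ _ vV vX) vY).
exact: (closed_extd mMP sth vX vY vV p).
Qed.

(** * Vanishing of the Nijenhuis tensor of the cone *)

Section integrability.
Variables (y : MP).
Local Notation x := (hpr y).
Let tZ : tangent x (Z x). Proof. exact: vf_tangent. Qed.
Let tJZ : tangent x (J x (Z x)). Proof. exact: (endo_tangent cJ). Qed.
Let tJ u : tangent x u -> tangent x (J x u). Proof. exact: (endo_tangent cJ). Qed.
Let sF : smooth_tensor2 F. Proof. exact: (smooth_curvature pk kZ). Qed.

Lemma tensor2_cone_J (b : tensor2 M) u B : smooth_tensor2 b -> tangent y u -> tangent x B ->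
  b x (push hpr (Jh y u)) B =
    (Jh y u) tt * b x (J x (Z x)) B + u tt * b x (Z x) B + b x (J x (push hpr u)) B.
Proof.
move=> sb tu tB; have [-> _ _] := cone_J_split tu; have tA := tpush tu.
have [tZJ tuZ] := (tangentZ ((Jh y u) tt) tJZ, tangentZ (u tt) tZ).
by rewrite (tensor2Dl sb (tangentD tZJ tuZ) (tJ tA) tB) (tensor2Dl sb tZJ tuZ tB) !(tensor2Zl sb).
Qed.

Lemma fun_cone_J u h : tangent y u -> push hpr (Jh y u) h =
    (Jh y u) tt * J x (Z x) h + u tt * Z x h + J x (push hpr u) h.
Proof. by move=> tu; have [-> _ _] := cone_J_split tu. Qed.

Lemma Z_f1 : Z x f1 = 0.
Proof.
have := curvature_Z pk kZ sf fE tZ; have := curvature_anti pk kZ tZ tZ; lra.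
Qed.

Lemma curvature_JZ B : tangent x B -> F x (J x (Z x)) B = J x B f1.
Proof.
move=> tB; rewrite (curvature_skew pk kZ sf fE tZ tB) (curvature_Z pk kZ sf fE (tJ tB)); ring.
Qed.

Lemma curvature_cone_J u B : tangent y u -> tangent x B ->
  F x (push hpr (Jh y u)) B =
    (Jh y u) tt * J x B f1 - u tt * B f1 + F x (J x (push hpr u)) B.
Proof.
move=> tu tB; rewrite (tensor2_cone_J sF tu tB) curvature_JZ// (curvature_Z pk kZ sf fE tB); ring.
Qed.

(** This is dt o Jh. By [cone_J_time], eta = - f1 mu, so its exterior derivative follows from the
    curvature. *)
Let mu : form1 MP := form1_endo Jh (dfun tt).
Let smu : smooth_form1 mu. Proof. exact: (smooth_form1_endo cJh). Qed.

(** Differentiate eta = - f1 mu and use d eta = F. The factor f1 is kept on the left to avoid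
    divisions. *)
Lemma extd_mu u v : tangent y u -> tangent y v ->
  f1 x * extd mu y u v = push hpr v f1 * (Jh y u) tt - push hpr u f1 * (Jh y v) tt
    - F x (push hpr u) (push hpr v).
Proof.
move=> tu tv; have sf1 := smooth_f1 pk kZ sf.
have sh : smooth (fun z : MP => - f1 (hpr z)) by apply: (smoothN mMP); exact: (smooth_comp_proj sf1).
have e : extd etah y u v = extd (fun z w => - f1 (hpr z) * mu z w) y u v.
  apply: (extd_eq mMP setah (smooth_form1Z mMP sh smu)) => // z w tw.
  by rewrite /mu /form1_endo /dfun mulNr cone_J_time// opprK.
have dE w : tangent y w -> w (fun z : MP => - f1 (hpr z)) = - push hpr w f1.
  by move=> tw; rewrite (tangentN_fun mMP tw (smooth_comp_proj sf1)) push_smoothE.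
move: e; rewrite (extd_cone_eta tu tv) (extdZ mMP sh smu tu tv) !dE// /mu /form1_endo /dfun => ->; ring.
Qed.

(** After multiplication by f1, the Z and JZ parts of the projections cancel through F (Z, .) = - d
    f1 and Z f1 = 0, and the remaining terms because F is of type (1,1). *)
Lemma extd_mu_J u v : tangent y u -> tangent y v ->
  extd mu y (Jh y u) v + extd mu y u (Jh y v) = 0.
Proof.
move=> tu tv; have [tA tB] := (tpush tu, tpush tv); have [tJu tJv] := (tJh tu, tJh tv).
have [tA' tB'] := (tpush tJu, tpush tJv).
apply: (mulfI (f10 x)); rewrite mulr0 mulrDr !extd_mu// !cone_JK//.
rewrite (curvature_anti pk kZ tB' tA) !curvature_cone_J// !fun_cone_J// Z_f1 !tvecNE.
have := curvature_skew pk kZ sf fE tA tB; have := curvature_anti pk kZ tA (tJ tB) => -> ->; ring.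
Qed.

Lemma nijenhuis_time X Y : vector_field X -> vector_field Y -> nijenhuis Jh X Y y tt = 0.
Proof.
move=> vX vY; have := form1_nijenhuis mMP cJh y sdt vX vY.
have [tX tY] := (vf_tangent y vX, vf_tangent y vY).
rewrite -/mu extd_mu_J// !(extd_dfun mMP stt)//; [|exact: tJh|exact: tJh].
by rewrite subr0 addr0.
Qed.

(** Here eta o Jh = f1 dt has the simple derivative d f1 ^ dt, while d eta = F, and both are known
    on vectors of the form Jh u. *)
Lemma nijenhuis_eta X Y : vector_field X -> vector_field Y -> etah y (nijenhuis Jh X Y y) = 0.
Proof.
move=> vX vY; have := form1_nijenhuis mMP cJh y setah vX vY.
have [tu tv] := (vf_tangent y vX, vf_tangent y vY); set u := X y in tu *; set v := Y y in tv *.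
have [tA tB] := (tpush tu, tpush tv); have [tJu tJv] := (tJh tu, tJh tv).
have [tA' tB'] := (tpush tJu, tpush tJv).
have sf1 := smooth_f1 pk kZ sf; have sfh := smooth_comp_proj sf1.
have e w w' : tangent y w -> tangent y w' -> extd (form1_endo Jh etah) y w w' =
    push hpr w f1 * w' tt - push hpr w' f1 * w tt.
  move=> tw tw'.
  rewrite (extd_eq mMP (smooth_form1_endo cJh setah) (smooth_form1Z mMP sfh sdt) _ tw tw').
    rewrite (extdZ mMP sfh sdt tw tw') (extd_dfun mMP stt tw tw') mulr0 addr0.
    by rewrite !push_smoothE.
  by move=> z w'' tw''; rewrite /form1_endo; have [_ -> _] := cone_J_split tw''.
rewrite !e// !extd_cone_eta// curvature_cone_J// => ->.
rewrite (curvature_anti pk kZ tB' (tJ tA)) curvature_cone_J; [|exact: tv|exact: tJ].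
rewrite (endoK cJ tA) !fun_cone_J// Z_f1.
rewrite (curvature_anti pk kZ (tJ tA) (tJ tB)) (curvature_J pk kZ sf fE tA tB) tvecNE.
have FB : J x (push hpr (Jh y v)) f1 = v tt * J x (Z x) f1 - (Jh y v) tt * Z x f1 - push hpr v f1.
  have [-> _ _] := cone_J_split tv.
  have [t1 t2] := (tangentZ ((Jh y v) tt) tJZ, tangentZ (v tt) tZ).
  rewrite (endoD cJ (tangentD t1 t2) (tJ tB)) (endoD cJ t1 t2) !(endoZ cJ)// !(endoK cJ)//.
  by rewrite !(tvecDE, tvecZE, tvecNE); ring.
rewrite FB Z_f1; ring.
Qed.

(** Tested on h, the form d (h o hpr) o Jh is the pullback of dh o J plus (Z h) dt plus (JZ h) mu.
    Its derivative is expanded on Jh u and Jh v, and everything reduces to identities for dh o J on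
    M and to [extd_mu_J]. *)
Lemma nijenhuis_proj X Y : vector_field X -> vector_field Y -> push hpr (nijenhuis Jh X Y y) = 0.
Proof.
move=> vX vY; have tN := nijenhuis_tangent mMP cJh y vX vY.
apply: (tangent_ext (tpush tN) (tangent0 x)) => h sh; rewrite tvec0E push_smoothE//.
have shh := smooth_comp_proj sh.
have := form1_nijenhuis mMP cJh y (smooth_form1_dfun shh) vX vY; rewrite {1}/dfun => ->.
have [tu tv] := (vf_tangent y vX, vf_tangent y vY); set u := X y in tu *; set v := Y y in tv *.
have [tA tB] := (tpush tu, tpush tv); have [tJu tJv] := (tJh tu, tJh tv).
have [tA' tB'] := (tpush tJu, tpush tJv).
rewrite !(extd_dfun mMP shh)// subr0 addr0.
pose phi q := Z q h; pose psi q := J q (Z q) h.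
have sphi : smooth phi by exact: (vf_smooth vZ sh).
have spsi : smooth psi by exact: (vf_smooth (endo_vf cJ vZ) sh).
have [sphih spsih] := (smooth_comp_proj sphi, smooth_comp_proj spsi).
pose a0 := form1_endo J (dfun h).
have sa0 : smooth_form1 a0 by apply: (smooth_form1_endo cJ); exact: smooth_form1_dfun.
have sp0 := smooth_pull1 mMP mM shpr sa0.
have s1 := smooth_form1Z mMP sphih sdt; have s2 := smooth_form1Z mMP spsih smu.
have e w w' : tangent y w -> tangent y w' -> extd (form1_endo Jh (dfun (h \o hpr))) y w w' =
    extd a0 x (push hpr w) (push hpr w') + (push hpr w phi * w' tt - push hpr w' phi * w tt)
    + (push hpr w psi * (Jh y w') tt - push hpr w' psi * (Jh y w) tt + psi x * extd mu y w w').
  move=> tw tw'.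
  rewrite (extd_eq mMP (smooth_form1_endo cJh (smooth_form1_dfun shh))
    (smooth_form1D mMP (smooth_form1D mMP sp0 s1) s2) _ tw tw').
    rewrite (extdD mMP (smooth_form1D mMP sp0 s1) s2 tw tw') (extdD mMP sp0 s1 tw tw').
    rewrite (extdZ mMP sphih sdt tw tw') (extdZ mMP spsih smu tw tw') (extd_dfun mMP stt tw tw').
    rewrite (extd_pull1 mMP mM shpr sa0 tw tw') mulr0 addr0.
    by rewrite !push_smoothE.
  move=> z w'' tw''; rewrite /form1_endo {1}/dfun -(push_smoothE hpr _ sh).
  have [-> _ _] := cone_J_split tw''.
  by rewrite !(tvecDE, tvecZE) /mu /form1_endo /dfun /pull1 /a0 /form1_endo /dfun /phi /psi /=; ring.
rewrite !e//.
have sd0 := smooth_extd mM sa0.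
have dZ B : tangent x B -> extd a0 x (Z x) B = J x B phi - B psi.
  by move=> tB0; exact: (dJ_Z pk kZ sf fE sh tB0).
(* From the value on Z, since d (dh o J) is of type (1,1). *)
have dJZ B : tangent x B -> extd a0 x (J x (Z x)) B = B phi + J x B psi.
  move=> tB0; have := dJ_J pk sh tZ tB0; rewrite -/a0 dZ ?(endoK cJ)//; last exact: tJ.
  by rewrite tvecNE => H; lra.
have dJh w B : tangent y w -> tangent x B -> extd a0 x (push hpr (Jh y w)) B =
   (Jh y w) tt * (B phi + J x B psi) + w tt * (J x B phi - B psi) + extd a0 x (J x (push hpr w)) B.
  by move=> tw tB0; rewrite (tensor2_cone_J sd0 tw tB0) dZ// dJZ.
(* Antisymmetry on the pair (Z, Z): the derivatives of h along Z and JZ commute. *)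
have dZZ : J x (Z x) phi = Z x psi.
  by have := dZ _ tZ; have := extd_anti mM sa0 tZ tZ; lra.
rewrite (extd_anti mM sa0 tB' tA) !dJh// !fun_cone_J// !cone_JK// !tvecNE.
have := extd_mu_J tu tv; have := dJ_J pk sh tA tB; rewrite -/a0.
rewrite (extd_anti mM sa0 (tJ tB) tA) dZZ => H1 H2.
have -> : extd mu y u (Jh y v) = - extd mu y (Jh y u) v by lra.
have -> : extd a0 x (J x (push hpr v)) (push hpr u) = extd a0 x (J x (push hpr u)) (push hpr v) by lra.
ring.
Qed.

End integrability.

Lemma cone_integrable : Defs.integrable Jh.
Proof.
move=> X Y vX vY y; rewrite -/(nijenhuis Jh X Y y).
apply: (tangent_split_inj (nijenhuis_tangent mMP cJh y vX vY) (tangent0 y)).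
- by rewrite nijenhuis_proj// push0.
- by rewrite nijenhuis_eta// (form1_0 y setah).
- by rewrite nijenhuis_time.
Qed.

Lemma cone_pseudo_kahler : pseudo_kahler gh Jh.
Proof.
split; last exact: cone_integrable.
split; [exact: cone_pseudo_riemannian|exact: cJh| |exact: cone_closed].
by move=> y u v; exact: cone_J_skew.
Qed.

Let txi y : tangent y (xi y). Proof. exact: tangent_partial_t. Qed.

Lemma cone_proj_partial_t y : push hpr (xi y) = 0.
Proof. by rewrite (cone_projE (txi y)) push_fst_partial_t// push0. Qed.

Lemma cone_eta_partial_t y : etah y (xi y) = 0.
Proof. by rewrite /cone_eta /pull1 push_fst_partial_t// (form1_0 y.1 seta). Qed.

Lemma cone_time_partial_t y : xi y tt = 1.
Proof. exact: (partial_t_snd mP). Qed.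

Lemma lie_invariant_cone_metric0 : lie_invariant2 xi cone_metric0.
Proof.
have vxi := vector_field_partial_t mP; have xi0 := cone_proj_partial_t.
have ie : lie_invariant1 xi etah.
  by apply: (lie_invariant1_pull mMP vxi mP sfst) => // y; exact: push_fst_partial_t.
have idt : lie_invariant1 xi (dfun tt).
  by apply: (lie_invariant1_dfun mMP) => //; exists 1 => y; exact: cone_time_partial_t.
have ida : lie_invariant1 xi (pull1 hpr (dfun f)).
  by apply: (lie_invariant1_pull mMP vxi mM shpr) => //; exact: smooth_form1_dfun.
have sfh : smooth (fun x => 2 * f x) by apply: (smoothM mM) => //; exact: smooth_cst.
have s2 := smooth_tensor2_prod mMP.
have se := smooth_tensor2Z mMP s2f1 (s2 _ _ setah setah).
have st := smooth_tensor2Z mMP s2f (s2 _ _ sdt sdt).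
have sp := smooth_pull2 mMP mM shpr sg.
have i1 := lie_invariant2Z vxi s2f1 (s2 _ _ setah setah)
  (fun y => push_zero_fun xi0 y smooth_inv_f1) (lie_invariant2_prod vxi setah setah ie ie).
have i2 := lie_invariant2Z vxi s2f (s2 _ _ sdt sdt)
  (fun y => push_zero_fun xi0 y sfh) (lie_invariant2_prod vxi sdt sdt idt idt).
have ip := lie_invariant2_pull mMP vxi mM shpr xi0 sg.
have i3 := lie_invariant2D vxi (s2 _ _ sda sdt) (s2 _ _ sdt sda)
  (lie_invariant2_prod vxi sda sdt ida idt) (lie_invariant2_prod vxi sdt sda idt ida).
have s3 := smooth_tensor2D mMP (s2 _ _ sda sdt) (s2 _ _ sdt sda).
have s4 := smooth_tensor2D mMP se sp; have i4 := lie_invariant2D vxi se sp i1 ip.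
have s5 := smooth_tensor2D mMP s4 st; have i5 := lie_invariant2D vxi s4 st i4 i2.
exact: (lie_invariant2D vxi s5 s3 i5 i3).
Qed.

Lemma cone_conical : conical gh xi.
Proof.
have vxi := vector_field_partial_t mP; have sE := smooth_exp_time; have sfh := smooth_comp_proj sf.
have gxi y v : tangent y v -> gh y (xi y) v =
    expR (2 * tt y) * (2 * f (hpr y) * v tt + push hpr v f).
  move=> tv; rewrite /cone_metric /pull2 /pull1 /dfun cone_proj_partial_t cone_eta_partial_t.
  rewrite cone_time_partial_t (tensor2_0l sg (tpush tv)) tvec0E; congr (_ * _); ring.
apply: (@conical_criterion _ _ mMP xi vxi gh (fun y => expR (2 * tt y) * f (hpr y))).
- exact: cone_pseudo_riemannian.
- move=> y; rewrite gxi// cone_time_partial_t cone_proj_partial_t tvec0E addr0 mulr1.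
  by rewrite !mulf_neq0// gt_eqF// expR_gt0.
- exact: (smoothM mMP).
- move=> y v tv; rewrite gxi// (tangent_mul tv sE sfh) (tangent_exp_time tv) push_smoothE//.
  by rewrite /comp; ring.
- move=> X Y y vX vY; rewrite (tangent_mul (txi y) sE (tensor2_smooth smooth_cone_metric0 vX vY)).
  rewrite (tangent_exp_time (txi y)) cone_time_partial_t lie_invariant_cone_metric0//.
  have gE u v : gh y u v = expR (2 * tt y) * cone_metric0 y u v by [].
  by rewrite !gE; ring.
Qed.

Lemma tangent_slice t p u : tangent p u -> tangent (slice t p : MP) (push (@slice R P t) u).
Proof. exact: (push_tangent mP mMP (smooth_map_at_slice mP t)). Qed.

Lemma cone_proj_slice t (u : tvec P) : push hpr (push (@slice R P t) u) = push pr u.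
Proof. by rewrite (push_push _ _ mMP mM shpr). Qed.

Lemma cone_eta_slice t p u : tangent p u -> etah (slice t p) (push (@slice R P t) u) = eta p u.
Proof. by move=> tu; rewrite /cone_eta /pull1 (push_fst_slice mP t tu). Qed.

Lemma cone_time_slice t p u : tangent p u -> push (@slice R P t) u tt = 0.
Proof. exact: slice_snd. Qed.

(** With a = c = 0 the components of Jh u are (J A, 0, 0); having no dt-component, Jh u comes from a
    vector on the slice. *)
Lemma cone_J_horizontal t p u : tangent p u -> eta p u = 0 ->
  exists u', [/\ tangent p u', eta p u' = 0,
    push (@slice R P t) u' = Jh (slice t p) (push (@slice R P t) u)
  & push pr u' = J (pr p) (push pr u)].
Proof.
move=> tu u0; have ts := tangent_slice t tu; have tJs := tJh ts.
have [hE eE tE] := cone_J_split ts.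
move: hE eE tE; rewrite (cone_time_slice t tu) (cone_eta_slice t tu) cone_proj_slice u0 mul0r oppr0 mulr0.
move=> hE eE tE; move: hE; rewrite tE !scale0r !add0r => hE.
exists (push (fun y : MP => y.1 : P) (Jh (slice t p) (push (@slice R P t) u))); split => //.
- exact: (push_tangent mMP mP sfst tJs).
- by rewrite {2}(tangent_prodR mP tJs) tE scale0r addr0.
- by rewrite -(cone_projE tJs) hE.
Qed.

(** A vector of the form Jh u' with u' tangent to the slice satisfies eta (Jh u') = f1 dt (u') = 0,
    which gives one inclusion; horizontal vectors are stable under Jh, which gives the other. *)
Lemma cone_CR p : CR_distribution (@slice R P 0) Jh p =
  push (@slice R P 0) @` [set u | tangent p u /\ eta p u = 0].
Proof.
apply/seteqP; split => [w [[u /= tu uw] [_ [u' /= tu' <-] Jw]]|_ [u /= [tu u0] <-]].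
- exists u => //; split => //; rewrite -(cone_eta_slice 0 tu) uw -Jw.
  have [_ -> _] := cone_J_split (tangent_slice 0 tu').
  by rewrite (cone_time_slice 0 tu') mulr0.
- split; first by exists u.
  have [u' [tu' u'0 u'E _]] := cone_J_horizontal 0 tu u0.
  (* The preimage of [u] under Jh is - Jh u. *)
  exists (push (@slice R P 0) (-1 *: u')); first by exists (-1 *: u') => //; exact: tangentZ.
  have ts := tangent_slice 0 tu.
  rewrite pushZ u'E (endoZ cJh); last exact: tJh.
  by rewrite (endoK cJh ts) scaleN1r opprK.
Qed.

Lemma cone_proj_fundamental (y : MP) : push hpr (push (@slice R P y.2) (XP y.1)) = 0.
Proof. by rewrite cone_proj_slice (push_proj_fundamental bundle). Qed.

Let tXP p : tangent p (XP p). Proof. exact: (vf_tangent p (vector_field_fundamental bundle)). Qed.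

Let tsXP (y : MP) : tangent y (push (@slice R P y.2) (XP y.1)).
Proof. by case: y => p t; exact: tangent_slice. Qed.

Lemma cone_eta_fundamental (y : MP) : etah y (push (@slice R P y.2) (XP y.1)) = 1.
Proof.
case: y => p t; rewrite [LHS](cone_eta_slice t (tXP p)); by case: conn.
Qed.

Lemma ker_cone_proj y u : tangent y u ->
  push hpr u = 0 <-> exists a b : R, u = a *: push (@slice R P y.2) (XP y.1) + b *: xi y.
Proof.
move=> tu; split => [u0|[a [b ->]]]; last first.
  by rewrite push_comb pushZ cone_proj_fundamental cone_proj_partial_t !scaler0 addr0.
exists (etah y u), (u tt).
have tb := tangentZ (u tt) (txi y); have ta := tangentZ (etah y u) (tsXP y).
apply: (tangent_split_inj tu (tangentD ta tb)).
- by rewrite push_comb pushZ cone_proj_fundamental cone_proj_partial_t !scaler0 addr0.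
- rewrite (form1_comb setah _ (tsXP y) tb) (form1Z setah _ (txi y)) cone_eta_partial_t.
  by rewrite cone_eta_fundamental mulr0 addr0 mulr1.
- by rewrite tvecE_comb tvecZE (cone_time_slice _ (tXP y.1)) cone_time_partial_t mulr0 add0r mulr1.
Qed.

(** The fundamental field has components (0, 1, 0), so its image under Jh projects to - JZ / f1, and
    JZ is nonzero because g (JZ, JZ) = g (Z, Z). *)
Lemma cone_J_fundamental (y : MP) : push hpr (Jh y (push (@slice R P y.2) (XP y.1))) != 0.
Proof.
apply/eqP => H; set x := hpr y; have tZ := vf_tangent x vZ; have tJZ := endo_tangent cJ tZ.
have [hE eE tE] := cone_J_split (tsXP y).
move: hE; rewrite H tE cone_eta_fundamental cone_proj_fundamental (cone_time_slice _ (tXP y.1)).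
rewrite (endo0 cJ) scale0r !addr0 -/x => /esym JZ0.
have := Z0 x; rewrite -(pk_isometry pk tZ tZ).
have -> : J x (Z x) = 0.
  apply/eqP; move/eqP: JZ0; rewrite scaler_eq0 oppr_eq0 mulf_eq0 oner_eq0 invr_eq0.
  by rewrite (negbTE (f10 _)).
by rewrite (tensor2_0l sg (tangent0 x)) eqxx.
Qed.

(** A point of [M] is assumed because over the empty manifold the identity holds vacuously; a local
    section turns it into a point of the cone. *)
Lemma cone_proj_not_holomorphic : (exists x : M, True) ->
  ~ forall y u, tangent y u -> push hpr (Jh y u) = J (hpr y) (push hpr u).
Proof.
move=> [x _] H; have [_ _ _ _ /(_ x)[U [chi1 [chi2 [sigma [_ _ _]]]]]] := bundle.
have := cone_J_fundamental (slice 0 (sigma x)).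
by rewrite H// cone_proj_fundamental (endo0 cJ) eqxx.
Qed.

Lemma cone_metricE y u v : tangent y u -> tangent y v ->
  gh y u v = expR (2 * tt y) * (2 / f1 (hpr y) * (etah y u * etah y v)
    + g (hpr y) (push hpr u) (push hpr v) + 2 * f (hpr y) * (u tt * v tt)
    - (g (hpr y) (J (hpr y) (Z (hpr y))) (push hpr u) * v tt
       + u tt * g (hpr y) (J (hpr y) (Z (hpr y))) (push hpr v))).
Proof.
move=> tu tv; rewrite /cone_metric /pull2 (pull_df tu) (pull_df tv) /dfun; congr (_ * _); ring.
Qed.

Lemma ord2P (i : 'I_2) : i = 0 \/ i = 1.
Proof. by case: i => -[|[|//]] ?; [left|right]; exact: val_inj. Qed.

(** The vector with components (JZ, 0, 1) is orthogonal to all (A, 0, 0) since alpha = - g (JZ, .),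
    and up to exp (2 t) its square is g (Z, Z) + 2 f - 2 g (Z, Z) = 2 f1. Both added vectors
    therefore have the sign of f1. *)
Lemma cone_frame y (I : finType) (s : I -> R) e : ortho_frame g (hpr y) s e ->
  exists e', ortho_frame gh y
    (fun i : I + 'I_2 => match i with inl i => s i | inr _ => Num.sg (f1 (hpr y)) end) e'.
Proof.
set x := hpr y => -[te se ge].
have tZ := vf_tangent x vZ; have tJZ := endo_tangent cJ tZ.
have f1x : f1 x != 0 := f10 x.
(* r undoes the conformal factor; b and q normalise the squares 2 / f1 and 2 f1 of the two added
   vectors to the sign of f1. *)
pose r := expR (- tt y); pose b := r * Num.sqrt (`|f1 x| / 2); pose q := r / Num.sqrt (2 * `|f1 x|).
have n0 : 0 < `|f1 x| by rewrite normr_gt0.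
have r0 : r != 0 by rewrite gt_eqF// expR_gt0.
have b0 : b != 0 by rewrite mulf_neq0// gt_eqF// sqrtr_gt0 divr_gt0.
have q0 : q != 0 by rewrite mulf_neq0// invr_eq0 gt_eqF// sqrtr_gt0 mulr_gt0.
have ErE : expR (2 * tt y) * (r * r) = 1.
  by rewrite -!expRD (_ : _ + _ = 0) ?expR0//; ring.
have bE : b * b = r * r * (Num.sg (f1 x) * f1 x / 2).
  by rewrite -normrEsg mulrACA -[Num.sqrt _ * _]expr2 sqr_sqrtr// divr_ge0// ltW.
have qE : q * q = r * r / (2 * `|f1 x|).
  by rewrite mulrACA -invfM -[Num.sqrt _ * _]expr2 sqr_sqrtr// mulr_ge0// ltW.
have /choice[L HL] : forall i, exists u, [/\ tangent y u, push hpr u = r *: e i, etah y u = 0 & u tt = 0].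
  by move=> i; apply: tangent_split_exists; exact: tangentZ.
have [U [tU UA Ua Uc]] := @tangent_split_exists y 0 b 0 (tangent0 _).
have [V [tV VA Va Vc]] := @tangent_split_exists y (q *: J x (Z x)) 0 q (tangentZ q tJZ).
pose e' (i : I + 'I_2) := match i with inl i => L i | inr j => if j == 0 then U else V end.
have te' i : tangent y (e' i) by case: i => [i|j]; [case: (HL i)|rewrite /e'; case: ifP].
have tL i : tangent y (L i) by case: (HL i).
have gLL i j : gh y (L i) (L j) = if i == j then s i else 0.
  have [[_ iA ia ic] [_ jA ja jc]] := (HL i, HL j).
  rewrite (cone_metricE (tL i) (tL j)) iA jA ia ja ic jc -/x (tensor2Zl sg _ (te i) (tangentZ r (te j))).
  rewrite (tensor2Zr sg _ (te j) (te i)) -ge.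
  transitivity (expR (2 * tt y) * (r * r) * g x (e i) (e j)); first by ring.
  by rewrite ErE mul1r.
have gLU i : gh y (L i) U = 0.
  have [_ iA ia ic] := HL i.
  rewrite (cone_metricE (tL i) tU) iA ia ic UA Ua Uc -/x.
  by rewrite (tensor2_0r sg (tangentZ r (te i))); ring.
have gLV i : gh y (L i) V = 0.
  have [_ iA ia ic] := HL i.
  rewrite (cone_metricE (tL i) tV) iA ia ic VA Va Vc -/x.
  rewrite (tensor2Zr sg _ tJZ (tangentZ r (te i))) (pk_sym pk (tangentZ r (te i)) tJZ); ring.
have gUV : gh y U V = 0.
  rewrite (cone_metricE tU tV) UA Ua Uc VA Va Vc -/x (tensor2_0l sg (tangentZ q tJZ)).
  by rewrite (tensor2_0r sg tJZ); ring.
have gUU : gh y U U = Num.sg (f1 x).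
  rewrite (cone_metricE tU tU) UA Ua Uc -/x (tensor2_0l sg (tangent0 x)) (tensor2_0r sg tJZ) bE.
  transitivity (expR (2 * tt y) * (r * r) * Num.sg (f1 x)); first by field; exact: f1x.
  by rewrite ErE mul1r.
have gVV : gh y V V = Num.sg (f1 x).
  rewrite (cone_metricE tV tV) VA Va Vc -/x (tensor2Zl sg _ tJZ (tangentZ q tJZ)).
  rewrite !(tensor2Zr sg _ tJZ tJZ) (pk_isometry pk tZ tZ) mul0r mulr0 add0r.
  have -> : f x = f1 x + 2^-1 * g x (Z x) (Z x) by rewrite /shifted_moment subrK.
  rewrite (_ : _ - _ = 2 * f1 x * (q * q)); last by field.
  rewrite qE {1}[f1 x]numEsg.
  transitivity (expR (2 * tt y) * (r * r) * Num.sg (f1 x)); first by field; rewrite gt_eqF.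
  by rewrite ErE mul1r.
have gUL i : gh y U (L i) = 0 by rewrite cone_metric_sym.
have gVL i : gh y V (L i) = 0 by rewrite cone_metric_sym.
have gVU : gh y V U = 0 by rewrite cone_metric_sym.
exists e'; split => // [u tu|[i|i] [j|j]]; last first.
- rewrite /e' (inj_eq (@inr_inj _ _)).
  by case: (ord2P i) => ->; case: (ord2P j) => -> /=.
- by rewrite /e'; case: ifP.
- by rewrite /e'; case: ifP.
- by rewrite /e' gLL (inj_eq (@inl_inj _ _)).
have big2 (W : nmodType) (G : I + 'I_2 -> W) :
    \sum_i G i = \sum_i G (inl i) + (G (inr 0) + G (inr 1)).
  rewrite big_sumType /= big_ord_recl big_ord1; congr (_ + (_ + G (inr _))).
  exact: val_inj.
have tA : tangent x (push hpr u - u tt *: J x (Z x)).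
  by apply: tangentB; [exact: tpush|exact: tangentZ].
(* The vector [V] already accounts for u tt times JZ in the projection, so only the remainder is
   expanded in the frame of M. *)
have [c cE] := se _ tA.
pose c' (i : I + 'I_2) : R := match i with
  | inl i => r^-1 * c i | inr j => if j == 0 then etah y u / b else u tt / q end.
exists c'; have tS : tangent y (\sum_i c' i *: e' i).
  by apply: tangent_sum => i _; exact: tangentZ.
apply: (tangent_split_inj tu tS).
- rewrite push_sum big2 /= UA VA scaler0 add0r scalerA divfK//.
  rewrite -[LHS](subrK (u tt *: J x (Z x))) cE; congr (_ + _).
  by apply: eq_bigr => i _; have [_ -> _ _] := HL i; rewrite scalerA mulrAC mulVf ?mul1r.
- rewrite (form1_sum setah _ _ te') big2 /= Ua Va mulr0 addr0 divfK// big1 ?add0r// => i _.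
  by have [_ _ -> _] := HL i; rewrite mulr0.
- rewrite tvec_sumE big2 -[RHS]/(\sum_i (r^-1 * c i) * L i tt + (etah y u / b * U tt + u tt / q * V tt)).
  rewrite Uc Vc mulr0 add0r divfK// big1 ?add0r// => i _.
  by have [_ _ _ ->] := HL i; rewrite mulr0.
Qed.

Lemma cone_signature k l : has_signature g (2 * k) (2 * l) ->
  ((forall x, 0 < f1 x) -> has_signature gh (2 * k + 2) (2 * l)) /\
  ((forall x, f1 x < 0) -> has_signature gh (2 * k) (2 * l + 2)).
Proof.
move=> /has_signatureP Hg; split => f1s; apply/has_signatureP => y.
- have [e /cone_frame[e' He']] := Hg (hpr y).
  exists (e' \o @insert_mid _ _ _); rewrite sign_insert_mid.
  have := ortho_frame_reindex (insert_mid_bij _ _ _) He'.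
  congr ortho_frame; apply: funext => i /=.
  by case: (insert_mid i) => // _; rewrite gtr0_sg.
- have [e /cone_frame[e' He']] := Hg (hpr y).
  exists (e' \o @insert_end _ _ _); rewrite sign_insert_end.
  have := ortho_frame_reindex (insert_end_bij _ _ _) He'.
  congr ortho_frame; apply: funext => i /=.
  by case: (insert_end i) => // _; rewrite ltr0_sg.
Qed.

End conification.

Theorem theorem1 (R : realType) (M P : premanifold R)
    (g : tensor2 M) (J : endo M) (Z : vfield M) (f : M -> R)
    (pr : P -> M) (act : R -> P -> P) (eta : form1 P) :
  let omega : tensor2 M := fundamental_form g J in
  let f1 : M -> R := fun x => f x - 2^-1 * g x (Z x) (Z x) in
  let beta : form1 M := fun x u => g x (Z x) u in
  let alpha : form1 M := dfun f in
  pseudo_kahler g J ->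
  killing g Z ->
  (forall x, g x (Z x) (Z x) != 0) ->
  smooth f ->
  (forall x u, tangent x u -> dfun f x u = - omega x (Z x) u) ->
  (forall x, f x != 0) ->
  (forall x, f1 x != 0) ->
  principal_circle_bundle pr act ->
  principal_connection act eta ->
  (forall p u v, tangent p u -> tangent p v ->
     extd eta p u v =
     pull2 pr (fun x a b => omega x a b - 2^-1 * extd beta x a b) p u v) ->
  let XP : vfield P := fundamental_vf act in
  let Mh : premanifold R := prodR P in
  let hpr : Mh -> M := fun y => pr y.1 in
  let prP : Mh -> P := fun y => y.1 in
  let t : Mh -> R := fun y => y.2 in
  let dt : form1 Mh := dfun t in
  let etah : form1 Mh := pull1 prP eta in
  let alphah : form1 Mh := pull1 hpr alpha in
  let betah : form1 Mh := pull1 hpr beta in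
  let xi : vfield Mh := @partial_t R P in
  let gh : tensor2 Mh := fun y u v =>
    expR (2 * t y) *
    (2 / f1 (hpr y) * (etah y u * etah y v) + pull2 hpr g y u v
     + 2 * f (hpr y) * (dt y u * dt y v)
     + (alphah y u * dt y v + dt y u * alphah y v)) in
  let theta : form1 Mh := fun y u =>
    expR (2 * t y) * (etah y u + 2^-1 * betah y u) in
  let omegah : tensor2 Mh := extd theta in
  let Jh : endo Mh := raise gh omegah in
  [/\ pseudo_riemannian gh,
      (forall y u v, tangent y u -> tangent y v ->
         omegah y u v = gh y (Jh y u) v) /\
      conical_pseudo_kahler gh Jh xi,
      (forall p : P, CR_distribution (@slice R P 0) Jh p =
         push (@slice R P 0) @` [set u | tangent p u /\ eta p u = 0]) /\
      (forall (p : P) u, tangent p u -> eta p u = 0 ->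
         exists u', [/\ tangent p u', eta p u' = 0,
           push (@slice R P 0) u' = Jh (slice 0 p) (push (@slice R P 0) u)
         & push pr u' = J (pr p) (push pr u)]),
      [/\ forall (y : Mh) u, tangent y u ->
            (push hpr u = 0 <->
             exists a b : R, u = a *: push (@slice R P y.2) (XP y.1) + b *: xi y),
          forall y : Mh, ~ (forall u, tangent y u -> push hpr u = 0 ->
                              push hpr (Jh y u) = 0)
        & (exists x : M, True) ->
          ~ (forall (y : Mh) u, tangent y u ->
               push hpr (Jh y u) = J (hpr y) (push hpr u))]
    & forall k l : nat, has_signature g (2 * k) (2 * l) ->
        ((forall x, 0 < f1 x) -> has_signature gh (2 * k + 2) (2 * l)) /\
        ((forall x, f1 x < 0) -> has_signature gh (2 * k) (2 * l + 2))].
Proof.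
move=> omega f1 beta alpha pk kZ Z0 sf fE f0 f10 bundle conn curv
  XP Mh hpr prP t dt etah alphah betah xi gh theta omegah Jh.
(* The objects bound in the statement are convertible with [cone_metric], [cone_primitive] and their
   companions, so the results on the cone apply as they stand. *)
split.
- exact: (cone_pseudo_riemannian pk kZ sf fE f10 bundle conn).
- split => [y u v tu tv|].
    apply: esym; exact: ((cone_J_spec pk kZ fE f10 bundle conn curv tu).2 v tv).
  split; first exact: (cone_pseudo_kahler pk kZ sf fE f10 bundle conn curv).
  exact: (cone_conical pk kZ sf fE f0 f10 bundle conn).
- split; first exact: (cone_CR pk kZ sf fE f10 bundle conn curv).
  exact: (cone_J_horizontal pk kZ sf fE f10 bundle conn curv 0).
- split.
  + exact: (ker_cone_proj pk bundle conn).
  + move=> y H; have := cone_J_fundamental pk kZ Z0 sf fE f10 bundle conn curv y.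
    case/eqP; apply: (H (push (@slice R P y.2) (XP y.1))).
      by case: y {H} => p s; exact: (tangent_slice bundle s (vf_tangent p (vector_field_fundamental bundle))).
    exact: (cone_proj_fundamental pk bundle y).
  + exact: (cone_proj_not_holomorphic pk kZ Z0 sf fE f10 bundle conn curv).
- move=> k l; exact: (cone_signature pk kZ fE f10 bundle conn).
Qed.
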